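(* Let $m\ge 1$ be an integer. For $\Lambda=(\alpha,\beta,\gamma)\in\mathbb{C}^3$ let $A(\Lambda)=\gamma T_{\overline{z}^m}+\alpha T_{z^m}+\beta I=T_{\gamma\overline{z}^m+\alpha z^m+\beta}$ acting on $L^2_a(\mathbb{D})$, let $P_e(A)=\{\Lambda\in\mathbb{C}^3: A(\Lambda)\text{ is not Fredholm}\}$, and assume $P_e^c(A):=\mathbb{C}^3\setminus P_e(A)=\Omega_0\cup\Omega_1\cup\Omega_2$, where for $i=0,1,2$ $$\Omega_i=\{(\alpha,\beta,\gamma)\in\mathbb{C}^3:\ \alpha t^2+\beta t+\gamma\text{ has } i \text{ zeros in } \mathbb{D} \text{ and has no zeros on } \mathbb{T}\}.$$ Then the following hold. (1) $\Omega_0=\{(\alpha,\beta,\gamma)\in\mathbb{C}^3: |\gamma|^2-|\alpha|^2>|\alpha\overline{\beta}-\beta\overline{\gamma}|\}$, and on $\Omega_0$ we have $\mathrm{ind}(T_{\gamma\overline{z}^m+\alpha z^m+\beta})=m$. (2) $\Omega_1=\{(\alpha,\beta,\gamma)\in\mathbb{C}^3: 2|\alpha|^2+2|\gamma|^2<|\beta|^2+|\beta^2-4\alpha\gamma|\}$, and on $\Omega_1$ we have $\mathrm{ind}(T_{\gamma\overline{z}^m+\alpha z^m+\beta})=0$. Moreover, $T_{\gamma\overline{z}^m+\alpha z^m+\beta}$ is invertible on $\Omega_1$. (3) $\Omega_2=\{(\alpha,\beta,\gamma)\in\mathbb{C}^3: |\alpha|^2-|\gamma|^2>|\alpha\overline{\beta}-\beta\overline{\gamma}|\}$,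 and on $\Omega_2$ we have $\mathrm{ind}(T_{\gamma\overline{z}^m+\alpha z^m+\beta})=-m$.
   Context: $\mathbb{D}$ is the open unit disk, $\mathbb{T}$ the unit circle, and $dA$ the normalized Lebesgue area measure on $\mathbb{D}$. The Bergman space $L^2_a(\mathbb{D})$ is the closed subspace of analytic functions in $L^2(\mathbb{D},dA)$, and $P:L^2(\mathbb{D},dA)\to L^2_a(\mathbb{D})$ is the orthogonal projection. For $\varphi\in L^\infty(\mathbb{D},dA)$ the Toeplitz operator on $L^2_a(\mathbb{D})$ is $T_\varphi f=P(\varphi f)$. The Fredholm index is $\mathrm{ind}(T)=\dim\ker T-\dim\ker T^*$. Zeros of the polynomial $\alpha t^2+\beta t+\gamma$ in $t$ are counted with multiplicity; the polynomial may have degree less than $2$, and the zero polynomial is regarded as having zeros on $\mathbb{T}$ (so it belongs to no $\Omega_i$). *)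

(* Defs.v *)
From HB Require Import structures.
From mathcomp Require Import all_boot all_order all_algebra.
From mathcomp Require Import complex.
From mathcomp Require Import all_classical all_reals all_analysis.

Set Implicit Arguments.
Unset Strict Implicit.
Unset Printing Implicit Defensive.

Import Order.TTheory GRing.Theory Num.Theory.
Import numFieldNormedType.Exports.

Local Open Scope classical_set_scope.
Local Open Scope ring_scope.
Local Open Scope complex_scope.

Section Dimension.
Context {K : fieldType} {E : lmodType K}.
Implicit Type V : set E.

Definition has_dim V (n : nat) : Prop :=
  exists b : 'I_n -> E,
    [/\ forall i, V (b i),
        forall c : 'I_n -> K, \sum_i c i *: b i = 0 -> forall i, c i = 0 &
        forall v, V v -> exists c : 'I_n -> K, v = \sum_i c i *: b i].

Definition finite_dim V : Prop := exists n, has_dim V n.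

(* Junk value 0 when V is not finite dimensional. *)
Definition dim V : nat := xget 0%N [set n | has_dim V n].

End Dimension.

(* Operators on a Hilbert space that is realized as a subspace H of an ambient
   vector space E.  An operator on H is a function E -> E of which only the
   values on H matter. *)
Section HilbertOperators.
Context {R : realType} {E : lmodType R[i]}.
Variables (H : set E) (ip : E -> E -> R[i]).
Implicit Type T S : E -> E.

Definition hnorm (x : E) : R := Num.sqrt (complex.Re (ip x x)).

Definition bounded_operator T : Prop :=
  [/\ forall x, H x -> H (T x),
      forall (a : R[i]) x y, H x -> H y -> T (a *: x + y) = a *: T x + T y &
      exists M : R, forall x, H x -> hnorm (T x) <= M * hnorm x].

Definition kernel T : set E := [set x | H x /\ T x = 0].

Definition adjoint T : E -> E :=
  fun y => xget 0 [set z | H z /\ forall x, H x -> ip (T x) y = ip x z].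

Definition closed_range T : Prop :=
  forall (u : nat -> E) (y : E), (forall n, H (u n)) -> H y ->
    (fun n => hnorm (T (u n) - y)) @ \oo --> (0 : R) -> (T @` H) y.

Definition fredholm T : Prop :=
  [/\ closed_range T, finite_dim (kernel T) & finite_dim (kernel (adjoint T))].

Definition fredholm_index T : int :=
  (dim (kernel T))%:Z - (dim (kernel (adjoint T)))%:Z.

Definition invertible T : Prop :=
  exists S, bounded_operator S /\
    forall x, H x -> S (T x) = x /\ T (S x) = x.

End HilbertOperators.

Section BergmanSpace.
Context {R : realType}.
Local Notation C := (R[i]).
Local Notation plane := (measurableTypeR R * measurableTypeR R)%type.

Definition unit_disk : set C := [set z | `|z| < 1].

Definition to_complex (p : plane) : C := (p.1 : R) +i* (p.2 : R).

Definition disk_xy : set plane := to_complex @^-1` unit_disk.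

Definition lebesgue2 : {measure set plane -> \bar R} :=
  (@lebesgue_measure R \x @lebesgue_measure R)%E.

(* Integral of a complex function over the disk against the normalized area
   measure dA = dx dy / pi. *)
Definition disk_integral (f : C -> C^o) : C :=
  (pi^-1 * \int[lebesgue2]_(p in disk_xy) complex.Re (f (to_complex p)))
  +i*
  (pi^-1 * \int[lebesgue2]_(p in disk_xy) complex.Im (f (to_complex p))).

Definition inner (f g : C -> C^o) : C :=
  disk_integral (fun z => (f z : C) * (g z : C)^*).

Definition square_integrable (f : C -> C^o) : Prop :=
  [/\ measurable_fun disk_xy
        (fun p => complex.Re (f (to_complex p)) : measurableTypeR R),
      measurable_fun disk_xy
        (fun p => complex.Im (f (to_complex p)) : measurableTypeR R) &
      (\int[lebesgue2]_(p in disk_xy)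
         ((complex.Re (`|f (to_complex p) : C| ^+ 2))%:E) < +oo)%E].

Definition analytic_at (f : C -> C^o) (z0 : C) : Prop :=
  exists (a : nat -> C) (r : R), 0 < r /\
    forall z : C, `|z - z0| < r%:C ->
      series (fun n => a n * (z - z0) ^+ n : C^o) @ \oo --> f z.

(* Functions on the disk are total functions on C; requiring the value 0
   outside the disk makes equality of elements equality on the disk. *)
Definition bergman : set (C -> C^o) :=
  [set f | [/\ forall z, unit_disk z -> analytic_at f z,
               square_integrable f &
               forall z, ~ unit_disk z -> f z = 0]].

Definition bergman_proj (g : C -> C^o) : C -> C^o :=
  xget 0 [set h | bergman h /\ forall k, bergman k -> inner (g - h) k = 0].

Definition toeplitz (phi : C -> C) (f : C -> C^o) : C -> C^o :=
  bergman_proj (fun z => phi z * (f z : C)).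

Definition bergman_fredholm := fredholm bergman inner.
Definition bergman_index := fredholm_index bergman inner.
Definition bergman_invertible := invertible bergman inner.

End BergmanSpace.

Section Pencil.
Context {R : realType}.
Local Notation C := (R[i]).

Definition symbol (m : nat) (L : C * C * C) : C -> C :=
  let: (alpha, beta, gamma) := L in
  fun z => gamma * z^* ^+ m + alpha * z ^+ m + beta.

Definition pencil (m : nat) (L : C * C * C) : (C -> C^o) -> (C -> C^o) :=
  let: (alpha, beta, gamma) := L in
  fun f => gamma *: toeplitz (fun z => z^* ^+ m) f
           + alpha *: toeplitz (fun z => z ^+ m) f + beta *: f.

Definition ess_spectrum (m : nat) : set (C * C * C) :=
  [set L | ~ bergman_fredholm (pencil m L)].

(* The roots of p listed with multiplicity, for p != 0. *)
Definition zeros (p : {poly C}) : seq C := sval (closed_field_poly_normal p).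

Definition quadratic (L : C * C * C) : {poly C} :=
  let: (alpha, beta, gamma) := L in
  alpha *: 'X^2 + beta *: 'X + gamma%:P.

(* The zero polynomial is excluded by the second condition. *)
Definition Omega (i : nat) : set (C * C * C) :=
  [set L | count (fun t => `|t| < 1) (zeros (quadratic L)) = i /\
           forall t : C, `|t| = 1 -> ~~ root (quadratic L) t].

End Pencil.

(* Main.v *)
Require Import Defs.
From HB Require Import structures.
From mathcomp Require Import all_boot all_order all_algebra.
From mathcomp Require Import complex.
From mathcomp Require Import all_classical all_reals all_analysis.
From mathcomp Require Import cyclic separable cyclotomic measurable_realfun ring lra.

(* In the monomial basis of the Bergman space, T_phi for phi = gamma conj(z)^m + alpha z^m + beta
   acts on Taylor coefficients by
     (T f)_n = alpha a_(n-m) + beta a_n + gamma c_n a_(n+m),  c_n = mu_(n+m) / mu_n,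
   where mu_n is the squared norm of z^n.  Only 0 < c_n <= 1 and c_n --> 1 are needed, so
   the area integrals are never computed in polar coordinates: orthogonality of monomials
   and Parseval's identity come from averaging over rotations by M-th roots of unity, plus
   Fatou's lemma.  That a locally analytic function on the disk has one Taylor series there
   is proved without contour integrals, from Cauchy's estimate (again by averaging over
   roots of unity) and compactness.

   Writing the parameters through the zeros t1, t2 of alpha t^2 + beta t + gamma:
   - if both lie in the disk, the recurrence T f = 0 factors asymptotically into two first
     order recurrences that expand forward, so the kernel is 0;
   - if both lie outside, all solutions decay geometrically, so the kernel has dimension m;
   - if they are separated by the circle, 0 lies outside the filled ellipse phi(D), hence
     |1 - u phi| <= q < 1 on D for some constant u, and the Neumann series of 1 - u T
     inverts T; closedness of the range replaces completeness of the Bergman space.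
   The adjoint is T_(conj phi), which exchanges the first two cases. *)

Set Implicit Arguments.
Unset Strict Implicit.
Unset Printing Implicit Defensive.

Import Order.TTheory GRing.Theory Num.Theory.
Import numFieldNormedType.Exports.
Import Normc.

Local Open Scope classical_set_scope.
Local Open Scope ring_scope.
Local Open Scope complex_scope.

(** * Complex moduli and series *)

(** The inequalities describing the regions are obtained by exclusion. Once zeros outside the closed
    disk are replaced by their inverses, every triple without zeros on the circle has one of three
    parametrizations by points of the disk; each satisfies its own inequality and violates the other
    two, while a zero on the circle violates all three. A triple satisfying one inequality therefore
    lies in some region, and in the expected one. Asymptotics of the recurrence cannot decide the
    case of separated zeros: one direction grows, one decays, and the solution fixed by the initial
    coefficients could fall into either. This is why that case is treated globally, through the
    values of the symbol. [dim], [adjoint] and [bergman_proj] are defined by choice with junk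
    values, so each of them is identified by exhibiting the object explicitly, on Taylor
    coefficients, together with uniqueness. *)

Section ComplexModulus.
Context {R : realType}.
Local Notation C := (R[i]).
Implicit Types z w : C.

(** The norm of [R[i]] takes values in [R[i]] itself; a real-valued modulus keeps all estimates in
    the ordered field [R]. *)
Definition cabs z : R := normc z.

Lemma normCE z : `|z| = (cabs z)%:C. Proof. by case: z. Qed.
Lemma cabs_ge0 z : 0 <= cabs z. Proof. by case: z => a b; exact: sqrtr_ge0. Qed.
Lemma cabs0 : cabs 0 = 0. Proof. exact: normc0. Qed.
Lemma cabs1 : cabs 1 = 1. Proof. exact: normc1. Qed.
Lemma cabsM z w : cabs (z * w) = cabs z * cabs w. Proof. exact: normcM. Qed.
Lemma cabsV z : cabs z^-1 = (cabs z)^-1. Proof. exact: normcV. Qed.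
Lemma cabsX z n : cabs (z ^+ n) = cabs z ^+ n.
Proof. by elim: n => [|n IH]; rewrite ?cabs1 // !exprS cabsM IH. Qed.
Lemma cabsN z : cabs (- z) = cabs z. Proof. exact: normcN. Qed.
Lemma cabsB z w : cabs (z - w) = cabs (w - z). Proof. by rewrite -cabsN opprB. Qed.
Lemma cabs_triangle z w : cabs (z + w) <= cabs z + cabs w.
Proof. exact: le_normcD. Qed.
Lemma cabs_triangleB z w : cabs (z - w) <= cabs z + cabs w.
Proof. by rewrite (le_trans (cabs_triangle _ _)) ?cabsN. Qed.
Lemma cabs_dist u z w : cabs (z - w) <= cabs (z - u) + cabs (u - w).
Proof. by apply: le_trans (cabs_triangle _ _); rewrite addrA subrK. Qed.
Lemma cabs_eq0 z : (cabs z == 0) = (z == 0).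
Proof. by apply/eqP/eqP => [/eq0_normc//|->]; exact: cabs0. Qed.
Lemma cabs_real (x : R) : cabs x%:C = `|x|.
Proof. by rewrite /cabs /= expr0n/= addr0 sqrtr_sqr. Qed.
Lemma cabsJ z : cabs z^*%R = cabs z.
Proof. by case: z => a b; rewrite /cabs /= sqrrN. Qed.
Lemma sqr_cabs z : cabs z ^+ 2 = complex.Re z ^+ 2 + complex.Im z ^+ 2.
Proof. by case: z => a b; rewrite /cabs/= sqr_sqrtr// addr_ge0 ?sqr_ge0. Qed.
Lemma cabs_sum (I : Type) (s : seq I) (P : pred I) (F : I -> C) :
  cabs (\sum_(i <- s | P i) F i) <= \sum_(i <- s | P i) cabs (F i).
Proof.
elim/big_rec2: _ => [|i x y _ le_yx]; first by rewrite cabs0.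
by rewrite (le_trans (cabs_triangle _ _)) ?lerD2l.
Qed.
Lemma ler_Re_cabs z : `|complex.Re z| <= cabs z.
Proof.
case: z => a b; rewrite /cabs/= -[leLHS]sqrtr_sqr ler_wsqrtr// lerDl; exact: sqr_ge0.
Qed.
Lemma ler_Im_cabs z : `|complex.Im z| <= cabs z.
Proof.
case: z => a b; rewrite /cabs/= -[leLHS]sqrtr_sqr ler_wsqrtr// lerDr; exact: sqr_ge0.
Qed.
Lemma cabs_le_ReIm z : cabs z <= `|complex.Re z| + `|complex.Im z|.
Proof.
rewrite {1}[z]complexE (le_trans (cabs_triangle _ _))// cabsM !cabs_real.
by rewrite (_ : cabs 'i%C = 1) ?mul1r// /cabs/= expr0n expr1n add0r sqrtr1.
Qed.
Lemma mul_conj z : z * z^*%R = (cabs z ^+ 2)%:C.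
Proof. by rewrite sqr_cabs add_Re2_Im2 sqr_normc. Qed.

Lemma conjcD z w : (z + w)^*%R = z^*%R + w^*%R. Proof. exact: rmorphD. Qed.
Lemma conjcN z : (- z)^*%R = - z^*%R. Proof. exact: rmorphN. Qed.
Lemma conjcM z w : (z * w)^*%R = z^*%R * w^*%R. Proof. exact: rmorphM. Qed.
Lemma conjcV z : (z^-1)^*%R = (z^*%R)^-1. Proof. exact: fmorphV. Qed.
Lemma conjcX z n : (z ^+ n)^*%R = z^*%R ^+ n. Proof. exact: rmorphXn. Qed.
Lemma conjc_sum (I : Type) (s : seq I) (P : pred I) (F : I -> C) :
  (\sum_(i <- s | P i) F i)^*%R = \sum_(i <- s | P i) (F i)^*%R.
Proof. exact: rmorph_sum. Qed.
Lemma cReJ z : complex.Re z^*%R = complex.Re z. Proof. by case: z. Qed.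
Lemma cImJ z : complex.Im z^*%R = - complex.Im z. Proof. by case: z. Qed.

Lemma cReD z w : complex.Re (z + w) = complex.Re z + complex.Re w.
Proof. by case: z; case: w. Qed.
Lemma cImD z w : complex.Im (z + w) = complex.Im z + complex.Im w.
Proof. by case: z; case: w. Qed.
Lemma cReN z : complex.Re (- z) = - complex.Re z. Proof. by case: z. Qed.
Lemma cImN z : complex.Im (- z) = - complex.Im z. Proof. by case: z. Qed.
Lemma Re_sum (I : Type) (s : seq I) (P : pred I) (F : I -> C) :
  complex.Re (\sum_(i <- s | P i) F i) = \sum_(i <- s | P i) complex.Re (F i).
Proof. by apply: (big_morph _ cReD). Qed.
Lemma Im_sum (I : Type) (s : seq I) (P : pred I) (F : I -> C) :
  complex.Im (\sum_(i <- s | P i) F i) = \sum_(i <- s | P i) complex.Im (F i).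
Proof. by apply: (big_morph _ cImD). Qed.

End ComplexModulus.

Arguments cabs : simpl never.

(** * Complex limits through real distances; geometrically dominated series *)

Section ComplexSeries.
Context {R : realType}.
Local Notation C := (R[i]).
Implicit Types (u v : nat -> C) (l : C).

Definition ccvg u l := (fun n => cabs (u n - l)) @ \oo --> (0 : R).

Lemma ccvgE u l : ((u : nat -> C^o) @ \oo --> (l : C^o)) <-> ccvg u l.
Proof.
split=> [/cvgrPdist_lt ul|/cvgrPdist_lt ul]; apply/cvgrPdist_lt => e e0.
- have e0' : 0 < e%:C by rewrite ltcR.
  apply: filterS (ul _ e0') => n; rewrite normCE ltcR sub0r normrN cabsB.
  by rewrite ger0_norm ?cabs_ge0.
- have [e' ee'] : exists e' : R, e = e'%:C.
    by apply/complex_realP; rewrite gtr0_real.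
  subst e; rewrite ltcR in e0.
  apply: filterS (ul _ e0) => n; rewrite normCE ltcR sub0r normrN cabsB.
  by rewrite ger0_norm ?cabs_ge0.
Qed.

Lemma ccvg_unique u l l' : ccvg u l -> ccvg u l' -> l = l'.
Proof.
move=> ul ul'; apply/eqP; rewrite -subr_eq0 -cabs_eq0 eq_le cabs_ge0 andbT.
have h : (fun n => cabs (u n - l) + cabs (u n - l')) @ \oo --> (0 : R).
  by rewrite -[X in _ --> X](addr0 0); exact: cvgD.
apply: (cvgr_to_ge h).
by apply: nearW => n; rewrite (le_trans (cabs_dist (u n) _ _))//= [cabs (l - _)]cabsB.
Qed.

Lemma ccvg_squeeze u l (e : nat -> R) :
  (forall n, cabs (u n - l) <= e n) -> e @ \oo --> (0 : R) -> ccvg u l.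
Proof.
move=> ule e0; apply: (@squeeze_cvgr _ _ _ _ (fun=> 0) e) => //; last exact: cvg_cst.
by apply: nearW => n; rewrite cabs_ge0 ule.
Qed.

Lemma ccvgD u v l l' : ccvg u l -> ccvg v l' -> ccvg (fun n => u n + v n) (l + l').
Proof.
move=> ul vl; apply: (@ccvg_squeeze _ _ (fun n => cabs (u n - l) + cabs (v n - l'))).
  by move=> n; apply: le_trans (cabs_triangle _ _); rewrite opprD addrACA.
by rewrite -[X in _ --> X](addr0 0); exact: cvgD.
Qed.

Lemma ccvgZ u l k : ccvg u l -> ccvg (fun n => k * u n) (k * l).
Proof.
move=> ul; apply: (@ccvg_squeeze _ _ (fun n => cabs k * cabs (u n - l))).
  by move=> n; rewrite -mulrBr cabsM.
by rewrite -[X in _ --> X](mulr0 (cabs k)); apply: cvgMr.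
Qed.

Lemma ccvg_const l : ccvg (fun=> l) l.
Proof. by rewrite /ccvg subrr cabs0; exact: cvg_cst. Qed.

Lemma ccvg_shift N u l : ccvg (fun n => u (n + N)%N) l <-> ccvg u l.
Proof. by rewrite /ccvg -(cvg_shiftn N (fun n => cabs (u n - l))). Qed.

Lemma ccvg_addn N u l : ccvg u l -> ccvg (fun n => u (n + N)%N) l.
Proof. exact: (iffRL (ccvg_shift N u l)). Qed.

Lemma ccvg_le u l K : ccvg u l -> (forall n, cabs (u n) <= K) -> cabs l <= K.
Proof.
move=> ul uK; have h : (fun n => cabs l - cabs (u n - l)) @ \oo --> cabs l.
  by rewrite -[X in _ --> X]subr0; apply: cvgB; [exact: cvg_cst|exact: ul].
apply: (cvgr_to_le h).
apply: nearW => n; rewrite lerBlDr (le_trans _ (lerD (uK n) (lexx _)))//.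
by rewrite [cabs (_ - l)]cabsB -{1}[l](subrK (u n)) addrC cabs_triangle.
Qed.

(** A total function, meaningful only when both real series converge; a geometric bound on [u] is
    what guarantees this below. *)
Definition csum u : C :=
  limn (series (fun n => complex.Re (u n))) +i* limn (series (fun n => complex.Im (u n))).

Lemma geometric_tail_le (q : R) m n : 0 <= q < 1 ->
  \sum_(m <= k < n) q ^+ k <= q ^+ m / (1 - q).
Proof.
move=> /andP[q0 q1]; have q10 : 0 < 1 - q by rewrite subr_gt0.
rewrite ler_pdivlMr//; case: (leqP m n) => [mn|/ltnW nm]; last first.
  by rewrite big_geq// mul0r exprn_ge0.
have -> : (\sum_(m <= k < n) q ^+ k) * (1 - q) = q ^+ m - q ^+ n.
  elim: n mn => [|n IH]; first by rewrite leqn0 => /eqP ->; rewrite big_geq// mul0r subrr.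
  rewrite leq_eqVlt => /predU1P[->|mn]; first by rewrite big_geq// mul0r subrr.
  by rewrite big_nat_recr//= mulrDl IH// exprS; ring.
by rewrite gerBl exprn_ge0.
Qed.

Lemma geometric_bound_Re u (K q : R) : (forall n, cabs (u n) <= K * q ^+ n) ->
  forall n, `|complex.Re (u n)| <= K * q ^+ n.
Proof. by move=> uK n; exact: le_trans (ler_Re_cabs _) (uK n). Qed.

Lemma geometric_bound_Im u (K q : R) : (forall n, cabs (u n) <= K * q ^+ n) ->
  forall n, `|complex.Im (u n)| <= K * q ^+ n.
Proof. by move=> uK n; exact: le_trans (ler_Im_cabs _) (uK n). Qed.

Lemma is_cvg_series_geometric (v : nat -> R) (K q : R) : 0 <= q < 1 ->
  (forall n, `|v n| <= K * q ^+ n) -> cvgn (series v).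
Proof.
move=> /andP[q0 q1] vK; apply: normed_cvg.
apply: (@series_le_cvg _ _ (geometric K q)) => //.
- by move=> n; exact: normr_ge0.
- by move=> n; exact: le_trans (normr_ge0 _) (vK n).
by apply: is_cvg_geometric_series; rewrite ger0_norm.
Qed.

Lemma csum_cvg u (K q : R) : 0 <= q < 1 -> (forall n, cabs (u n) <= K * q ^+ n) ->
  ccvg (fun n => \sum_(k < n) u k) (csum u).
Proof.
move=> q01 uK.
have cR := is_cvg_series_geometric q01 (geometric_bound_Re uK).
have cI := is_cvg_series_geometric q01 (geometric_bound_Im uK).
have h (v : nat -> R) : cvgn (series v) ->
    (fun n => `|series v n - limn (series v)|) @ \oo --> (0 : R).
  move=> cv; have : (fun n => series v n - limn (series v)) @ \oo --> (0 : R).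
    by rewrite -[X in _ --> X](subrr (limn (series v))); apply: cvgB; [exact: cv|exact: cvg_cst].
  by move=> /cvg_norm; rewrite normr0.
apply: (@ccvg_squeeze _ _ (fun n => `|series (fun n => complex.Re (u n)) n - limn (series (fun n => complex.Re (u n)))| +
   `|series (fun n => complex.Im (u n)) n - limn (series (fun n => complex.Im (u n)))|)).
  move=> n; rewrite (le_trans (cabs_le_ReIm _))// cReD cImD cReN cImN Re_sum Im_sum /=.
  by rewrite /series/= !big_mkord.
by rewrite -[X in _ --> X](addr0 0); apply: cvgD; exact: h.
Qed.

(** The bound holds for every finite block of terms from [N] on and passes to the limit. *)
Lemma csum_tail u (K q : R) N : 0 <= q < 1 -> (forall n, cabs (u n) <= K * q ^+ n) ->
  cabs (csum u - \sum_(k < N) u k) <= K * q ^+ N / (1 - q).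
Proof.
move=> q01 uK; have /(ccvg_addn N) := csum_cvg q01 uK.
move=> /(ccvgD (ccvg_const (- \sum_(k < N) u k))).
rewrite [_ + csum u]addrC => /ccvg_le; apply => n.
rewrite addrC -!(big_mkord xpredT) /= (big_cat_nat (leq0n N) (leq_addl n N)) /=.
rewrite addrAC subrr add0r (le_trans (cabs_sum _ _ _))//.
rewrite (le_trans (ler_sum _ (fun i _ => uK i)))// -mulr_sumr -mulrA.
by rewrite ler_wpM2l ?geometric_tail_le//; have := uK 0%N; rewrite expr0 mulr1; apply: le_trans; exact: cabs_ge0.
Qed.

Lemma csum_le u (K q : R) : 0 <= q < 1 -> (forall n, cabs (u n) <= K * q ^+ n) ->
  cabs (csum u) <= K / (1 - q).
Proof. by move=> q01 uK; have := csum_tail 0 q01 uK; rewrite big_ord0 subr0 expr0 mulr1. Qed.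

End ComplexSeries.

(** * Power series and Cauchy's estimate *)

Section RootsOfUnity.
Context {R : realType}.
Local Notation C := (R[i]).

(** [X^M - 1] is separable in characteristic 0, hence has [M] distinct roots, and [M] distinct
    [M]-th roots of unity in a field include a primitive one. *)
Lemma prim_root_exists M : (0 < M)%N -> exists w : C, M.-primitive_root w.
Proof.
move=> M0; pose p : {poly C} := 'X^M - 1; have [r Dp] := closed_field_poly_normal p.
rewrite (monicP _) ?monicXnsubC // scale1r in Dp.
have rn1: all M.-unity_root r by apply/allP=> z; rewrite -root_prod_XsubC -Dp.
have sz_r : (size r >= M)%N.
  by rewrite -ltnS -[X in (X <= _)%N](@size_XnsubC C M 1)// -/p Dp size_prod_XsubC.
suff uniq_r : uniq r by have /hasP[z _ ?] := has_prim_root M0 rn1 uniq_r sz_r; exists z.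
rewrite -separable_prod_XsubC -Dp; apply: separable_Xn_sub_1.
by rewrite pnatr_eq0 -lt0n.
Qed.

Lemma prim_root_neq0 M (w : C) : M.-primitive_root w -> w != 0.
Proof.
move=> wM; apply/eqP => w0; have := prim_expr_order wM.
by rewrite w0 expr0n eqn0Ngt (prim_order_gt0 wM)/= => /eqP; rewrite eq_sym oner_eq0.
Qed.

(** Orthogonality of the characters of a cyclic group: for [i != j] the sum is geometric with ratio
    [x = w^(i-j)], and [x - 1] times it is [x^M - 1 = 0]. *)
Lemma sum_prim_root M (w : C) (i j : nat) : M.-primitive_root w -> (i < M)%N -> (j < M)%N ->
  \sum_(k < M) (w ^+ k) ^+ i / (w ^+ k) ^+ j = if i == j then M%:R else 0.
Proof.
move=> wM iM jM; have w0 := prim_root_neq0 wM.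
have [->|ij] := eqVneq i j.
  under eq_bigr do rewrite divff ?expf_neq0//.
  by rewrite sumr_const card_ord.
set x := w ^+ i / w ^+ j; rewrite (eq_bigr (fun k : 'I_M => x ^+ k)); last first.
  by move=> k _; rewrite /x expr_div_n -!exprM ![(k * _)%N]mulnC.
have x1 : x - 1 != 0.
  rewrite subr_eq0; apply: contra ij => /eqP h.
  have : w ^+ i = w ^+ j by rewrite -[RHS]mul1r -h divfK// expf_neq0.
  by move=> /eqP; rewrite (eq_prim_root_expr wM) !modn_small.
apply/eqP; rewrite -(mulrI_eq0 _ (mulfI x1)) -subrX1 /x expr_div_n.
by rewrite -!exprM ![(_ * M)%N]mulnC !exprM (prim_expr_order wM) !expr1n divr1 subrr.
Qed.

Lemma prim_root_cabs M (w : C) : M.-primitive_root w -> cabs w = 1.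
Proof.
move=> wM; apply/eqP; rewrite -(pexpr_eq1 (prim_order_gt0 wM) (cabs_ge0 w)).
by rewrite -cabsX (prim_expr_order wM) cabs1.
Qed.

End RootsOfUnity.

Section PowerSeries.
Context {R : realType}.
Local Notation C := (R[i]).
Implicit Types (a b c : nat -> C) (f g : C -> C) (z w : C).

Definition pexp f z0 (r : R) a := forall z, cabs (z - z0) < r ->
  ccvg (fun n => \sum_(k < n) a k * (z - z0) ^+ k) (f z).

Definition psv a z : C := csum (fun n => a n * z ^+ n).

Lemma analytic_atE f z0 : analytic_at f z0 <-> exists a r, 0 < r /\ pexp f z0 r a.
Proof.
split=> -[a [r [r0 h]]]; exists a, r; split=> // z.
- move=> zr; apply/ccvgE; have := h z; rewrite normCE ltcR => /(_ zr).
  by rewrite /series/=; under [X in X @ _ --> _ -> _]funext => n do rewrite big_mkord.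
- rewrite normCE ltcR => /h /ccvgE.
  by rewrite /series/=; under [X in _ -> X @ _ --> _]funext => n do rewrite big_mkord.
Qed.

Lemma ccvg_bounded (u : nat -> C) l : ccvg u l -> exists K, forall n, cabs (u n) <= K.
Proof.
move=> ul; have /cvg_seq_bounded : cvgn (fun n => cabs (u n - l)) by apply/cvg_ex; exists 0.
move=> [K [Kr /(_ (K + 1))]]; rewrite ltrDl ltr01 => /(_ isT) h.
exists (K + 1 + cabs l) => n; rewrite -[u n](subrK l) (le_trans (cabs_triangle _ _))//.
by rewrite lerD2r (le_trans (ler_norm _))// h.
Qed.

(** Evaluation at the single point [z0 + s]: the partial sums of a convergent series are bounded,
    hence so are its terms. *)
Lemma pexp_bound f z0 r a s : pexp f z0 r a -> 0 <= s < r ->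
  exists K, forall n, cabs (a n) * s ^+ n <= K.
Proof.
move=> fa /andP[s0 sr]; have := fa (z0 + s%:C).
rewrite [z0 + _]addrC addrK cabs_real ger0_norm// => /(_ sr) /ccvg_bounded [K SK].
exists (K + K) => n; have := lerD (SK n.+1) (SK n).
rewrite big_ord_recr /= => /(le_trans _); apply.
apply: le_trans (cabs_triangleB _ _).
by rewrite addrAC subrr add0r cabsM cabsX cabs_real ger0_norm.
Qed.

Lemma bound_geometric a (s K : R) w : 0 < s -> (forall n, cabs (a n) * s ^+ n <= K) ->
  forall n, cabs (a n * w ^+ n) <= K * (cabs w / s) ^+ n.
Proof.
move=> s0 aK n; rewrite cabsM cabsX expr_div_n mulrA ler_pdivlMr ?exprn_gt0//.
by rewrite mulrAC ler_wpM2r ?exprn_ge0 ?cabs_ge0.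
Qed.

Lemma ratio_lt1 (s : R) w : 0 < s -> cabs w < s -> 0 <= cabs w / s < 1.
Proof. by move=> s0 ws; rewrite divr_ge0 ?cabs_ge0 ?(ltW s0)//= ltr_pdivrMr// mul1r. Qed.

Lemma psv_cvg a (s K : R) w : 0 < s -> (forall n, cabs (a n) * s ^+ n <= K) -> cabs w < s ->
  ccvg (fun n => \sum_(k < n) a k * w ^+ k) (psv a w).
Proof.
by move=> s0 aK ws; apply: (csum_cvg (ratio_lt1 s0 ws) (bound_geometric w s0 aK)).
Qed.

Lemma psv_tail a (s K : R) w M : 0 < s -> (forall n, cabs (a n) * s ^+ n <= K) -> cabs w < s ->
  cabs (psv a w - \sum_(k < M) a k * w ^+ k) <= K * (cabs w / s) ^+ M / (1 - cabs w / s).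
Proof.
by move=> s0 aK ws; apply: (csum_tail M (ratio_lt1 s0 ws) (bound_geometric w s0 aK)).
Qed.

Lemma pexp_le f z0 r r' a : r' <= r -> pexp f z0 r a -> pexp f z0 r' a.
Proof. by move=> rr' fa z zr'; apply: fa; exact: lt_le_trans rr'. Qed.

Lemma pexp_psvE f r a z : pexp f 0 r a -> cabs z < r -> f z = psv a z.
Proof.
move=> fa zr; pose s := (cabs z + r) / 2.
have z0 := cabs_ge0 z.
have s0 : 0 < s by rewrite /s; lra.
have zs : cabs z < s by rewrite /s; lra.
have sr : 0 <= s < r by rewrite /s; lra.
have [K aK] := pexp_bound fa sr.
have := fa z; rewrite subr0 => /(_ zr) h.
exact: ccvg_unique h (psv_cvg s0 aK zs).
Qed.

(* Averaging against w^(-k n) over the M-th roots of unity w^k isolates, up to a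
   geometrically small error, the n-th Taylor coefficient. *)
Definition root_avg M w (n : nat) f z : C :=
  M%:R^-1 * \sum_(k < M) f (w ^+ k * z) / (w ^+ k) ^+ n.

(** With at most [M] coefficients no two exponents agree modulo [M], so the average isolates one
    monomial exactly. *)
Lemma root_avg_poly M w n N a z : M.-primitive_root w -> (n < M)%N -> (N <= M)%N ->
  root_avg M w n (fun z => \sum_(k < N) a k * z ^+ k) z = (a n * z ^+ n) *+ (n < N)%N.
Proof.
move=> wM nM NM; rewrite /root_avg.
have M0 : M%:R != 0 :> C by rewrite pnatr_eq0 -lt0n (leq_ltn_trans _ nM).
under eq_bigr do rewrite mulr_suml.
rewrite exchange_big/= (eq_bigr (fun j : 'I_N => if (j : nat) == n then a j * z ^+ j * M%:R else 0)).
  rewrite -big_mkcond/=; case: ltnP => [nN|Nn].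
    rewrite (big_pred1 (Ordinal nN))/=; last by [].
    by rewrite mulr1n mulrC mulfK.
  rewrite big_pred0 ?mulr0// => i; apply/negbTE; rewrite neq_ltn.
  by rewrite (leq_trans (ltn_ord i)).
move=> j _; transitivity (a j * z ^+ j * \sum_(k < M) (w ^+ k) ^+ j / (w ^+ k) ^+ n).
  rewrite mulr_sumr; apply: eq_bigr => k _; rewrite exprMn; ring.
rewrite sum_prim_root ?(leq_trans (ltn_ord j))//; case: ifP => _; by rewrite ?mulr0.
Qed.

Lemma root_avg_le M w n f z (K : R) : M.-primitive_root w ->
  (forall k, cabs (f (w ^+ k * z)) <= K) -> cabs (root_avg M w n f z) <= K.
Proof.
move=> wM fK; have M0 := prim_order_gt0 wM.
have MR : 0 < M%:R :> R by rewrite ltr0n.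
rewrite /root_avg cabsM cabsV (_ : cabs M%:R = M%:R); last first.
  by rewrite -[M%:R in LHS](rmorph_nat (real_complex R)) cabs_real ger0_norm.
rewrite mulrC ler_pdivrMr// (le_trans (cabs_sum _ _ _))//.
rewrite (le_trans (ler_sum _ (_ : forall i : 'I_M, true -> _ <= K)))//.
  by move=> k _; rewrite cabsM cabsV !cabsX (prim_root_cabs wM) !expr1n invr1 mulr1.
by rewrite sumr_const card_ord mulr_natr.
Qed.

Lemma root_avgB M w n f g z :
  root_avg M w n (fun z => f z - g z) z = root_avg M w n f z - root_avg M w n g z.
Proof.
rewrite /root_avg -mulrBr -sumrB; congr (_ * _).
by apply: eq_bigr => k _; rewrite mulrBl.
Qed.

(** The first [M] terms are handled exactly; the error is an average of tails at points of the same
    modulus as [z]. *)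
Lemma root_avg_psv M w n a (s K : R) z : M.-primitive_root w -> (n < M)%N -> 0 < s ->
  (forall n, cabs (a n) * s ^+ n <= K) -> cabs z < s ->
  cabs (root_avg M w n (psv a) z - a n * z ^+ n) <= K * (cabs z / s) ^+ M / (1 - cabs z / s).
Proof.
move=> wM nM s0 aK zs.
have := root_avg_poly a z wM nM (leqnn M); rewrite nM mulr1n => <-.
rewrite -root_avgB; apply: root_avg_le => // k.
have wz : cabs (w ^+ k * z) = cabs z by rewrite cabsM cabsX (prim_root_cabs wM) expr1n mul1r.
by rewrite -wz; apply: psv_tail => //; rewrite wz.
Qed.

Lemma cvg_geometric_mul (q K L : R) : 0 <= q < 1 -> (fun n => K * q ^+ n / L) @ \oo --> (0 : R).
Proof.
move=> /andP[q0 q1]; have : (fun n => K * q ^+ n * L^-1) @ \oo --> K * 0 * L^-1.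
  by apply: cvgMl; apply: cvgMr; apply: cvg_expr; rewrite ger0_norm.
by rewrite mulr0 mul0r.
Qed.

Lemma root_avg_cvg (w : nat -> C) n a (s K : R) z : (forall M, M.+1.-primitive_root (w M)) ->
  0 < s -> (forall n, cabs (a n) * s ^+ n <= K) -> cabs z < s ->
  ccvg (fun M => root_avg M.+1 (w M) n (psv a) z) (a n * z ^+ n).
Proof.
move=> wM s0 aK zs; apply/(ccvg_shift n).
apply: (@ccvg_squeeze _ _ _ (fun M => K * (cabs z / s) ^+ (M + n.+1) / (1 - cabs z / s))).
  by move=> M; rewrite addnS; apply: root_avg_psv => //; rewrite ltnS leq_addl.
have := @cvg_geometric_mul (cabs z / s) K (1 - cabs z / s) (ratio_lt1 s0 zs).
by rewrite -(cvg_shiftn n.+1).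
Qed.

Lemma prim_root_seq : exists w : nat -> C, forall M, M.+1.-primitive_root (w M).
Proof.
by have [w wM] := choice (fun M => @prim_root_exists R M.+1 isT); exists w.
Qed.

(** The averages at radius [t] are bounded by [K] and tend to [a n * t ^+ n]. The radius [s]
    strictly between [t] and [r] makes the tails geometrically small. *)
Lemma cauchy_estimate f z0 r a K t n : pexp f z0 r a ->
  (forall z, cabs (z - z0) < r -> cabs (f z) <= K) -> 0 <= t < r -> cabs (a n) * t ^+ n <= K.
Proof.
move=> fa fK /andP[t0 tr]; pose s := (t + r) / 2.
have s0 : 0 < s by rewrite /s; lra.
have ts : t < s by rewrite /s; lra.
have sr : 0 <= s < r by rewrite /s; lra.
have [L aL] := pexp_bound fa sr.
have [w wM] := prim_root_seq.
have ct : cabs t%:C = t by rewrite cabs_real ger0_norm.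
have : ccvg (fun M => root_avg M.+1 (w M) n (psv a) t%:C) (a n * t%:C ^+ n).
  by apply: (root_avg_cvg n wM s0 aL); rewrite ct.
move=> /ccvg_le h; rewrite -ct -cabsX -cabsM; apply: h => M; apply: root_avg_le => // k.
have ck : cabs (w M ^+ k * t%:C) = t.
  by rewrite cabsM cabsX (prim_root_cabs (wM M)) expr1n mul1r.
have := fa (z0 + w M ^+ k * t%:C).
rewrite [z0 + _]addrC addrK ck => /(_ tr) h.
rewrite (ccvg_unique (psv_cvg s0 aL _) h) ?ck//.
by apply: fK; rewrite addrK ck.
Qed.

(** Cauchy's estimate with [K = 0], for the expansion of the zero function with coefficients
    [a n - b n]. *)
Lemma pexp_inj f z0 r r' a b : 0 < r -> 0 < r' -> pexp f z0 r a -> pexp f z0 r' b -> a = b.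
Proof.
move=> r0 r'0 fa fb; apply/funext => n; apply/eqP; rewrite -subr_eq0 -cabs_eq0.
have m0 : 0 < Num.min r r' by rewrite lt_min r0.
have : pexp (fun=> 0) z0 (Num.min r r') (fun n => a n - b n).
  move=> z; rewrite lt_min => /andP[/fa fz /fb fz'].
  have := ccvgD fz (ccvgZ (-1) fz'); rewrite mulN1r subrr.
  by congr ccvg; apply/funext => k; rewrite mulN1r -sumrB; apply: eq_bigr => i _; rewrite mulrBl.
move=> /cauchy_estimate => /(_ 0 (Num.min r r' / 2) n).
have -> : 0 <= Num.min r r' / 2 < Num.min r r' by lra.
move=> /(_ _ isT) h; rewrite eq_le cabs_ge0 andbT.
have tn : 0 < (Num.min r r' / 2) ^+ n by rewrite exprn_gt0// divr_gt0.
by rewrite -(pmulr_lle0 _ tn) h// => z _; rewrite cabs0.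
Qed.

End PowerSeries.

(** * Change of the centre of a power series *)

Section Recentering.
Context {R : realType}.
Local Notation C := (R[i]).
Implicit Types (a b c : nat -> C) (f g : C -> C) (z w : C).

Lemma binomial_sumE (S : comPzRingType) N M (x y : S) : (N < M)%N ->
  \sum_(n < M) x ^+ (N - n) * y ^+ n *+ 'C(N, n) = (x + y) ^+ N.
Proof.
move=> NM; rewrite exprDn (big_ord_widen M (fun n => x ^+ (N - n) * y ^+ n *+ 'C(N, n)) NM).
rewrite [RHS]big_mkcond/=; apply: eq_bigr => n _.
by case: ltnP => // Nn; rewrite bin_small.
Qed.

Lemma binomial_sum_le N M (x y : R) : 0 <= x -> 0 <= y ->
  \sum_(n < M) x ^+ (N - n) * y ^+ n *+ 'C(N, n) <= (x + y) ^+ N.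
Proof.
move=> x0 y0; rewrite -(@binomial_sumE _ N (M + N.+1)) ?leq_addl//.
rewrite big_split_ord/= lerDl; apply: sumr_ge0 => n _.
by rewrite mulrn_wge0// mulr_ge0// exprn_ge0.
Qed.

Lemma binomial_term_le N n (x y : R) : 0 <= x -> 0 <= y ->
  x ^+ (N - n) * y ^+ n *+ 'C(N, n) <= (x + y) ^+ N.
Proof.
move=> x0 y0; apply: le_trans (binomial_sum_le N n.+1 x0 y0).
rewrite big_ord_recr/= lerDr; apply: sumr_ge0 => k _.
by rewrite mulrn_wge0// mulr_ge0// exprn_ge0.
Qed.

(** The [n]-th Taylor coefficient at [z0]. Terms with [N < n], where [N - n] truncates to 0, vanish
    with the binomial coefficient. *)
Definition recenter a z0 n : C := csum (fun N => a N * z0 ^+ (N - n) *+ 'C(N, n)).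

Lemma cabsMn z n : cabs (z *+ n) = cabs z *+ n. Proof. exact: normcMn. Qed.

(** One term of the binomial expansion of [(|z0| + t)^N] is at most the whole; the spare radius [t]
    pays for [n] and leaves a geometric majorant in [N]. *)
Lemma recenter_bound a (s t K : R) z0 n N : 0 < s -> 0 < t -> cabs z0 + t < s ->
  (forall n, cabs (a n) * s ^+ n <= K) ->
  cabs (a N * z0 ^+ (N - n) *+ 'C(N, n)) <= K / t ^+ n * ((cabs z0 + t) / s) ^+ N.
Proof.
move=> s0 t0 zts aK; rewrite cabsMn cabsM cabsX -mulrnAr.
have tn : 0 < t ^+ n by rewrite exprn_gt0.
have sN : 0 < s ^+ N by rewrite exprn_gt0.
have z00 := cabs_ge0 z0.
have := binomial_term_le N n z00 (ltW t0); rewrite -mulrnAl.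
set B := _ *+ _ => h.
have -> : K / t ^+ n * ((cabs z0 + t) / s) ^+ N = K * (cabs z0 + t) ^+ N / (t ^+ n * s ^+ N).
  by rewrite expr_div_n; field; rewrite !gt_eqF.
rewrite ler_pdivlMr ?mulr_gt0//.
have -> : cabs (a N) * B * (t ^+ n * s ^+ N) = (cabs (a N) * s ^+ N) * (B * t ^+ n) by ring.
by apply: ler_pM => //; rewrite mulr_ge0 ?exprn_ge0 ?cabs_ge0 ?mulrn_wge0 ?exprn_ge0// ltW.
Qed.

(** The two partial sums of length [M] differ, once the complete binomial expansions with [N < M]
    cancel, only by terms with [N >= M], each at most [K * q ^+ N]. The double series is thus
    rearranged by finite sums and one limit. *)
Lemma recenter_cvg a (s K : R) z0 w : 0 < s -> (forall n, cabs (a n) * s ^+ n <= K) ->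
  cabs z0 + cabs w < s ->
  ccvg (fun M => \sum_(n < M) recenter a z0 n * w ^+ n) (psv a (z0 + w)).
Proof.
move=> s0 aK zws.
have z00 := cabs_ge0 z0; have w00 := cabs_ge0 w.
pose t := (s - cabs z0 + cabs w) / 2.
have t0 : 0 < t by rewrite /t; lra.
have zts : cabs z0 + t < s by rewrite /t; lra.
have rec_cvg n : ccvg (fun L => \sum_(N < L) a N * z0 ^+ (N - n) *+ 'C(N, n)) (recenter a z0 n).
  apply: (csum_cvg (q := (cabs z0 + t) / s)); last exact: (fun N => recenter_bound n N s0 t0 zts aK).
  by rewrite divr_ge0 ?(ltW s0) ?addr_ge0 ?(ltW t0)//= ltr_pdivrMr// mul1r.
have zws' : cabs (z0 + w) < s by apply: le_lt_trans zws; exact: cabs_triangle.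
set q := (cabs z0 + cabs w) / s.
have q01 : 0 <= q < 1.
  by rewrite /q divr_ge0 ?(ltW s0) ?addr_ge0//= ltr_pdivrMr// mul1r.
have diff M : cabs (\sum_(n < M) recenter a z0 n * w ^+ n -
    \sum_(N < M) a N * (z0 + w) ^+ N) <= K * q ^+ M / (1 - q).
  have lim : ccvg (fun L => \sum_(n < M) (\sum_(N < L) a N * z0 ^+ (N - n) *+ 'C(N, n)) * w ^+ n)
      (\sum_(n < M) recenter a z0 n * w ^+ n).
    elim: M => [|M IH].
      rewrite big_ord0; have := @ccvg_const R 0; congr ccvg.
      by apply/funext => L; rewrite big_ord0.
    rewrite big_ord_recr/=; under eq_fun do rewrite big_ord_recr/=.
    apply: ccvgD => //; rewrite mulrC; under eq_fun do rewrite mulrC.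
    exact/ccvgZ.
  have := ccvgD (ccvg_const (- \sum_(N < M) a N * (z0 + w) ^+ N)) lim.
  rewrite [_ + \sum_(n < M) recenter _ _ _ * _]addrC => /(ccvg_addn M) /ccvg_le; apply=> L.
  have -> : - (\sum_(N < M) a N * (z0 + w) ^+ N) +
      \sum_(n < M) (\sum_(N < L + M) a N * z0 ^+ (N - n) *+ 'C(N, n)) * w ^+ n =
      \sum_(M <= N < L + M) a N * \sum_(n < M) z0 ^+ (N - n) * w ^+ n *+ 'C(N, n).
    apply/eqP; rewrite addrC subr_eq; apply/eqP.
    transitivity (\sum_(N < L + M) a N * \sum_(n < M) z0 ^+ (N - n) * w ^+ n *+ 'C(N, n)).
      under eq_bigr do rewrite mulr_suml.
      rewrite exchange_big/=; apply: eq_bigr => N _; rewrite mulr_sumr.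
      by apply: eq_bigr => n _; rewrite -!mulrnAr -!mulrA [_ *+ _ * _]mulrC !mulrnAr [w ^+ n * _]mulrC.
    rewrite -(big_mkord xpredT (fun N => a N * \sum_(n < M) z0 ^+ (N - n) * w ^+ n *+ 'C(N, n))).
    rewrite (big_cat_nat (leq0n M) (leq_addl L M))/= addrC; congr (_ + _).
    by rewrite big_mkord; apply: eq_bigr => N _; rewrite binomial_sumE.
  rewrite (le_trans (cabs_sum _ _ _))//.
  apply: (@le_trans _ _ (\sum_(M <= N < L + M) K * q ^+ N)).
    apply: ler_sum => N _; rewrite cabsM /q expr_div_n mulrA ler_pdivlMr ?exprn_gt0//.
    rewrite mulrAC ler_pM ?mulr_ge0 ?exprn_ge0 ?cabs_ge0 ?(ltW s0)//.
    rewrite (le_trans (cabs_sum _ _ _))// (le_trans _ (binomial_sum_le N M z00 w00))//.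
    by apply: ler_sum => n _; rewrite cabsMn cabsM !cabsX.
  rewrite -mulr_sumr -mulrA ler_wpM2l ?geometric_tail_le//.
  by have := aK 0%N; rewrite expr0 mulr1; apply: le_trans; exact: cabs_ge0.
apply: (@ccvg_squeeze _ _ _ (fun M => K * q ^+ M / (1 - q) +
   K * (cabs (z0 + w) / s) ^+ M / (1 - cabs (z0 + w) / s))).
  move=> M; rewrite (le_trans (cabs_dist (\sum_(N < M) a N * (z0 + w) ^+ N) _ _))//.
  by rewrite lerD// cabsB; exact: psv_tail.
rewrite -[X in _ --> X](addr0 0); apply: cvgD; apply: cvg_geometric_mul => //.
exact: ratio_lt1.
Qed.

Lemma pexp_recenter f z0 z1 r a : pexp f z0 r a -> cabs (z1 - z0) < r ->
  pexp f z1 (r - cabs (z1 - z0)) (recenter a (z1 - z0)).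
Proof.
move=> fa z1r z; rewrite ltrBrDr addrC => zr.
have n1 := cabs_ge0 (z1 - z0); have n2 := cabs_ge0 (z - z1).
pose s := (cabs (z1 - z0) + cabs (z - z1) + r) / 2.
have s0 : 0 < s by rewrite /s; lra.
have sr : 0 <= s < r by rewrite /s; lra.
have zs : cabs (z1 - z0) + cabs (z - z1) < s by rewrite /s; lra.
have [K aK] := pexp_bound fa sr.
have zz : z1 - z0 + (z - z1) = z - z0 by ring.
have zr' : cabs (z - z0) < r by rewrite -zz (le_lt_trans (cabs_triangle _ _)).
have zs' : cabs (z - z0) < s by rewrite -zz (le_lt_trans (cabs_triangle _ _)).
rewrite (ccvg_unique (fa z zr') (psv_cvg s0 aK zs')) -zz.
exact: (recenter_cvg s0 aK).
Qed.

(* The n-th Taylor coefficient at a varying centre is itself a power series in the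
   centre; Cauchy's estimate for that series bounds a (n + k) * 'C(n + k, n). *)
Lemma recenter_psv a (s K : R) n : 0 < s -> (forall n, cabs (a n) * s ^+ n <= K) ->
  pexp (fun z => recenter a z n) 0 s (fun k => a (k + n)%N *+ 'C(k + n, n)).
Proof.
move=> s0 aK z; rewrite subr0 => zs.
pose t := (s - cabs z) / 2.
have t0 : 0 < t by rewrite /t; lra.
have zts : cabs z + t < s by rewrite /t; lra.
have z00 := cabs_ge0 z.
have q01 : 0 <= (cabs z + t) / s < 1.
  by rewrite divr_ge0 ?(ltW s0) ?addr_ge0 ?(ltW t0)//= ltr_pdivrMr// mul1r.
have /(ccvg_addn n) := csum_cvg q01 (fun N => recenter_bound n N s0 t0 zts aK).
rewrite -/(recenter a z n).
suff -> : (fun m => \sum_(k < m + n) a k * z ^+ (k - n) *+ 'C(k, n)) = (fun m => \sum_(k < m) (a (k + n)%N *+ 'C(k + n, n)) * z ^+ k) by [].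
apply/funext => M.
rewrite -(big_mkord xpredT (fun N => a N * z ^+ (N - n) *+ 'C(N, n))).
rewrite (big_cat_nat (leq0n n) (leq_addl M n))/= big_nat_cond big1 ?add0r; last first.
  by move=> i /andP[/andP[_ ni] _]; rewrite bin_small.
rewrite -{1}[n]add0n big_addn addnK big_mkord; apply: eq_bigr => k _.
by rewrite addnK mulrnAl.
Qed.

End Recentering.

(** * From local to global power series *)

Section LocalToGlobal.
Context {R : realType}.
Local Notation C := (R[i]).
Implicit Types (a b c : nat -> C) (f g : C -> C) (z w : C).

(** One number [e] measures both the radius and the bound [1 / e], so the condition weakens as [e]
    decreases and lends itself to compactness. *)
Definition expands f (e : R) z := exists c, pexp f z e c /\
  forall w, cabs (w - z) < e -> cabs (f w) <= e^-1.

Lemma expands_near f z : analytic_at f z -> exists2 e : R, 0 < e &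
  forall z', cabs (z' - z) < e -> forall e', 0 < e' -> e' <= e -> expands f e' z'.
Proof.
move=> /analytic_atE [a [r [r0 fa]]]; pose s := r / 2.
have s0 : 0 < s by rewrite /s; lra.
have [K aK] : exists K, forall n, cabs (a n) * s ^+ n <= K.
  by apply: (pexp_bound fa); rewrite /s; lra.
have K0 : 0 <= K by have := aK 0%N; rewrite expr0 mulr1; apply: le_trans; exact: cabs_ge0.
have fK w : cabs (w - z) < s / 2 -> cabs (f w) <= 2 * K.
  move=> wz; have n0 := cabs_ge0 (w - z).
  have ws : cabs (w - z) < s by lra.
  have wr : cabs (w - z) < r by rewrite /s in ws; lra.
  rewrite (ccvg_unique (fa w wr) (psv_cvg s0 aK ws)).
  have := csum_le (ratio_lt1 s0 ws) (bound_geometric (w - z) s0 aK).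
  move=> /le_trans; apply; rewrite ler_pdivrMr; last first.
    by have /andP[_] := ratio_lt1 s0 ws; rewrite subr_gt0.
  have q2 : cabs (w - z) / s <= 2^-1 by rewrite ler_pdivrMr//; lra.
  by move: q2; set q := _ / s => q2; nra.
(* [s / 4] keeps the disk of radius [e'] about [z'] inside the disk of radius [s / 2], where
   [|f| <= 2 * K]; the other term ensures [2 * K <= 1 / e']. *)
exists (Num.min (s / 4) (2 * K + 1)^-1).
  by rewrite lt_min invr_gt0; apply/andP; split; lra.
move=> z' z'z e' e'0; rewrite le_min => /andP[e's e'K].
move: z'z; rewrite lt_min => /andP[z'z _].
have n0 := cabs_ge0 (z' - z).
have z'r : cabs (z' - z) < r by rewrite /s in z'z; lra.
exists (recenter a (z' - z)); split.
  by apply: pexp_le (pexp_recenter fa z'r); rewrite /s in e's z'z; lra.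
move=> w wz'; apply: (@le_trans _ _ (2 * K)).
  by apply: fK; rewrite (le_lt_trans (cabs_dist z' _ _))//; lra.
have e'i : e'^-1 >= 2 * K + 1 by rewrite -[leLHS]invrK lef_pV2 ?posrE ?invr_gt0//; lra.
by lra.
Qed.

Lemma nbhs_plane (p : R * R) (e : R) : 0 < e ->
  \forall p' \near p, cabs ((p'.1 +i* p'.2 : C) - (p.1 +i* p.2)) < e.
Proof.
move=> e0; have e2 : 0 < e / 2 by lra.
exists ([set x | `|p.1 - x| < e / 2], [set x | `|p.2 - x| < e / 2]) => /=.
  by split; exact: nbhsx_ballx.
move=> [x y] /= [xp yp]; rewrite (le_lt_trans (cabs_le_ReIm _))//=.
by move: xp yp; rewrite distrC [X in _ -> X < _ -> _]distrC; lra.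
Qed.

(** Compactness of the square [[-1, 1]^2]. A point of modulus at least 1 has a neighbourhood of
    points of modulus above [rho], where the claim is vacuous. *)
Lemma expands_uniform f (rho : R) : (forall z, cabs z < 1 -> analytic_at f z) ->
  rho < 1 -> exists2 e : R, 0 < e & forall z, cabs z <= rho -> expands f e z.
Proof.
move=> fan rho1.
pose box : set (R * R) := `[-1, 1]%classic `*` `[-1, 1]%classic.
have : compact box by apply: compact_setX; exact: segment_compact.
move=> /compact_near_coveringP /(_ R (0^'+ : set_system R)
   (fun e p => cabs (p.1 +i* p.2 : C) <= rho -> expands f e (p.1 +i* p.2)) _) [].
  move=> p _; have [p1|p1] := ltP (cabs (p.1 +i* p.2 : C)) 1.
    have [e e0 h] := expands_near (fan _ p1).
    exists ([set p' : R * R | cabs ((p'.1 +i* p'.2 : C) - (p.1 +i* p.2)) < e], [set e' : R | 0 < e' <= e]).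
      split; first exact: nbhs_plane.
      by near=> e'; apply/andP; split; near: e'; [exact: nbhs_right_gt|exact: nbhs_right_le].
    by move=> [p' e'] /= [p'p /andP[e'0 e'e]] _; exact: h.
  exists ([set p' : R * R | cabs ((p'.1 +i* p'.2 : C) - (p.1 +i* p.2)) < 1 - rho], setT).
    by split; [apply: nbhs_plane; lra|exact: filterT].
  move=> [p' e'] /= [p'p _] p'rho.
  have := cabs_triangleB (p'.1 +i* p'.2 : C) ((p'.1 +i* p'.2 : C) - (p.1 +i* p.2)).
  by rewrite opprB addrC subrK; lra.
move=> d /= d0 h; exists (d / 2); first by lra.
move=> z zrho; have e0 : 0 < d / 2 by lra.
have := h (d / 2); rewrite /= sub0r normrN gtr0_norm// => /(_ _ e0 (complex.Re z, complex.Im z)).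
rewrite /= (_ : _ +i* _ = z); last by case: (z).
apply=> //; first by lra.
have zR := ler_Re_cabs z; have zI := ler_Im_cabs z.
move: zR zI; rewrite !ler_norml => /andP[? ?] /andP[? ?].
by split; rewrite /= in_itv/=; apply/andP; split; lra.
Unshelve. all: by end_near. Qed.

(** Absorbs the factor [N + 1], which counts the pairs with [k + n = N] in [pexp_extend], into an
    arbitrarily small geometric growth. *)
Lemma bernoulli_bound (d : R) n : 0 < d -> n.+1%:R <= (1 + d^-1) * (1 + d) ^+ n.
Proof.
move=> d0; have di : 0 < d^-1 by rewrite invr_gt0.
suff h : 1 + n%:R * d <= (1 + d) ^+ n.
  have n0 : 0 <= n%:R :> R by [].
  apply: (@le_trans _ _ ((1 + d^-1) * (1 + n%:R * d))); last by rewrite ler_wpM2l//; lra.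
  have -> : (1 + d^-1) * (1 + n%:R * d) = 1 + n%:R + n%:R * d + d^-1 by field; rewrite gt_eqF.
  by rewrite -natr1; nra.
elim: n => [|n IH]; first by rewrite mul0r addr0 expr0.
have n0 : 0 <= n%:R :> R by [].
by rewrite exprS -natr1; nra.
Qed.

(** Cauchy's estimate is used twice: about each centre [z], bounding the [n]-th Taylor coefficient
    there by [e^-1 / t ^+ n], and then for that coefficient as a power series in [z]. Summing the
    bounds over [k + n = N] gives [|a N| * (sg + t) ^+ N <= (N + 1) / e], where [sg + t] exceeds the
    target radius [s]. *)
Lemma pexp_extend f (rho e : R) a : 0 < e -> e <= rho -> pexp f 0 rho a ->
  (forall z, cabs z < rho -> expands f e z) ->
  exists a', pexp f 0 (rho + e / 8) a'.
Proof.
move=> e0 erho fa fexp; exists a.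
pose sg := rho - e / 8; pose t := e / 2; pose s := rho + e / 8.
have sg0 : 0 < sg by rewrite /sg; lra.
have t0 : 0 < t by rewrite /t; lra.
have s0 : 0 < s by rewrite /s; lra.
have coefs z : cabs z < rho -> pexp f z e (recenter a z).
  move=> zrho; have [c [fc _]] := fexp z zrho.
  have := @pexp_recenter R f 0 z rho a fa; rewrite subr0 => /(_ zrho) fc'.
  suff -> : recenter a z = c by [].
  apply: pexp_inj fc' fc => //; by rewrite subr_gt0.
have bound n k : cabs (a (k + n)%N) *+ 'C(k + n, n) * sg ^+ k * t ^+ n <= e^-1.
  pose rho' := (rho + sg) / 2.
  have rho'0 : 0 < rho' by rewrite /rho'; lra.
  have [K aK] : exists K, forall n, cabs (a n) * rho' ^+ n <= K.
    by apply: (pexp_bound fa); rewrite /rho' /sg; lra.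
  have cest z : cabs (z - 0) < rho' -> cabs (recenter a z n) <= e^-1 / t ^+ n.
    rewrite subr0 => zr; have zrho : cabs z < rho by rewrite /rho' /sg in zr; lra.
    have [_ [_ fK]] := fexp z zrho.
    rewrite ler_pdivlMr ?exprn_gt0//; apply: (cauchy_estimate _ (coefs z zrho) fK).
    by rewrite /t; lra.
  have := cauchy_estimate (t := sg) k (recenter_psv n rho'0 aK) cest.
  rewrite cabsMn ler_pdivlMr ?exprn_gt0//; apply.
  by rewrite /rho' /sg; lra.
have aN N : cabs (a N) * (sg + t) ^+ N <= N.+1%:R / e.
  rewrite exprDn mulr_sumr.
  apply: le_trans (_ : \sum_(i < N.+1) e^-1 <= _); last first.
    by rewrite sumr_const card_ord mulr_natl.
  apply: ler_sum => i _; have iN : (i <= N)%N by rewrite -ltnS.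
  have := bound i (N - i)%N; rewrite subnK// => h; apply: le_trans h.
  by rewrite mulrnAr mulrA !mulrnAl.
pose d := (sg + t) / s - 1.
have d0 : 0 < d by rewrite /d subr_gt0 ltr_pdivlMr// mul1r /s /sg /t; lra.
pose L := (1 + d^-1) / e.
have aL N : cabs (a N) * s ^+ N <= L.
  have := aN N; have -> : sg + t = (1 + d) * s by rewrite /d [1 + _]addrC subrK divfK ?gt_eqF.
  rewrite exprMn => h; have := bernoulli_bound N d0 => h'.
  have p0 : 0 < (1 + d) ^+ N by rewrite exprn_gt0//; lra.
  rewrite -(ler_pM2l p0) mulrCA (le_trans h)// /L mulrA [_ ^+ N * _]mulrC.
  by rewrite ler_pM2r ?invr_gt0.
move=> z; rewrite subr0 -/s => zs.
suff -> : f z = psv a z by exact: psv_cvg aL zs.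
have [zr|rz] := ltP (cabs z) rho; first exact: pexp_psvE fa zr.
have zp : 0 < cabs z by lra.
(* A point beyond radius [rho] is pulled back radially by [e / 2] to a centre [z0] inside; about
   [z0], both [f] and the power series have the same recentred expansion. *)
pose k : R := 1 - e / 2 / cabs z.
pose z0 := k%:C * z.
have kz : k * cabs z = cabs z - e / 2.
  by rewrite /k mulrBl mul1r divfK ?gt_eqF.
have k0 : 0 <= k.
  by rewrite -(pmulr_lge0 _ zp) kz; lra.
have z0E : cabs z0 = cabs z - e / 2 by rewrite cabsM cabs_real ger0_norm.
have zz0 : cabs (z - z0) = e / 2.
  rewrite /z0 -{1}[z]mul1r -mulrBl -(rmorph1 (real_complex R)) -rmorphB cabsM cabs_real.
  by rewrite opprB addrC subrK ger0_norm ?divfK ?gt_eqF// divr_ge0// ?(ltW zp)//; lra.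
have z0rho : cabs z0 < rho by rewrite z0E /s in zs *; lra.
have := coefs z0 z0rho z; rewrite zz0 => h.
have {}h : ccvg (fun n => \sum_(k < n) recenter a z0 k * (z - z0) ^+ k) (f z).
  by apply: h; lra.
have zE : z0 + (z - z0) = z by rewrite addrC subrK.
rewrite -[X in psv a X]zE; apply: ccvg_unique h _.
by apply: (recenter_cvg s0 aL); rewrite zz0 z0E subrK.
Qed.

(** Each extension gains the same [e / 8] at every radius below [rho], so finitely many steps reach
    [rho]; uniqueness of coefficients merges the expansions for all [rho < 1] into one. *)
Lemma pexp_global f : (forall z, cabs z < 1 -> analytic_at f z) -> exists a, pexp f 0 1 a.
Proof.
move=> fan.
have [a0 [r0 [r00 fa0]]] : exists a r, 0 < r /\ pexp f 0 r a.
  by apply/analytic_atE; apply: fan; rewrite cabs0.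
suff ext rho : rho < 1 -> exists a, pexp f 0 rho a.
  exists a0 => z; rewrite subr0 => z1.
  pose rho := (1 + cabs z) / 2.
  have zrho : cabs z < rho by rewrite /rho; lra.
  have [|a fa] := ext rho; first by rewrite /rho; lra.
  have rho0 : 0 < rho by rewrite /rho; have := cabs_ge0 z; lra.
  have -> : a0 = a by exact: pexp_inj fa0 fa.
  by have := fa z; rewrite subr0; exact.
move=> rho1; have [e' e'0 he'] := expands_uniform fan rho1.
pose e := Num.min e' r0.
have e0 : 0 < e by rewrite lt_min e'0.
have he z : cabs z <= rho -> expands f e z.
  move=> /he' [c [fc fK]]; exists c; split; first by apply: pexp_le fc; rewrite ge_min lexx.
  move=> w wz; apply: le_trans (fK w _) _; first by rewrite (lt_le_trans wz)// ge_min lexx.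
  by rewrite lef_pV2 ?posrE// ge_min lexx.
suff step j : exists a, pexp f 0 (Num.min rho (e + j%:R * (e / 8))) a.
  have [j jP] : exists j : nat, rho < j%:R * (e / 8).
    have e8 : 0 < e / 8 by lra.
    exists (Num.truncn (rho / (e / 8))).+1.
    by rewrite -ltr_pdivrMr// truncnS_gt.
  have [a] := step j; rewrite (_ : Num.min _ _ = rho); first by exists a.
  by apply/min_idPl; lra.
elim: j => [|j [a fa]].
  rewrite mul0r addr0; exists a0; apply: pexp_le fa0.
  by rewrite /e minA ge_min lexx orbT.
set r1 := Num.min _ _ in fa.
have [rr1|r1r] := leP rho (e + j%:R * (e / 8)).
  exists a; have -> : Num.min rho (e + j.+1%:R * (e / 8)) = r1; last by [].
  rewrite /r1; have /min_idPl -> := rr1; apply/min_idPl.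
  by rewrite (le_trans rr1)// -[j.+1%:R]natr1; lra.
have r1E : r1 = e + j%:R * (e / 8) by apply/min_idPr/ltW.
have j0 : 0 <= j%:R * (e / 8) by rewrite mulr_ge0//; lra.
have [||a' fa'] := @pexp_extend f r1 e a e0 _ fa.
- by rewrite r1E; lra.
- by move=> z zr; apply: he; rewrite r1E in zr; lra.
exists a'; apply: pexp_le fa'; rewrite r1E -[j.+1%:R]natr1.
by rewrite ge_min; apply/orP; right; lra.
Qed.

End LocalToGlobal.

(** * Rotation invariance of planar Lebesgue measure *)

Section LebesgueInvariance.
Context {R : realType}.
Local Notation C := (R[i]).
Local Notation mR := (measurableTypeR R).
Local Notation plane := (mR * mR)%type.
Local Notation pushm := measure_function_pushforward__canonical__measure_function_Measure.
Local Notation lebesgue1 := (@lebesgue_measure R).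

Lemma measurable_translation (c : R) : measurable_fun [set: mR] (fun x : mR => (x + c : mR)).
Proof. exact: measurable_funD. Qed.

Lemma lebesgue_measure_translation (c : R) (A : set mR) : measurable A ->
  lebesgue1 ((fun x : mR => (x + c : mR)) @^-1` A) = lebesgue1 A.
Proof.
move=> mA; rewrite [RHS](@lebesgue_measure_unique R (pushm lebesgue1 (measurable_translation c)))//.
move=> X [[a b] _ <-] /=; rewrite /pushforward/=.
have -> : (fun x : mR => (x + c : mR)) @^-1` `]a, b]%classic = `](a - c), (b - c)]%classic.
  by apply/seteqP; split=> x; rewrite /= !in_itv/= ltrBlDr lerBrDr.
rewrite !lebesgue_measure_itv/= !lte_fin ltrD2r; case: ifP => // _.
by rewrite -!EFinB; congr (_%:E); ring.
Qed.

Definition vshear (a : R) (p : plane) : plane := (p.1, p.2 + a * p.1).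
Definition hshear (a : R) (p : plane) : plane := (p.1 + a * p.2, p.2).

Lemma measurable_scale1 a : measurable_fun [set: plane] (fun p : plane => (a * p.1 : mR)).
Proof. by apply: measurable_funM; [exact: measurable_cst|exact: measurable_fst]. Qed.

Lemma measurable_scale2 a : measurable_fun [set: plane] (fun p : plane => (a * p.2 : mR)).
Proof. by apply: measurable_funM; [exact: measurable_cst|exact: measurable_snd]. Qed.

Lemma measurable_vshear a : measurable_fun setT (vshear a).
Proof.
apply: measurable_fun_pair; first exact: measurable_fst.
apply: measurable_funD; first exact: measurable_snd.
exact: measurable_scale1.
Qed.

Lemma measurable_hshear a : measurable_fun setT (hshear a).
Proof.
apply: measurable_fun_pair; last exact: measurable_snd.
apply: measurable_funD; first exact: measurable_fst.
exact: measurable_scale2.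
Qed.

Lemma preimage_measurable d d' (T : measurableType d) (U : measurableType d') (f : T -> U) A :
  measurable_fun setT f -> measurable A -> measurable (f @^-1` A).
Proof. by move=> mf mA; rewrite -[X in measurable X]setTI; exact: mf. Qed.

Lemma lebesgue2_vshear a (A : set plane) : measurable A ->
  lebesgue2 (vshear a @^-1` A) = lebesgue2 A.
Proof.
move=> mA; apply: eq_integral => x _ /=.
have -> : xsection (vshear a @^-1` A) x = (fun y : mR => (y + a * x : mR)) @^-1` xsection A x.
  by apply/seteqP; split=> y; rewrite /xsection/= !inE.
by apply: lebesgue_measure_translation; exact: measurable_xsection.
Qed.

(** Gives access to horizontal sections, which a horizontal shear translates; [lebesgue2] itself
    integrates over vertical ones. *)
Lemma lebesgue2_sym (A : set plane) : measurable A ->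
  lebesgue2 A = (lebesgue1 \x^ lebesgue1)%E A.
Proof. by move=> mA; apply: product_measure_unique => // X Y mX mY; exact: product_measure2E. Qed.

Lemma lebesgue2_hshear a (A : set plane) : measurable A ->
  lebesgue2 (hshear a @^-1` A) = lebesgue2 A.
Proof.
move=> mA; rewrite !lebesgue2_sym//; last exact: preimage_measurable (measurable_hshear a) mA.
apply: eq_integral => y _ /=.
have -> : ysection (hshear a @^-1` A) y = (fun x : mR => (x + a * y : mR)) @^-1` ysection A y.
  by apply/seteqP; split=> x; rewrite /ysection/= !inE.
by apply: lebesgue_measure_translation; exact: measurable_ysection.
Qed.

Definition crot (u : C) (p : plane) : plane :=
  (complex.Re (u * to_complex p), complex.Im (u * to_complex p)).

Lemma to_complex_rot u p : to_complex (crot u p) = u * to_complex p.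
Proof. by rewrite /to_complex /crot /=; case: (u * _). Qed.

(** A rotation by [theta] is a product of three shears, the outer two with factor
    [- tan (theta / 2)], written as [- (1 - cos theta) / sin theta]; hence the condition
    [sin theta != 0]. *)
Lemma rot_shears u : cabs u = 1 -> complex.Im u != 0 ->
  crot u = hshear (- ((1 - complex.Re u) / complex.Im u)) \o
    (vshear (complex.Im u) \o hshear (- ((1 - complex.Re u) / complex.Im u))).
Proof.
move=> u1 s0; have := sqr_cabs u; rewrite u1 expr1n.
case: u u1 s0 => c s /= _ s0 cs; apply/funext => -[x y].
rewrite /crot /hshear /vshear /to_complex /=.
have h : s * s = (1 - c) * (1 + c) by nra.
have key : (1 - c) / s * s = 1 - c by rewrite divfK.
have key2 : (1 - c) / s * (1 + c) = s by rewrite mulrAC -h mulfK.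
set t := (1 - c) / s in key key2 *.
have c1 : c = 1 - t * s by rewrite key; ring.
congr pair.
  transitivity ((1 - t * s) * x - (t * (1 + c)) * y); first by rewrite key2 -c1; ring.
  have -> : t * (1 + c) = t * (2 - t * s) by rewrite [in LHS]c1; ring.
  ring.
transitivity ((1 - t * s) * y + s * x); first by rewrite -c1; ring.
by ring.
Qed.

Lemma measurable_rot u : cabs u = 1 -> complex.Im u != 0 -> measurable_fun setT (crot u).
Proof.
move=> u1 s0; rewrite rot_shears//; apply: measurableT_comp; first exact: measurable_hshear.
by apply: measurableT_comp; [exact: measurable_vshear|exact: measurable_hshear].
Qed.

Lemma lebesgue2_rot u (A : set plane) : cabs u = 1 -> complex.Im u != 0 -> measurable A ->
  lebesgue2 (crot u @^-1` A) = lebesgue2 A.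
Proof.
move=> u1 s0 mA; rewrite rot_shears// !comp_preimage.
set t := - _.
have m1 : measurable (hshear t @^-1` A) by exact: preimage_measurable (measurable_hshear t) mA.
rewrite lebesgue2_hshear; last exact: preimage_measurable (measurable_vshear _) m1.
by rewrite lebesgue2_vshear// lebesgue2_hshear.
Qed.

Lemma ge0_integral_rot u (D : set plane) (f : plane -> \bar R) : cabs u = 1 -> complex.Im u != 0 ->
  measurable D -> crot u @^-1` D = D -> measurable_fun D f -> (forall p, D p -> (0 <= f p)%E) ->
  (\int[lebesgue2]_(p in D) f (crot u p) = \int[lebesgue2]_(p in D) f p)%E.
Proof.
move=> u1 s0 mD uD mf f0.
have mu := measurable_rot u1 s0.
transitivity (\int[pushforward lebesgue2 (crot u)]_(p in D) f p)%E.
  by rewrite ge0_integral_pushforward// ?uD// => p /[!inE] /f0.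
apply: (@eq_measure_integral _ _ _ _ lebesgue2 (pushm lebesgue2 mu)) => A mA _.
exact: lebesgue2_rot.
Qed.

End LebesgueInvariance.

(** * Parseval's identity on the disk *)

Section DiskMeasurability.
Context {R : realType}.
Local Notation C := (R[i]).
Local Notation mR := (measurableTypeR R).
Local Notation plane := (mR * mR)%type.
Local Notation D := (@disk_xy R).
Implicit Types (f g : C -> C) (z w : C).

Lemma disk_xyE (p : plane) : D p <-> cabs (to_complex p) < 1.
Proof. by rewrite /disk_xy /unit_disk/= normCE -(ltcR (cabs _)). Qed.

Lemma measurable_disk : measurable D.
Proof.
pose h : plane -> mR := fun p => p.1 ^+ 2 + p.2 ^+ 2.
have mh : measurable_fun setT h.
  by apply: measurable_funD; apply: measurable_funX; [exact: measurable_fst|exact: measurable_snd].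
have -> : D = h @^-1` `]-oo, 1[%classic.
  apply/seteqP; split=> p; rewrite /= in_itv/= -[X in _ < X](expr1n _ 2).
    by move=> /disk_xyE p1; rewrite /h -(sqr_cabs (to_complex p)) ltr_pXn2r ?nnegrE ?cabs_ge0.
  by rewrite /h -(sqr_cabs (to_complex p)) ltr_pXn2r ?nnegrE ?cabs_ge0// => p1; exact/disk_xyE.
exact: preimage_measurable.
Qed.
Hint Resolve measurable_disk : core.

Lemma rot_disk u : cabs u = 1 -> crot u @^-1` D = D.
Proof.
by move=> u1; apply/seteqP; split=> p /disk_xyE;
  rewrite ?to_complex_rot => h; apply/disk_xyE; rewrite ?to_complex_rot; move: h; rewrite cabsM u1 mul1r.
Qed.

Lemma lebesgue2_disk_lty : (lebesgue2 D < +oo)%E.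
Proof.
apply: (@le_lt_trans _ _ (lebesgue2 (`[(-1 : R), 1]%classic `*` `[(-1 : R), 1]%classic))).
  apply: le_measure; rewrite ?inE//; first exact: measurableX.
  move=> p /disk_xyE p1; have := ler_Re_cabs (to_complex p); have := ler_Im_cabs (to_complex p).
  rewrite /= !ler_norml => /andP[? ?] /andP[? ?].
  by split; rewrite /= in_itv/=; apply/andP; split; lra.
rewrite [X in (X < _)%E]product_measure1E//= !lebesgue_measure_itv/= !lte_fin.
by case: ifP => _; rewrite ?mule0 ?ltry// -EFinB -EFinM ltry.
Qed.

Definition cmeas f := measurable_fun D (fun p => complex.Re (f (to_complex p)) : mR) /\
  measurable_fun D (fun p => complex.Im (f (to_complex p)) : mR).

Lemma cmeas_cst c : cmeas (fun=> c).
Proof. by split; exact: measurable_cst. Qed.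

Lemma cmeas_id : cmeas id.
Proof. by split; apply: measurable_funTS; [exact: measurable_fst|exact: measurable_snd]. Qed.

Lemma cmeasD f g : cmeas f -> cmeas g -> cmeas (fun z => f z + g z).
Proof.
move=> [f1 f2] [g1 g2]; split.
  by under eq_fun do rewrite cReD; exact: measurable_funD.
by under eq_fun do rewrite cImD; exact: measurable_funD.
Qed.

Lemma cReM z w : complex.Re (z * w) = complex.Re z * complex.Re w - complex.Im z * complex.Im w.
Proof. by case: z; case: w. Qed.
Lemma cImM z w : complex.Im (z * w) = complex.Re z * complex.Im w + complex.Im z * complex.Re w.
Proof. by case: z => a b; case: w => c d /=; rewrite [b * c]mulrC. Qed.

Lemma cmeasM f g : cmeas f -> cmeas g -> cmeas (fun z => f z * g z).
Proof.
move=> [f1 f2] [g1 g2]; split.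
  by under eq_fun do rewrite cReM; apply: measurable_funB; exact: measurable_funM.
by under eq_fun do rewrite cImM; apply: measurable_funD; exact: measurable_funM.
Qed.

Lemma cmeasJ f : cmeas f -> cmeas (fun z => (f z)^*%R).
Proof.
move=> [f1 f2]; split.
  by apply: eq_measurable_fun f1 => p _; rewrite /= cReJ.
by apply: eq_measurable_fun (measurable_funN f2) => p _; rewrite /= cImJ.
Qed.

Lemma cmeasZ c f : cmeas f -> cmeas (fun z => c * f z).
Proof. by apply: cmeasM; exact: cmeas_cst. Qed.

Lemma cmeasX f n : cmeas f -> cmeas (fun z => f z ^+ n).
Proof.
move=> mf; elim: n => [|n IH]; first exact: cmeas_cst.
by under eq_fun do rewrite exprS; exact: cmeasM.
Qed.

Lemma cmeas_sum N (F : nat -> C -> C) : (forall n, cmeas (F n)) -> cmeas (fun z => \sum_(n < N) F n z).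
Proof.
move=> mF; elim: N => [|N IH].
  by under eq_fun do rewrite big_ord0; exact: cmeas_cst.
by under eq_fun do rewrite big_ord_recr/=; exact: cmeasD.
Qed.

Lemma eq_cmeas f g : (forall z, cabs z < 1 -> f z = g z) -> cmeas f -> cmeas g.
Proof.
move=> fg [f1 f2]; split; [apply: eq_measurable_fun f1|apply: eq_measurable_fun f2];
  by move=> p /[!inE]/disk_xyE/fg ->.
Qed.

Lemma cmeas_poly (a : nat -> C) N : cmeas (fun z => \sum_(n < N) a n * z ^+ n).
Proof. by apply: (cmeas_sum N (F := fun n z => a n * z ^+ n)) => n; apply/cmeasZ/cmeasX/cmeas_id. Qed.

Lemma ccvg_Re (u : nat -> C) l : ccvg u l -> (fun n => complex.Re (u n)) @ \oo --> complex.Re l.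
Proof.
move=> /cvgrPdist_lt ul; apply/cvgrPdist_lt => e e0; apply: filterS (ul _ e0) => n.
rewrite sub0r normrN ger0_norm ?cabs_ge0// cabsB; apply: le_lt_trans.
by rewrite -cReN -cReD ler_Re_cabs.
Qed.

Lemma ccvg_Im (u : nat -> C) l : ccvg u l -> (fun n => complex.Im (u n)) @ \oo --> complex.Im l.
Proof.
move=> /cvgrPdist_lt ul; apply/cvgrPdist_lt => e e0; apply: filterS (ul _ e0) => n.
rewrite sub0r normrN ger0_norm ?cabs_ge0// cabsB; apply: le_lt_trans.
by rewrite -cImN -cImD ler_Im_cabs.
Qed.

Lemma ccvg_cabs (u : nat -> C) l : ccvg u l -> (fun n => cabs (u n)) @ \oo --> cabs l.
Proof.
move=> /cvgrPdist_lt ul; apply/cvgrPdist_lt => e e0; apply: filterS (ul _ e0) => n.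
rewrite sub0r normrN ger0_norm ?cabs_ge0// cabsB; apply: le_lt_trans.
have := cabs_triangle (u n - l) l; have := cabs_triangle (l - u n) (u n).
by rewrite !subrK [cabs (u n - l)]cabsB ler_norml => ? ?; apply/andP; split; lra.
Qed.

Lemma cmeas_lim (F : nat -> C -> C) f : (forall n, cmeas (F n)) ->
  (forall z, cabs z < 1 -> ccvg (F^~ z) (f z)) -> cmeas f.
Proof.
move=> mF Ff; split.
  apply: (measurable_fun_cvg (fun n => (mF n).1)) => p /disk_xyE p1; exact: ccvg_Re (Ff _ p1).
apply: (measurable_fun_cvg (fun n => (mF n).2)) => p /disk_xyE p1; exact: ccvg_Im (Ff _ p1).
Qed.

Lemma cmeas_pexp f (a : nat -> C) : pexp f 0 1 a -> cmeas f.
Proof.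
move=> fa; apply: (cmeas_lim (F := fun N z => \sum_(n < N) a n * z ^+ n)).
  by move=> n; exact: cmeas_poly.
by move=> z z1; have := fa z; rewrite subr0 => /(_ z1).
Qed.

Lemma measurable_cabs2 f : cmeas f -> measurable_fun D (fun p => ((cabs (f (to_complex p)) ^+ 2)%:E)).
Proof.
move=> [f1 f2]; apply/measurable_EFinP.
under eq_fun do rewrite sqr_cabs.
by apply: measurable_funD; exact: measurable_funX.
Qed.

Lemma cmeas_rot u f : cabs u = 1 -> complex.Im u != 0 -> cmeas f -> cmeas (fun z => f (u * z)).
Proof.
move=> u1 s0 [f1 f2].
have mu : measurable_fun D (crot u) by apply: measurable_funTS; exact: measurable_rot.
have uD : crot u @` D `<=` D by rewrite -{1}(rot_disk u1); exact: image_preimage_subset.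
split.
  have := measurable_comp measurable_disk uD f1 mu.
  by apply: eq_measurable_fun => p _ /=; rewrite to_complex_rot.
have := measurable_comp measurable_disk uD f2 mu.
by apply: eq_measurable_fun => p _ /=; rewrite to_complex_rot.
Qed.

End DiskMeasurability.
#[export] Hint Resolve measurable_disk : core.

(** * Discrete Parseval identity over rotations by roots of unity, integrated over the disk *)

Section Parseval.
Context {R : realType}.
Local Notation C := (R[i]).
Local Notation mR := (measurableTypeR R).
Local Notation plane := (mR * mR)%type.
Local Notation D := (@disk_xy R).
Implicit Types (f g : C -> C) (z w : C) (a : nat -> C).

(** Extended-real, so that finiteness is a separate statement; the factor [1 / pi] enters later, in
    [nrm2] and [wt]. *)
Definition sqint f : \bar R := \int[lebesgue2]_(p in D) (cabs (f (to_complex p)) ^+ 2)%:E.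

Lemma sqint_ge0 f : (0 <= sqint f)%E.
Proof. by apply: integral_ge0 => p _; rewrite lee_fin sqr_ge0. Qed.

Lemma eq_sqint f g : (forall z, cabs z < 1 -> cabs (f z) = cabs (g z)) -> sqint f = sqint g.
Proof. by move=> fg; apply: eq_integral => p /[!inE]/disk_xyE p1; rewrite fg. Qed.

Lemma sqint_le f (K : R) : cmeas f -> (forall z, cabs z < 1 -> cabs (f z) <= K) ->
  (sqint f <= (K ^+ 2)%:E * lebesgue2 D)%E.
Proof.
move=> mf fK; rewrite -integral_cst//; apply: ge0_le_integral => //.
- by move=> p _; rewrite lee_fin sqr_ge0.
- exact: measurable_cabs2.
move=> p /disk_xyE/fK h; rewrite lee_fin lerXn2r ?nnegrE ?cabs_ge0//.
exact: le_trans (cabs_ge0 _) h.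
Qed.

Lemma sqint_bounded f (K : R) : cmeas f -> (forall z, cabs z < 1 -> cabs (f z) <= K) ->
  (sqint f < +oo)%E.
Proof.
move=> mf fK; apply: le_lt_trans (sqint_le mf fK) _.
by rewrite lte_mul_pinfty ?lee_fin ?sqr_ge0// lebesgue2_disk_lty.
Qed.

Lemma sqintZ c f : cmeas f -> sqint (fun z => c * f z) = ((cabs c ^+ 2)%:E * sqint f)%E.
Proof.
move=> mf; rewrite -ge0_integralZl ?lee_fin ?sqr_ge0//.
- by apply: eq_integral => p _; rewrite cabsM exprMn EFinM.
- exact: measurable_cabs2.
- by move=> p _; rewrite lee_fin sqr_ge0.
Qed.

Lemma sqint_sum N (F : nat -> C -> C) : (forall n, cmeas (F n)) ->
  (\int[lebesgue2]_(p in D) (\sum_(n < N) cabs (F n (to_complex p)) ^+ 2)%:E =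
   \sum_(n < N) sqint (F n))%E.
Proof.
move=> mF; rewrite -ge0_integral_sum//.
- by apply: eq_integral => p _; rewrite sumEFin.
- by move=> n; exact: measurable_cabs2.
- by move=> n p _; rewrite lee_fin sqr_ge0.
Qed.

(** A real number of modulus 1 squares to 1. Primitive roots of order above 2 are thus not real, as
    the factorization into shears requires. *)
Lemma prim_root_Im M w : M.-primitive_root w -> (2 < M)%N -> complex.Im w != 0.
Proof.
move=> wM M2; apply/eqP => w0; have := prim_root_cabs wM.
have wR : w = (complex.Re w)%:C by case: w w0 {wM} => x y /= ->.
move=> h; have : w ^+ 2 = 1.
  by rewrite wR -rmorphXn/= -real_normK ?num_real// -cabs_real -wR h expr1n.
by move=> /eqP; rewrite -(prim_order_dvd wM) => /dvdn_leq -/(_ isT); rewrite leqNgt M2.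
Qed.

Lemma sqint_crot u f : cabs u = 1 -> complex.Im u != 0 -> cmeas f ->
  sqint (fun z => f (u * z)) = sqint f.
Proof.
move=> u1 s0 mf.
rewrite -[RHS](ge0_integral_rot u1 s0 (@measurable_disk R) (rot_disk u1) (measurable_cabs2 mf)); last first.
  by move=> p _; rewrite lee_fin sqr_ge0.
by apply: eq_integral => p _; rewrite to_complex_rot.
Qed.

Lemma cmeas_prim_root M w f k : M.-primitive_root w -> (2 < M)%N -> cmeas f ->
  cmeas (fun z => f (w ^+ k * z)).
Proof.
move=> wM M2 mf; elim: k => [|k IH].
  by under eq_fun do rewrite expr0 mul1r.
under eq_fun do rewrite exprSr -mulrA.
apply: (cmeas_rot (f := fun z => f (w ^+ k * z))) => //; first exact: prim_root_cabs wM.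
exact: prim_root_Im wM M2.
Qed.

(** Some powers of [w] may be real, so the invariance is iterated one factor [w] at a time. *)
Lemma sqint_prim_root M w f k : M.-primitive_root w -> (2 < M)%N -> cmeas f ->
  sqint (fun z => f (w ^+ k * z)) = sqint f.
Proof.
move=> wM M2 mf; elim: k => [|k IH].
  by under eq_fun do rewrite expr0 mul1r.
under eq_fun do rewrite exprSr -mulrA.
rewrite (sqint_crot (f := fun z => f (w ^+ k * z))) ?IH//; first exact: prim_root_cabs wM.
  exact: prim_root_Im wM M2.
exact: cmeas_prim_root wM M2 mf.
Qed.

Lemma cmeas_root_avg M w n f : M.-primitive_root w -> (2 < M)%N -> cmeas f ->
  cmeas (root_avg M w n f).
Proof.
move=> wM M2 mf; apply: cmeasZ.
apply: (cmeas_sum M (F := fun k z => f (w ^+ k * z) / (w ^+ k) ^+ n)) => k.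
by apply: cmeasM; [exact: cmeas_prim_root wM M2 mf|exact: cmeas_cst].
Qed.

Lemma conj_unit (u : C) : cabs u = 1 -> u^*%R = u^-1.
Proof.
move=> u1; have u0 : u != 0 by rewrite -cabs_eq0 u1 oner_eq0.
by apply: (mulfI u0); rewrite mul_conj u1 expr1n divff.
Qed.

(** Parseval for the finite Fourier transform of [k |-> f (w ^+ k * z)]: after expanding the
    squares, the sum over [n] kills the terms with [k != l]. *)
Lemma root_avg_parseval M w f z : M.-primitive_root w ->
  \sum_(n < M) cabs (root_avg M w n f z) ^+ 2 = M%:R^-1 * \sum_(k < M) cabs (f (w ^+ k * z)) ^+ 2.
Proof.
move=> wM; have M0 : M%:R != 0 :> C by rewrite pnatr_eq0 -lt0n (prim_order_gt0 wM).
have w0 := prim_root_neq0 wM.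
apply: (@complexI R); rewrite rmorph_sum rmorphM rmorph_sum/= fmorphV rmorph_nat.
pose F k := f (w ^+ k * z).
have wJ (k n : nat) : ((w ^+ k) ^+ n)^*%R = (w ^+ k) ^- n.
  by rewrite conj_unit// !cabsX (prim_root_cabs wM) !expr1n.
transitivity (\sum_(n < M) M%:R^-2 * \sum_(k < M) \sum_(l < M) F k * (F l)^*%R *
    ((w ^+ n) ^+ l / (w ^+ n) ^+ k)).
  apply: eq_bigr => n _; rewrite -mul_conj /root_avg conjcM conjc_sum conjcV conjC_nat.
  rewrite mulrACA -invfM -expr2; congr (_ * _).
  rewrite mulr_suml; apply: eq_bigr => k _; rewrite mulr_sumr; apply: eq_bigr => l _.
  rewrite conjcM conjcV wJ invrK -!exprM ![(n * _)%N]mulnC -/(F k) -/(F l); ring.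
rewrite -mulr_sumr exchange_big/=; under eq_bigr do rewrite exchange_big/=.
rewrite expr2 invfM -mulrA; congr (_ * _); rewrite mulr_sumr; apply: eq_bigr => k _.
rewrite (bigD1 k)//= [X in _ + X]big1 ?addr0; last first.
  by move=> l lk; rewrite -mulr_sumr sum_prim_root// val_eqE (negbTE lk) mulr0.
by rewrite -mulr_sumr sum_prim_root// eqxx mul_conj mulrCA mulVf// mulr1.
Qed.

(** The discrete identity is integrated; its right side averages rotated copies of [f], all with the
    same integral. *)
Lemma sqint_root_avg M w f : M.-primitive_root w -> (2 < M)%N -> cmeas f ->
  sqint f = (\sum_(n < M) sqint (root_avg M w n f))%E.
Proof.
move=> wM M2 mf; have M0 := prim_order_gt0 wM.
rewrite -(sqint_sum M (F := root_avg M w ^~ f)); last first.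
  by move=> n; exact: cmeas_root_avg wM M2 mf.
under eq_integral do rewrite (root_avg_parseval _ _ wM) EFinM.
rewrite ge0_integralZl//; last 2 first.
- apply/measurable_EFinP; apply: measurable_sum => k.
  apply/measurable_EFinP; apply: (measurable_cabs2 (f := fun z => f (w ^+ k * z))).
  exact: cmeas_prim_root wM M2 mf.
- by move=> p _; rewrite lee_fin sumr_ge0// => k _; rewrite sqr_ge0.
rewrite (sqint_sum M (F := fun k z => f (w ^+ k * z))); last first.
  by move=> k; exact: cmeas_prim_root wM M2 mf.
under eq_bigr do rewrite (sqint_prim_root _ wM M2 mf).
rewrite sumr_const card_ord -[X in (_ * X)%E]/(sqint f *+ M)%E -mule_natl muleA -EFinM mulVf ?mul1e//.
by rewrite pnatr_eq0 -lt0n.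
Qed.

End Parseval.

(** * From polynomials to power series by Fatou's lemma *)

Section ParsevalIdentity.
Context {R : realType}.
Local Notation C := (R[i]).
Local Notation mR := (measurableTypeR R).
Local Notation plane := (mR * mR)%type.
Local Notation D := (@disk_xy R).
Implicit Types (f g : C -> C) (z w : C) (a : nat -> C).

Definition mom n : R := fine (sqint (fun z : C => z ^+ n)).

Lemma cabsX_le1 z n : cabs z < 1 -> cabs (z ^+ n) <= 1.
Proof. by move=> z1; rewrite cabsX exprn_ile1 ?cabs_ge0// ltW. Qed.

Lemma cmeas_Xn n : cmeas (fun z : C => z ^+ n).
Proof. exact/cmeasX/cmeas_id. Qed.

Lemma sqint_Xn n : sqint (fun z : C => z ^+ n) = (mom n)%:E.
Proof.
rewrite fineK// ge0_fin_numE ?sqint_ge0//.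
by apply: (sqint_bounded (cmeas_Xn n) (K := 1)) => z; exact: cabsX_le1.
Qed.

Lemma mom_ge0 n : 0 <= mom n. Proof. by rewrite -lee_fin -sqint_Xn sqint_ge0. Qed.

Lemma sqint_monomial a n : sqint (fun z => a n * z ^+ n) = (cabs (a n) ^+ 2 * mom n)%:E.
Proof. by rewrite sqintZ ?sqint_Xn//; exact: cmeas_Xn. Qed.

(** Order above 2 for the rotation invariance, and at least [N] so that polynomials of degree below
    [N] show no aliasing. *)
Lemma prim_root3 N : exists M w, [/\ M.-primitive_root (w : C), (2 < M)%N & M = (N + 3)%N].
Proof.
have [w wM] : exists w : C, (N + 3).-primitive_root w by apply: prim_root_exists; rewrite addn3.
by exists (N + 3)%N, w; split=> //; rewrite addn3.
Qed.

Lemma sqint_poly a N :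
  sqint (fun z => \sum_(n < N) a n * z ^+ n) = (\sum_(n < N) cabs (a n) ^+ 2 * mom n)%:E.
Proof.
have [M [w [wM M2 ME]]] := prim_root3 N.
rewrite (sqint_root_avg wM M2); last exact: cmeas_poly.
rewrite (eq_bigr (fun n : 'I_M => if (n < N)%N then (cabs (a n) ^+ 2 * mom n)%:E else 0%E)); last first.
  move=> n _; rewrite -sqint_monomial.
  have NM : (N <= M)%N by rewrite ME leq_addr.
  case: ifP => nN.
    by apply: eq_sqint => z _; rewrite root_avg_poly// nN mulr1n.
  have := sqintZ 0 (@cmeas_id R); rewrite cabs0 expr0n mul0e => <-.
  by apply: eq_sqint => z _; rewrite root_avg_poly// nN mulr0n mul0r.
rewrite -big_mkcond/= -sumEFin (big_ord_widen M (fun n => (cabs (a n) ^+ 2 * mom n)%:E))//.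
by rewrite ME leq_addr.
Qed.

Lemma fatou_bound (h : nat -> plane -> R) (l : plane -> R) (B : \bar R) :
  (forall n, measurable_fun D (EFin \o h n)) -> (forall n p, D p -> 0 <= h n p) ->
  (forall p, D p -> (fun n => h n p) @ \oo --> l p) ->
  (forall n, (\int[lebesgue2]_(p in D) (h n p)%:E <= B)%E) ->
  (\int[lebesgue2]_(p in D) (l p)%:E <= B)%E.
Proof.
move=> mh h0 hl hB.
have := @fatou _ _ _ lebesgue2 D (@measurable_disk R) (fun n p => (h n p)%:E) mh.
have h0' n p : D p -> (0 <= (h n p)%:E)%E by move=> Dp; rewrite lee_fin h0.
move=> /(_ h0').
have -> : (\int[lebesgue2]_(p in D) limn_einf (fun n => (h n p)%:E) =
           \int[lebesgue2]_(p in D) (l p)%:E)%E.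
  apply: eq_integral => p /[!inE] Dp.
  have : (fun n => (h n p)%:E) @ \oo --> (l p)%:E.
    by apply: cvg_EFin; [exact: nearW|exact: hl].
  by move=> /cvg_limn_einf_sup [].
move=> /le_trans; apply.
rewrite limn_einf_lim; apply: lime_le; first exact: is_cvg_einfs.
apply: nearW => n; apply: le_trans (hB n).
by apply: ereal_inf_lbound; exists n => //=.
Qed.

Lemma cvg_sum_ord N (F : nat -> nat -> R) (l : nat -> R) :
  (forall n, F n @ \oo --> l n) -> (fun M => \sum_(n < N) F n M) @ \oo --> \sum_(n < N) l n.
Proof.
move=> Fl; elim: N => [|N IH].
  by rewrite big_ord0; under eq_fun do rewrite big_ord0; exact: cvg_cst.
by rewrite big_ord_recr/=; under eq_fun do rewrite big_ord_recr/=; exact: cvgD.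
Qed.

Lemma lee_sum_ord N M (E : nat -> \bar R) : (N <= M)%N -> (forall n, (0 <= E n)%E) ->
  (\sum_(n < N) E n <= \sum_(n < M) E n)%E.
Proof.
move=> NM E0; rewrite -(subnKC NM) big_split_ord/= leeDl// sume_ge0// => n _; exact: E0.
Qed.

(** Bessel's inequality: at every order the sum over [n < N] is part of the discrete Parseval sum,
    and the averages tend pointwise to [a n * z ^+ n], so Fatou's lemma applies. *)
Lemma sqint_lower f a N : pexp f 0 1 a ->
  ((\sum_(n < N) cabs (a n) ^+ 2 * mom n)%:E <= sqint f)%E.
Proof.
move=> fa; have mf := cmeas_pexp fa.
have [w wM] := @prim_root_seq R.
rewrite -sumEFin; under eq_bigr do rewrite -sqint_monomial.
rewrite -(sqint_sum N (F := fun n z => a n * z ^+ n)); last first.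
  by move=> n; exact/cmeasZ/cmeas_Xn.
(* The shift makes the order exceed both [N] and 2 for every [M]. *)
pose av M n z := root_avg (M + N).+3 (w (M + N).+2) n f z.
apply: (@fatou_bound (fun M p => \sum_(n < N) cabs (av M n (to_complex p)) ^+ 2)).
- move=> M; apply/measurable_EFinP; apply: measurable_sum => n; apply/measurable_EFinP.
  by apply: measurable_cabs2; apply: cmeas_root_avg (wM _) _ mf.
- by move=> M p _; apply: sumr_ge0 => n _; rewrite sqr_ge0.
- move=> p /disk_xyE p1.
  pose s := (1 + cabs (to_complex p)) / 2.
  have p0 := cabs_ge0 (to_complex p).
  have s0 : 0 < s by rewrite /s; lra.
  have ps : cabs (to_complex p) < s by rewrite /s; lra.
  have [K aK] : exists K, forall n, cabs (a n) * s ^+ n <= K.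
    by apply: (pexp_bound fa); rewrite /s; lra.
  apply: (@cvg_sum_ord N (fun n M => cabs (av M n (to_complex p)) ^+ 2) (fun n => cabs (a n * to_complex p ^+ n) ^+ 2)) => n.
  have : ccvg (fun M => av M n (to_complex p)) (a n * to_complex p ^+ n).
    have := ccvg_addn (N.+2) (root_avg_cvg n wM s0 aK ps).
    have pw M k : cabs (w M ^+ k * to_complex p) < 1.
      by rewrite cabsM cabsX (prim_root_cabs (wM M)) expr1n mul1r.
    congr ccvg; apply/funext => M; rewrite /av !addnS /root_avg; congr (_ * _).
    by apply: eq_bigr => k _; rewrite (pexp_psvE fa).
  by move=> /ccvg_cabs h; rewrite !expr2; under eq_fun do rewrite expr2; exact: cvgM.
- move=> M; rewrite (sqint_sum N (F := av M)); last first.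
    by move=> n; apply: cmeas_root_avg (wM _) _ mf.
  rewrite (sqint_root_avg (wM (M + N).+2) isT mf).
  apply: (@lee_sum_ord _ _ (fun n => sqint (av M n))); first by rewrite (leq_trans (leq_addl M N))// -addn3 leq_addr.
  by move=> n; exact: sqint_ge0.
Qed.

Lemma sqint_upper f a (K : R) : pexp f 0 1 a ->
  (forall N, \sum_(n < N) cabs (a n) ^+ 2 * mom n <= K) -> (sqint f <= K%:E)%E.
Proof.
move=> fa aK; apply: (@fatou_bound (fun N p => cabs (\sum_(n < N) a n * to_complex p ^+ n) ^+ 2)).
- move=> N; apply: (measurable_cabs2 (f := fun z => \sum_(n < N) a n * z ^+ n)); exact: cmeas_poly.
- by move=> N p _; rewrite sqr_ge0.
- move=> p /disk_xyE p1; have := fa (to_complex p); rewrite subr0 => /(_ p1) /ccvg_cabs h.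
  by rewrite !expr2; under eq_fun do rewrite expr2; exact: cvgM.
by move=> N; rewrite [X in (X <= _)%E]sqint_poly lee_fin.
Qed.

Lemma parseval f a : pexp f 0 1 a -> (sqint f < +oo)%E ->
  (fun N => \sum_(n < N) cabs (a n) ^+ 2 * mom n) @ \oo --> fine (sqint f).
Proof.
move=> fa foo; pose S N := \sum_(n < N) cabs (a n) ^+ 2 * mom n.
have fE : sqint f = (fine (sqint f))%:E by rewrite fineK// ge0_fin_numE ?sqint_ge0.
have Sle N : S N <= fine (sqint f) by rewrite -lee_fin -fE; exact: sqint_lower.
have Snd : nondecreasing_seq S.
  apply/nondecreasing_seqP => n; rewrite /S big_ord_recr/= lerDl.
  by rewrite mulr_ge0 ?sqr_ge0 ?mom_ge0.
have Scvg : cvgn S by apply: nondecreasing_is_cvgn => //; exists (fine (sqint f)) => _ [n _ <-].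
suff -> : fine (sqint f) = limn S by [].
apply/eqP; rewrite eq_le; apply/andP; split.
  rewrite -lee_fin -fE; apply: (sqint_upper fa) => N; exact: nondecreasing_cvgn_le.
by apply: limr_le => //; exact: nearW.
Qed.

End ParsevalIdentity.

(** * Moments of the disk *)

Section Moments.
Context {R : realType}.
Local Notation C := (R[i]).
Local Notation mR := (measurableTypeR R).
Local Notation plane := (mR * mR)%type.
Local Notation D := (@disk_xy R).
Implicit Types (s : R).

Lemma measurable_cabsXn n :
  measurable_fun D (fun p => (cabs (to_complex p ^+ n) ^+ 2)%:E : \bar R).
Proof. exact: (measurable_cabs2 (cmeas_Xn n)). Qed.

Lemma mom_le n m : mom (n + m) <= mom n :> R.
Proof.
rewrite -lee_fin -!sqint_Xn; apply: ge0_le_integral => //.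
- by move=> p _; rewrite lee_fin sqr_ge0.
- exact: measurable_cabsXn.
- exact: measurable_cabsXn.
move=> p /disk_xyE p1; rewrite lee_fin lerXn2r ?nnegrE ?cabs_ge0//.
by rewrite exprD cabsM ler_piMr ?cabs_ge0// cabsX_le1.
Qed.

(** The rectangle [[s, t] x [0, 1 - t]] lies in the disk because [t^2 + (1 - t)^2 < 1], and
    [|z| >= s] on it; [k] is its area. *)
Lemma mom_lower s : 0 < s < 1 -> exists2 k : R, 0 < k & forall n, (s ^+ n) ^+ 2 * k <= mom n.
Proof.
move=> /andP[s0 s1]; pose t := (1 + s) / 2; pose k := (t - s) * (1 - t).
have st : s < t by rewrite /t; lra.
have t1 : t < 1 by rewrite /t; lra.
exists k; first by rewrite mulr_gt0 ?subr_gt0.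
move=> n; pose B : set plane := `[s, t]%classic `*` `[0, (1 - t)]%classic.
have mB : measurable B by exact: measurableX.
have BD : B `<=` D.
  move=> [x y] [/=]; rewrite !in_itv/= => /andP[sx xt] /andP[y0 yt]; apply/disk_xyE.
  rewrite -(@ltr_pXn2r _ 2) ?nnegrE ?cabs_ge0// sqr_cabs /to_complex/= expr1n.
  nra.
rewrite -lee_fin -sqint_Xn /sqint.
apply: (@le_trans _ _ (\int[lebesgue2]_(p in B) (cabs (to_complex p ^+ n) ^+ 2)%:E)%E); last first.
  apply: ge0_subset_integral => //; first exact: measurable_cabsXn.
  by move=> p _; rewrite lee_fin sqr_ge0.
have <- : (\int[lebesgue2]_(p in B) ((s ^+ n) ^+ 2)%:E = ((s ^+ n) ^+ 2 * k)%:E)%E.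
  rewrite integral_cst// [X in (_ * X)%E]product_measure1E//= !lebesgue_measure_itv/= !lte_fin st subr_gt0 t1.
  by rewrite -!EFinB -!EFinM subr0.
apply: ge0_le_integral => //.
- by move=> p _; rewrite lee_fin sqr_ge0.
- by apply: measurable_funS (measurable_disk) BD _; exact: measurable_cabsXn.
move=> [x y] [/=]; rewrite !in_itv/= => /andP[sx xt] _.
rewrite lee_fin lerXn2r ?nnegrE ?cabs_ge0 ?exprn_ge0 ?(ltW s0)//.
rewrite cabsX lerXn2r ?nnegrE ?cabs_ge0 ?(ltW s0)//.
rewrite (le_trans sx)//; have := ler_Re_cabs (to_complex (x, y)); rewrite /to_complex/=.
by apply: le_trans; exact: ler_norm.
Qed.

Lemma mom_gt0 n : 0 < mom n :> R.
Proof.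
have [|k k0 h] := @mom_lower (1 / 2); first by apply/andP; split; lra.
by apply: lt_le_trans (h n); rewrite mulr_gt0// !exprn_gt0.
Qed.

(** A pointwise bound on [|z|^(2n)]: where [|z| <= s] the second term dominates it, and where
    [|z| > s] the first and third do, since [s^(2m) <= |z|^(2m)]. *)
Lemma mom_split s n m : 0 <= s <= 1 ->
  mom n <= mom (n + m) + (s ^+ n) ^+ 2 * fine (lebesgue2 D) + (1 - (s ^+ m) ^+ 2) * mom n.
Proof.
move=> /andP[s0 s1]; set A := fine _.
have AE : lebesgue2 D = A%:E by rewrite fineK// ge0_fin_numE ?measure_ge0// lebesgue2_disk_lty.
have sm : 0 <= 1 - (s ^+ m) ^+ 2 by rewrite subr_ge0 -exprM exprn_ile1.
have mX k : measurable_fun D (fun p => (cabs (to_complex p ^+ k) ^+ 2)%:E : \bar R).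
  exact: measurable_cabsXn.
rewrite -lee_fin EFinD EFinD -[X in (_ <= _ + X)%E]EFinM EFinM EFinM -AE -!sqint_Xn.
rewrite -integral_cst// -ge0_integralZl//; last by move=> p _; rewrite lee_fin sqr_ge0.
rewrite -ge0_integralD//; last 2 first.
- by move=> p _; rewrite lee_fin sqr_ge0.
- by move=> p _; rewrite lee_fin sqr_ge0.
rewrite -ge0_integralD//; last 4 first.
- by move=> p _; rewrite adde_ge0// lee_fin sqr_ge0.
- exact: emeasurable_funD.
- by move=> p _; rewrite mule_ge0// lee_fin ?sqr_ge0.
- by apply: measurable_funeM.
apply: ge0_le_integral => //.
- by move=> p _; rewrite lee_fin sqr_ge0.
- by apply: emeasurable_funD; [exact: emeasurable_funD|exact: measurable_funeM].
move=> p /disk_xyE p1; rewrite /= -EFinM -!EFinD lee_fin exprD cabsM !cabsX.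
set x := cabs _ in p1 *; have x0 : 0 <= x by exact: cabs_ge0.
have hX := sqr_ge0 (x ^+ n); have hY := sqr_ge0 (x ^+ m); have hS := sqr_ge0 (s ^+ n).
rewrite exprMn; have [xs|sx] := leP x s.
  have h1 : (x ^+ n) ^+ 2 <= (s ^+ n) ^+ 2 by rewrite -!exprM lerXn2r// ?nnegrE.
  have := mulr_ge0 hX hY; have := mulr_ge0 sm hX; lra.
have h2 : (s ^+ m) ^+ 2 <= (x ^+ m) ^+ 2 by rewrite -!exprM lerXn2r// ?nnegrE// ltW.
have := ler_wpM2l hX h2; lra.
Qed.

(** Mass concentrates at the boundary: [s] near 1 makes the third term of [mom_split] small, and the
    second, of order [s^(2n)], is negligible against [mom n >= k * t^(2n)] with [s < t]. *)
Lemma mom_ratio m (e : R) : 0 < e -> exists N, forall n, (N <= n)%N -> (1 - e) * mom n <= mom (n + m).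
Proof.
move=> e0.
have [s [s01 sm]] : exists s : R, 0 < s < 1 /\ 1 - (s ^+ m) ^+ 2 <= e / 2.
  have : (fun s : R => 1 - (s ^+ m) ^+ 2) x @[x --> (1 : R)^'-] --> 1 - ((1 : R) ^+ m) ^+ 2.
    apply: cvgB; first exact: cvg_cst.
    apply: (@cvg_comp _ _ _ (fun s : R => s ^+ m) (fun s => s ^+ 2)); last exact: exprn_continuous.
    by apply: cvg_at_left_filter; exact: exprn_continuous.
  rewrite !expr1n subrr => /cvgrPdist_le /(_ (e / 2)).
  have e20 : 0 < e / 2 by lra.
  move=> /(_ e20) h.
  have [s []] : exists s : R, (0 < s < 1) /\ `|0 - (1 - (s ^+ m) ^+ 2)| <= e / 2.
    near (1 : R)^'- => s; exists s; split; last by near: s.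
    by apply/andP; split; near: s; [exact: nbhs_left_gt|exact: nbhs_left_lt].
  move=> s01 hs; exists s; split=> //; apply: le_trans hs.
  by rewrite sub0r normrN ler_norm.
have /andP[s0 s1] := s01; pose t := (1 + s) / 2.
have [k k0 tk] : exists2 k : R, 0 < k & forall n, (t ^+ n) ^+ 2 * k <= mom n.
  by apply: mom_lower; rewrite /t; apply/andP; split; lra.
set A := fine (lebesgue2 D).
have t0 : 0 < t by rewrite /t; lra.
have A0 : 0 <= A by rewrite fine_ge0// measure_ge0.
have : (fun n => A / k * ((s / t) ^+ 2) ^+ n) @ \oo --> (0 : R).
  rewrite -[X in _ --> X](mulr0 (A / k)); apply: cvgMr; apply: cvg_expr.
  have st : 0 <= s / t < 1 by rewrite divr_ge0 ?ltW//= ltr_pdivrMr// mul1r /t; lra.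
  by rewrite ger0_norm ?sqr_ge0// expr_lt1//; case/andP: st.
move=> /cvgrPdist_le /(_ (e / 2)); have e20 : 0 < e / 2 by lra.
move=> /(_ e20) [N _ hN]; exists N => n /hN /=.
rewrite sub0r normrN => /(le_trans (ler_norm _)) h.
have := @mom_split s n m; rewrite (ltW s0) (ltW s1) -/A => /(_ isT).
have h2 : (s ^+ n) ^+ 2 * A <= e / 2 * mom n.
  have := ler_wpM2r (ltW (mom_gt0 n)) h; apply: le_trans.
  have -> : (s ^+ n) ^+ 2 * A = A / k * ((s / t) ^+ 2) ^+ n * ((t ^+ n) ^+ 2 * k).
    have tn0 : t ^+ n != 0 by rewrite expf_neq0// gt_eqF.
    rewrite -[((s / t) ^+ 2) ^+ n]exprM mulnC exprM expr_div_n; field.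
    by rewrite tn0 gt_eqF.
  apply: ler_wpM2l (tk n).
  by rewrite mulr_ge0 ?divr_ge0 ?(ltW k0)// exprn_ge0// sqr_ge0.
have m0 := mom_gt0 n.
by nra.
Unshelve. all: by end_near. Qed.

End Moments.

(** * The inner product on square integrable functions *)

Section InnerProduct.
Context {R : realType}.
Local Notation C := (R[i]).
Local Notation mR := (measurableTypeR R).
Local Notation plane := (mR * mR)%type.
Local Notation D := (@disk_xy R).
Implicit Types (f g h : C -> C) (z w c : C) (a b : nat -> C).

Definition L2 f := cmeas f /\ (sqint f < +oo)%E.

Lemma square_integrableE f : square_integrable f <-> L2 f.
Proof.
have e : (\int[lebesgue2]_(p in D) (complex.Re (`|f (to_complex p)| ^+ 2))%:E)%E = sqint f.
  by apply: eq_integral => p _; rewrite normCE -rmorphXn.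
by rewrite /L2 -e; split=> [[]|[[]]].
Qed.

Lemma L2D f g : L2 f -> L2 g -> L2 (fun z => f z + g z).
Proof.
move=> [mf fo] [mg go]; split; first exact: cmeasD.
apply: (@le_lt_trans _ _ (2%:E * (sqint f + sqint g))%E); last first.
  by rewrite lte_mul_pinfty// lte_add_pinfty.
rewrite -ge0_integralD//; last 4 first.
- by move=> p _; rewrite lee_fin sqr_ge0.
- exact: measurable_cabs2.
- by move=> p _; rewrite lee_fin sqr_ge0.
- exact: measurable_cabs2.
rewrite -ge0_integralZl//; last 2 first.
- by apply: emeasurable_funD; exact: measurable_cabs2.
- by move=> p _; rewrite -EFinD lee_fin addr_ge0 ?sqr_ge0.
apply: ge0_le_integral => //.
- by move=> p _; rewrite lee_fin sqr_ge0.
- exact: (measurable_cabs2 (cmeasD mf mg)).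
- by apply: measurable_funeM; apply: emeasurable_funD; exact: measurable_cabs2.
move=> p _; rewrite -EFinD -EFinM lee_fin.
have := cabs_triangle (f (to_complex p)) (g (to_complex p)).
have := cabs_ge0 (f (to_complex p) + g (to_complex p)).
set x := cabs (f _); set y := cabs (g _); set u := cabs _ => u0 uxy.
have := sqr_ge0 (x - y); have : u ^+ 2 <= (x + y) ^+ 2 by rewrite lerXn2r ?nnegrE// (le_trans u0).
by rewrite sqrrD sqrrB; lra.
Qed.

Lemma L2M f g (K : R) : cmeas f -> (forall z, cabs z < 1 -> cabs (f z) <= K) -> L2 g ->
  L2 (fun z => f z * g z).
Proof.
move=> mf fK [mg go]; split; first exact: cmeasM.
have K0 : 0 <= K by apply: le_trans (cabs_ge0 _) (fK 0 _); rewrite cabs0.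
apply: (@le_lt_trans _ _ ((K ^+ 2)%:E * sqint g)%E); last first.
  by rewrite lte_mul_pinfty// ?lee_fin ?sqr_ge0.
rewrite -ge0_integralZl//; try by move=> *; rewrite lee_fin sqr_ge0.
  2: exact: measurable_cabs2.
apply: ge0_le_integral => //.
- by move=> p _; rewrite lee_fin sqr_ge0.
- exact: (measurable_cabs2 (cmeasM mf mg)).
- by apply: measurable_funeM; exact: measurable_cabs2.
move=> p /disk_xyE p1; rewrite -EFinM lee_fin cabsM exprMn ler_wpM2r ?sqr_ge0//.
by rewrite lerXn2r ?nnegrE ?cabs_ge0// fK.
Qed.

Lemma L2Z c f : L2 f -> L2 (fun z => c * f z).
Proof. by apply: (@L2M _ _ (cabs c)) => //; exact: cmeas_cst. Qed.

Lemma eq_L2 f g : (forall z, cabs z < 1 -> f z = g z) -> L2 f -> L2 g.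
Proof.
move=> fg [mf fo]; split; first exact: eq_cmeas mf.
by rewrite -(@eq_sqint _ f)// => z z1; rewrite fg.
Qed.

Definition cintegrable f :=
  lebesgue2.-integrable D (fun p => (complex.Re (f (to_complex p)))%:E) /\
  lebesgue2.-integrable D (fun p => (complex.Im (f (to_complex p)))%:E).

Lemma disk_integralD f g : cintegrable f -> cintegrable g ->
  disk_integral (fun z => f z + g z) = disk_integral f + disk_integral g.
Proof.
move=> [f1 f2] [g1 g2]; rewrite /disk_integral.
under eq_Rintegral do rewrite cReD; under [X in _ +i* (_ * X)]eq_Rintegral do rewrite cImD.
by rewrite !RintegralD//; apply/eqP; rewrite eq_complex/= !mulrDr !eqxx.
Qed.

Lemma Rintegral_lin (u v : plane -> R) (x y : R) :
  lebesgue2.-integrable D (EFin \o u) -> lebesgue2.-integrable D (EFin \o v) ->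
  \int[lebesgue2]_(p in D) (x * u p + y * v p) =
    x * \int[lebesgue2]_(p in D) u p + y * \int[lebesgue2]_(p in D) v p.
Proof.
move=> iu iv.
have iZ k (w : plane -> R) : lebesgue2.-integrable D (EFin \o w) ->
    lebesgue2.-integrable D (EFin \o (fun p => k * w p)).
  by move=> iw; have := integrableZl (@measurable_disk R) k iw.
by rewrite RintegralD ?RintegralZl//; exact: iZ.
Qed.

Lemma disk_integralZ c f : cintegrable f -> disk_integral (fun z => c * f z) = c * disk_integral f.
Proof.
move=> [f1 f2]; rewrite /disk_integral.
have r1 := Rintegral_lin (complex.Re c) (- complex.Im c) f1 f2.
have r2 := Rintegral_lin (complex.Re c) (complex.Im c) f2 f1.
under eq_Rintegral do rewrite cReM -mulNr.
under [X in _ +i* (_ * X)]eq_Rintegral do rewrite cImM.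
rewrite r1 r2; apply/eqP; rewrite eq_complex cReM cImM/=; apply/andP; split; apply/eqP; ring.
Qed.

Lemma disk_integralJ f : cintegrable f -> disk_integral (fun z => (f z)^*%R) = (disk_integral f)^*%R.
Proof.
move=> [f1 f2]; rewrite /disk_integral.
under eq_Rintegral do rewrite cReJ; under [X in _ +i* (_ * X)]eq_Rintegral do rewrite cImJ -mulN1r.
by rewrite RintegralZl// mulrCA mulN1r.
Qed.

(** [|f| |g| <= |f|^2 + |g|^2] stands in for Cauchy-Schwarz. *)
Lemma cintegrable_mul f g : L2 f -> L2 g -> cintegrable (fun z => f z * (g z)^*%R).
Proof.
move=> [mf fo] [mg go].
have [m1 m2] := cmeasM mf (cmeasJ mg).
have i2 : lebesgue2.-integrable D (fun p => (cabs (f (to_complex p)) ^+ 2 + cabs (g (to_complex p)) ^+ 2)%:E).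
  have i1 u : cmeas u -> (sqint u < +oo)%E ->
      lebesgue2.-integrable D (fun p => (cabs (u (to_complex p)) ^+ 2)%:E).
    move=> mu uo; apply/integrableP; split; first exact: measurable_cabs2.
    apply: le_lt_trans uo; rewrite le_eqVlt; apply/orP; left; apply/eqP.
    by apply: eq_integral => p _; rewrite gee0_abs// lee_fin sqr_ge0.
  by under eq_fun do rewrite EFinD; apply: integrableD => //; exact: i1.
have bound p : cabs (f (to_complex p) * (g (to_complex p))^*%R) <=
    cabs (f (to_complex p)) ^+ 2 + cabs (g (to_complex p)) ^+ 2.
  rewrite cabsM cabsJ; set x := cabs _; set y := cabs _.
  by have := sqr_ge0 (x - y); have := sqr_ge0 (x + y); rewrite sqrrB sqrrD; lra.
split; apply: le_integrable i2 => //.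
- exact/measurable_EFinP.
- move=> p _; rewrite lee_fin [leRHS]ger0_norm ?addr_ge0 ?sqr_ge0//.
  exact: le_trans (ler_Re_cabs _) (bound p).
- exact/measurable_EFinP.
- move=> p _; rewrite lee_fin [leRHS]ger0_norm ?addr_ge0 ?sqr_ge0//.
  exact: le_trans (ler_Im_cabs _) (bound p).
Qed.

Lemma innerDl f g h : L2 f -> L2 g -> L2 h ->
  inner (fun z => f z + g z) h = inner f h + inner g h.
Proof.
move=> f2 g2 h2; rewrite /inner -disk_integralD; try exact: cintegrable_mul.
by congr disk_integral; apply/funext => z; rewrite mulrDl.
Qed.

Lemma innerZl c f h : L2 f -> L2 h -> inner (fun z => c * f z) h = c * inner f h.
Proof.
move=> f2 h2; rewrite /inner -disk_integralZ; last exact: cintegrable_mul.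
by congr disk_integral; apply/funext => z; rewrite mulrA.
Qed.

Lemma innerJ f g : L2 f -> L2 g -> inner g f = (inner f g)^*%R.
Proof.
move=> f2 g2; rewrite /inner -disk_integralJ; last exact: cintegrable_mul.
by congr disk_integral; apply/funext => z; rewrite conjcM conjCK mulrC.
Qed.

Lemma eq_inner f g f' g' : (forall z, cabs z < 1 -> f z * (g z)^*%R = f' z * (g' z)^*%R) ->
  inner f g = inner f' g'.
Proof.
move=> e; rewrite /inner /disk_integral.
by congr (_ * _ +i* (_ * _)); apply: eq_Rintegral => p /[!inE] /disk_xyE /e ->.
Qed.

Lemma innerDr f g h : L2 f -> L2 g -> L2 h ->
  inner h (fun z => f z + g z) = inner h f + inner h g.
Proof. by move=> ? ? ?; rewrite innerJ ?innerDl// ?conjcD -?innerJ//; exact: L2D. Qed.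

Lemma innerZr c f h : L2 f -> L2 h -> inner h (fun z => c * f z) = c^*%R * inner h f.
Proof. by move=> ? ?; rewrite innerJ ?innerZl// ?conjcM -?innerJ//; exact: L2Z. Qed.

Definition nrm2 f : R := pi^-1 * fine (sqint f).

Lemma inner_self f : inner f f = (nrm2 f)%:C.
Proof.
rewrite /inner /disk_integral /nrm2; under eq_Rintegral do rewrite mul_conj/=.
under [X in _ +i* (_ * X)]eq_Rintegral do rewrite mul_conj/=.
by rewrite [X in _ +i* (_ * X)](_ : _ = 0) ?mulr0// /Rintegral integral0.
Qed.

Lemma nrm2_ge0 f : 0 <= nrm2 f.
Proof. by rewrite mulr_ge0 ?invr_ge0 ?pi_ge0// fine_ge0// sqint_ge0. Qed.

End InnerProduct.

(** * The Bergman space in terms of Taylor coefficients *)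

Section BergmanCoefficients.
Context {R : realType}.
Local Notation C := (R[i]).
Implicit Types (f g h k : C -> C^o) (z w c : C) (a b : nat -> C).

Lemma pexpD f g (r : R) a b : pexp f 0 r a -> pexp g 0 r b ->
  pexp (fun z => f z + g z) 0 r (fun n => a n + b n).
Proof.
move=> fa gb z zr; have := ccvgD (fa z zr) (gb z zr); congr ccvg.
by apply/funext => N; rewrite -big_split/=; apply: eq_bigr => n _; rewrite mulrDl.
Qed.

Lemma pexpZ c f (r : R) a : pexp f 0 r a -> pexp (fun z => c * f z) 0 r (fun n => c * a n).
Proof.
move=> fa z zr; have := ccvgZ c (fa z zr); congr ccvg.
by apply/funext => N; rewrite mulr_sumr; apply: eq_bigr => n _; rewrite mulrA.
Qed.

Lemma pexpXn f (r : R) a m : pexp f 0 r a ->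
  pexp (fun z => z ^+ m * f z) 0 r (fun n => if (n < m)%N then 0 else a (n - m)%N).
Proof.
move=> fa z; rewrite subr0 => zr; apply/(ccvg_shift m).
have := fa z; rewrite subr0 => /(_ zr) /(ccvgZ (z ^+ m)); congr ccvg.
apply/funext => N; rewrite [in RHS]addnC big_split_ord/= [X in _ = X + _]big1 ?add0r; last first.
  by move=> i _; rewrite ltn_ord mul0r.
rewrite mulr_sumr; apply: eq_bigr => i _.
by rewrite ltnNge leq_addr/= addKn exprD mulrCA.
Qed.

Lemma pexp_analytic f a z : pexp f 0 1 a -> cabs z < 1 -> analytic_at f z.
Proof.
move=> fa z1; apply/analytic_atE; exists (recenter a z), (1 - cabs z).
rewrite subr_gt0; split=> //.
by have := @pexp_recenter R f 0 z 1 a fa; rewrite subr0; exact.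
Qed.

Lemma unit_diskE z : unit_disk z <-> cabs z < 1.
Proof. by rewrite /unit_disk/= normCE -(ltcR (cabs z)). Qed.

Lemma bergmanP f : bergman f <->
  [/\ exists a, pexp f 0 1 a, (sqint f < +oo)%E & forall z, ~ cabs z < 1 -> f z = 0].
Proof.
split=> [[fan /square_integrableE[mf fo] f0]|[[a fa] fo f0]].
  split=> //; last by move=> z z1; apply: f0 => /unit_diskE.
  by apply: pexp_global => z /unit_diskE; exact: fan.
split; last by move=> z z1; apply: f0 => /unit_diskE.
  by move=> z /unit_diskE; exact: pexp_analytic fa.
by apply/square_integrableE; split=> //; exact: cmeas_pexp fa.
Qed.

Lemma bergman_L2 f : bergman f -> L2 f.
Proof. by case=> _ /square_integrableE. Qed.

Definition coefs f : nat -> C := xget (fun=> 0) [set a | pexp f 0 1 a].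

Lemma coefsP f : bergman f -> pexp f 0 1 (coefs f).
Proof. by move=> /bergmanP[[a fa] _ _]; rewrite /coefs; case: xgetP => [b -> //|/(_ a)]. Qed.

Lemma coefsE f a : pexp f 0 1 a -> coefs f = a.
Proof.
rewrite /coefs => fa; case: xgetP => [b _ /= fb|/(_ a)//].
exact: (pexp_inj _ _ fb fa).
Qed.

Lemma bergman_ext f g : bergman f -> bergman g -> coefs f = coefs g -> f = g.
Proof.
move=> Hf Hg e; apply/funext => z; have [z1|z1] := ltP (cabs z) 1.
  have := coefsP Hf; rewrite e => fa.
  by rewrite (pexp_psvE fa z1) (pexp_psvE (coefsP Hg) z1).
have /bergmanP[_ _ ->] := Hf; last by rewrite ltNge z1.
by have /bergmanP[_ _ ->] := Hg; last by rewrite ltNge z1.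
Qed.

Lemma bergmanD f g : bergman f -> bergman g -> bergman (fun z => f z + g z).
Proof.
move=> Hf Hg; apply/bergmanP; split.
- by eexists; exact: pexpD (coefsP Hf) (coefsP Hg).
- by have [] := L2D (bergman_L2 Hf) (bergman_L2 Hg).
move=> z z1; have /bergmanP[_ _ ->//] := Hf; have /bergmanP[_ _ ->//] := Hg.
by rewrite addr0.
Qed.

Lemma bergmanZ c f : bergman f -> bergman (fun z => c * f z).
Proof.
move=> Hf; apply/bergmanP; split.
- by eexists; exact: pexpZ (coefsP Hf).
- by have [] := L2Z c (bergman_L2 Hf).
by move=> z z1; have /bergmanP[_ _ ->//] := Hf; rewrite mulr0.
Qed.

Lemma bergmanX f m : bergman f -> bergman (fun z => z ^+ m * f z).
Proof.
move=> Hf; apply/bergmanP; split.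
- by eexists; exact: pexpXn (coefsP Hf).
- have [] // := @L2M _ (fun z => z ^+ m) f 1 _ _ (bergman_L2 Hf); first exact: cmeas_Xn.
  by move=> z; exact: cabsX_le1.
by move=> z z1; have /bergmanP[_ _ ->//] := Hf; rewrite mulr0.
Qed.

Lemma bergman0 : bergman (0 : C -> C^o).
Proof.
have p0 : pexp (0 : C -> C) 0 1 (fun=> 0).
  move=> z _; have := @ccvg_const R 0; congr ccvg; apply/funext => N.
  by rewrite big1// => i _; rewrite mul0r.
apply/bergmanP; split=> //; first by exists (fun=> 0).
by apply: (@sqint_bounded _ _ 0 (cmeas_pexp p0)) => z _; rewrite cabs0.
Qed.

Lemma coefsD f g : bergman f -> bergman g ->
  coefs (fun z => f z + g z) = (fun n => coefs f n + coefs g n).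
Proof. by move=> Hf Hg; exact: coefsE (pexpD (coefsP Hf) (coefsP Hg)). Qed.

Lemma coefsZ c f : bergman f -> coefs (fun z => c * f z) = (fun n => c * coefs f n).
Proof. by move=> Hf; exact: coefsE (pexpZ c (coefsP Hf)). Qed.

Lemma coefsX f m : bergman f ->
  coefs (fun z => z ^+ m * f z) = (fun n => if (n < m)%N then 0 else coefs f (n - m)%N).
Proof. by move=> Hf; exact: coefsE (pexpXn m (coefsP Hf)). Qed.

Lemma coefs0 : coefs 0 = (fun=> 0).
Proof.
apply: coefsE => z _; have := @ccvg_const R 0; congr ccvg; apply/funext => N.
by rewrite big1// => i _; rewrite mul0r.
Qed.

Definition of_coefs a : C -> C^o := fun z => if cabs z < 1 then psv a z else 0.

Lemma of_coefs_pexp a : (forall s : R, 0 < s < 1 -> exists K, forall n, cabs (a n) * s ^+ n <= K) ->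
  pexp (of_coefs a) 0 1 a.
Proof.
move=> ab z; rewrite subr0 => z1; rewrite /of_coefs z1.
pose s := (1 + cabs z) / 2; have z0 := cabs_ge0 z.
have [|K aK] := ab s; first by rewrite /s; apply/andP; split; lra.
by apply: (psv_cvg _ aK); rewrite /s; lra.
Qed.

Lemma of_coefs_bergman a (K : R) : pexp (of_coefs a) 0 1 a ->
  (forall N, \sum_(n < N) cabs (a n) ^+ 2 * mom n <= K) -> bergman (of_coefs a).
Proof.
move=> fa aK; apply/bergmanP; split; first by exists a.
  by apply: le_lt_trans (sqint_upper fa aK) _; exact: ltry.
by move=> z z1; rewrite /of_coefs; case: ifP.
Qed.

(** The squared norm of [z^n] for the normalized area measure. *)
Definition wt n : R := pi^-1 * mom n.

Lemma wt_gt0 n : 0 < wt n.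
Proof. by rewrite mulr_gt0 ?invr_gt0 ?pi_gt0 ?mom_gt0. Qed.

Lemma nrm2_series f : bergman f ->
  (fun N => \sum_(n < N) wt n * cabs (coefs f n) ^+ 2) @ \oo --> nrm2 f.
Proof.
move=> Hf; have /bergmanP[_ fo _] := Hf; have := parseval (coefsP Hf) fo => h.
have -> : (fun N => \sum_(n < N) wt n * cabs (coefs f n) ^+ 2) =
  (fun N => pi^-1 * \sum_(n < N) cabs (coefs f n) ^+ 2 * mom n); last by apply: cvgMr.
by apply/funext => N; rewrite mulr_sumr; apply: eq_bigr => n _; rewrite /wt -mulrA [mom n * _]mulrC.
Qed.

Lemma ccvg_real (u : nat -> R) (l : R) : u @ \oo --> l -> ccvg (fun n => (u n)%:C) l%:C.
Proof.
move=> ul; rewrite /ccvg; under eq_fun do rewrite -rmorphB cabs_real.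
rewrite -(normr0 R) -(subrr l); apply: cvg_norm; apply: cvgB => //; exact: cvg_cst.
Qed.

Lemma inner_self_series f : bergman f ->
  ccvg (fun N => \sum_(n < N) (wt n)%:C * (coefs f n * (coefs f n)^*%R)) (inner f f).
Proof.
move=> Hf; rewrite inner_self; have := ccvg_real (nrm2_series Hf); congr ccvg.
by apply/funext => N; rewrite rmorph_sum; apply: eq_bigr => n _; rewrite mul_conj rmorphM.
Qed.

(* By polarization. *)
Lemma inner_series f g : bergman f -> bergman g ->
  ccvg (fun N => \sum_(n < N) (wt n)%:C * (coefs f n * (coefs g n)^*%R)) (inner f g).
Proof.
move=> Hf Hg; have f2 := bergman_L2 Hf; have g2 := bergman_L2 Hg.
have ii : 'i%C * 'i%C = -1 :> C by rewrite -expr2 sqr_i.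
have iJ : ('i%C : C)^*%R = - 'i%C by apply/eqP; rewrite eq_complex/= oppr0 !eqxx.
have Hig := bergmanZ 'i%C Hg; have ig2 := bergman_L2 Hig.
have n1 := ccvgZ (-1) (inner_self_series Hf).
have n2 := ccvgZ (-1) (inner_self_series Hg).
have n3 := inner_self_series (bergmanD Hf Hg).
have n4 := inner_self_series (bergmanD Hf Hig).
have := ccvgZ (2^-1) (ccvgD (ccvgD n3 (ccvgD n1 n2)) (ccvgZ 'i%C (ccvgD n4 (ccvgD n1 n2)))).
have two0 : (2 : C) != 0 by rewrite pnatr_eq0.
congr ccvg; last first.
  rewrite !innerDl ?innerDr ?innerZl ?innerZr//; try exact: L2D.
  rewrite iJ; set A := inner f f; set B := inner g g; set X := inner f g; set Y := inner g f.
  have -> : 'i%C * (A + - 'i%C * X + ('i%C * Y + 'i%C * (- 'i%C * B)) + (-1 * A + -1 * B)) =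
    'i%C * 'i%C * (Y - X) - 'i%C * ('i%C * 'i%C * B + B) :> C by ring.
  rewrite ii; apply: (mulfI two0); rewrite !mulrA divff//; ring.
apply/funext => N; rewrite !mulr_sumr -!big_split/= mulr_sumr -big_split/= mulr_sumr.
apply: eq_bigr => n _; rewrite !coefsD ?coefsZ//.
rewrite !conjcD conjcM iJ; set A := coefs f n; set B := coefs g n; set w := (wt n)%:C.
have -> : 2^-1 * (w * ((A + B) * (A^*%R + B^*%R)) + (-1 * (w * (A * A^*%R)) + -1 * (w * (B * B^*%R))) +
    'i%C * (w * ((A + 'i%C * B) * (A^*%R + - 'i%C * B^*%R)) +
      (-1 * (w * (A * A^*%R)) + -1 * (w * (B * B^*%R))))) =
  2^-1 * w * (A * B^*%R + B * A^*%R + 'i%C * 'i%C * (B * A^*%R - A * B^*%R)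
    - 'i%C * ('i%C * 'i%C * (B * B^*%R) + B * B^*%R)) by ring.
by rewrite ii; apply: (mulfI two0); rewrite !mulrA divff//; ring.
Qed.

Lemma nrm2_eq0 f : bergman f -> nrm2 f = 0 -> f = 0.
Proof.
move=> Hf f0; apply: (bergman_ext Hf bergman0); rewrite coefs0; apply/funext => n.
have h := nrm2_series Hf; rewrite f0 in h.
have Snd : nondecreasing_seq (fun N => \sum_(n < N) wt n * cabs (coefs f n) ^+ 2).
  apply/nondecreasing_seqP => k; rewrite big_ord_recr/= lerDl.
  by rewrite mulr_ge0 ?sqr_ge0 ?(ltW (wt_gt0 _)).
have := nondecreasing_cvgn_le Snd (cvgP _ h) n.+1; rewrite (cvg_lim _ h)//.
rewrite big_ord_recr/= => le0.
have : wt n * cabs (coefs f n) ^+ 2 <= 0.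
  apply: le_trans le0; rewrite lerDr; apply: sumr_ge0 => k _.
  by rewrite mulr_ge0 ?sqr_ge0 ?(ltW (wt_gt0 _)).
rewrite pmulr_rle0 ?wt_gt0// => e.
by apply/eqP; rewrite -cabs_eq0 -sqrf_eq0 eq_le e sqr_ge0.
Qed.

Lemma inner_inj f g : bergman f -> bergman g ->
  (forall k, bergman k -> inner f k = inner g k) -> f = g.
Proof.
move=> Hf Hg e.
have Hd := bergmanD Hf (bergmanZ (-1) Hg).
have : (fun z => f z + -1 * g z) = 0 :> (C -> C^o).
  apply: nrm2_eq0 => //; apply: complexI; rewrite -inner_self.
  rewrite innerDl ?innerZl ?e//; try exact: bergman_L2; last first.
    exact: bergman_L2 (bergmanZ _ _).
  by rewrite mulN1r subrr.
move=> /(congr1 (fun u : C -> C => fun z => u z + g z)) h; apply/funext => z.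
by have := congr1 (fun u : C -> C => u z) h; rewrite mulN1r subrK => ->; rewrite [LHS]add0r.
Qed.

(** Two candidates for the projection have the same inner products with the whole Bergman space,
    hence agree; the chosen one is therefore [h]. *)
Lemma bergman_projE (u : C -> C^o) h : L2 u -> bergman h ->
  (forall k, bergman k -> inner u k = inner h k) -> bergman_proj u = h.
Proof.
move=> u2 Hh e.
have projP h' : bergman h' -> (forall k, bergman k -> inner (u - h') k = 0) <->
    (forall k, bergman k -> inner u k = inner h' k).
  move=> Hh'; suff E k : bergman k -> inner (u - h') k = inner u k - inner h' k.
    by split=> E' k Hk; [apply/eqP; rewrite -subr_eq0 -E// E'|rewrite E// E'// subrr].
  move=> Hk; have h'2 := bergman_L2 Hh'; have k2 := bergman_L2 Hk.
  rewrite -(mulN1r (inner h' k)) -innerZl// -innerDl//; last exact: L2Z.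
  by apply: eq_inner => z _; rewrite mulN1r.
rewrite /bergman_proj; apply: xget_unique; first by split=> //; exact/projP.
move=> h' [Hh' /(projP _ Hh') e']; apply: inner_inj => // k Hk.
by rewrite -e ?e'.
Qed.

End BergmanCoefficients.

(** * Toeplitz operators with symbol gamma conj(z)^m + alpha z^m + beta *)

Section ToeplitzOperator.
Context {R : realType}.
Local Notation C := (R[i]).
Implicit Types (f g h k : C -> C^o) (z w c : C) (a b : nat -> C) (L : C * C * C).
Variable m : nat.

Definition wratio n : R := wt (n + m) / wt n.

(** The adjoint of the shift by [m]: if [a] are the coefficients of [f], these are the coefficients
    of the projection of [f] times the [m]-th power of conj [z]. *)
Definition bshift a n : C := (wratio n)%:C * a (n + m)%N.

Lemma wratio_ge0 n : 0 <= wratio n.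
Proof. by rewrite divr_ge0// ltW// wt_gt0. Qed.

Lemma wratio_le1 n : wratio n <= 1.
Proof.
by rewrite ler_pdivrMr ?wt_gt0// mul1r /wt ler_pM2l ?invr_gt0 ?pi_gt0// mom_le.
Qed.

Lemma wratioK n : wratio n * wt n = wt (n + m).
Proof. by rewrite divfK// gt_eqF// wt_gt0. Qed.

Lemma wratio_near1 (e : R) : 0 < e -> exists N, forall n, (N <= n)%N -> 1 - wratio n <= e.
Proof.
move=> e0; have [N hN] := mom_ratio m e0; exists N => n /hN h.
have p0 := @pi_gt0 R; have m0 := mom_gt0 n.
rewrite lerBlDr -lerBlDl ler_pdivlMr ?wt_gt0// /wt mulrCA ler_pM2l ?invr_gt0//.
Qed.

Lemma bshift_pexp f : bergman f -> pexp (of_coefs (bshift (coefs f))) 0 1 (bshift (coefs f)).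
Proof.
move=> Hf; apply: of_coefs_pexp => s /andP[s0 s1].
have [K aK] : exists K, forall n, cabs (coefs f n) * s ^+ n <= K.
  by apply: (pexp_bound (coefsP Hf)); rewrite (ltW s0) s1.
exists (K / s ^+ m) => n; rewrite ler_pdivlMr ?exprn_gt0// -mulrA -exprD.
rewrite cabsM cabs_real ger0_norm ?wratio_ge0// -mulrA.
apply: le_trans (aK (n + m)%N); rewrite ler_piMl ?wratio_le1//.
by rewrite mulr_ge0 ?cabs_ge0// exprn_ge0// ltW.
Qed.

(** [|c_n a_(n+m)|^2 mu_n = c_n |a_(n+m)|^2 mu_(n+m)] with [c_n <= 1], so the sums are bounded by
    those of [f]. *)
Lemma bshift_bergman f : bergman f -> bergman (of_coefs (bshift (coefs f))).
Proof.
move=> Hf; apply: (of_coefs_bergman (bshift_pexp Hf)) => N.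
have /bergmanP[_ fo _] := Hf.
have fE : sqint f = (fine (sqint f))%:E by rewrite fineK// ge0_fin_numE ?sqint_ge0.
have : \sum_(n < m + N) cabs (coefs f n) ^+ 2 * mom n <= fine (sqint f).
  by rewrite -lee_fin -fE; exact: sqint_lower (coefsP Hf).
apply: le_trans; rewrite big_split_ord/= -[leLHS]add0r lerD//.
  by apply: sumr_ge0 => n _; rewrite mulr_ge0 ?sqr_ge0 ?mom_ge0.
apply: ler_sum => n _; rewrite cabsM exprMn cabs_real ger0_norm ?wratio_ge0// addnC.
rewrite mulrAC mulrC ler_wpM2l ?sqr_ge0//.
have e : mom (n + m) = wratio n * mom n.
  have m0 : mom n != 0 :> R by rewrite gt_eqF ?mom_gt0.
  have p0 : pi != 0 :> R by rewrite gt_eqF ?pi_gt0.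
  rewrite /wratio /wt; move: (pi : R) p0 => p p0; field; by rewrite ?m0 ?p0.
by rewrite ?[(m + n)%N]addnC e expr2 -mulrA ler_piMl ?wratio_le1// mulr_ge0 ?wratio_ge0 ?mom_ge0.
Qed.

(** Conjugation moves the factor to [k] as [z ^+ m], which shifts its coefficients; the two
    coefficient series agree because [wt (n + m) = wratio n * wt n]. *)
Lemma inner_bshift f k : bergman f -> bergman k ->
  inner (fun z => z^*%R ^+ m * f z) k = inner (of_coefs (bshift (coefs f))) k.
Proof.
move=> Hf Hk.
have -> : inner (fun z => z^*%R ^+ m * f z) k = inner f (fun z => z ^+ m * k z).
  by apply: eq_inner => z _; rewrite conjcM conjcX mulrCA mulrA.
have h1 := ccvg_addn m (inner_series Hf (bergmanX m Hk)).
apply: (ccvg_unique h1).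
have := inner_series (bshift_bergman Hf) Hk; congr ccvg; apply/funext => N.
rewrite coefsX// (coefsE (bshift_pexp Hf)) [in RHS]addnC big_split_ord/=.
rewrite [X in _ = X + _]big1 ?add0r; last first.
  by move=> i _; rewrite ltn_ord conjC0 !mulr0.
apply: eq_bigr => i _; rewrite ltnNge leq_addr/= addKn [(m + i)%N]addnC /bshift.
by rewrite -wratioK (rmorphM (real_complex R) (wratio i) (wt i))/=; ring.
Qed.

Definition explicit_toeplitz L f : C -> C^o :=
  let: (al, be, ga) := L in
  fun z => ga * of_coefs (bshift (coefs f)) z + al * (z ^+ m * f z) + be * f z.

Lemma explicit_bergman L f : bergman f -> bergman (explicit_toeplitz L f).
Proof.
case: L => -[al be] ga Hf; apply: bergmanD; last exact: bergmanZ.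
by apply: bergmanD; apply: bergmanZ; [exact: bshift_bergman|exact: bergmanX].
Qed.

Lemma coefs_explicit al be ga f n : bergman f ->
  coefs (explicit_toeplitz (al, be, ga) f) n =
  ga * bshift (coefs f) n + al * (if (n < m)%N then 0 else coefs f (n - m)%N) + be * coefs f n.
Proof.
move=> Hf; have H1 := bshift_bergman Hf; have H2 := bergmanX m Hf.
rewrite /explicit_toeplitz coefsD; [|by apply: bergmanD; exact: bergmanZ|exact: bergmanZ].
rewrite coefsD; [|exact: bergmanZ|exact: bergmanZ].
by rewrite !coefsZ// coefsX// (coefsE (bshift_pexp Hf)).
Qed.

Lemma conj_Xn_L2 f : bergman f -> L2 (fun z => z^*%R ^+ m * f z).
Proof.
move=> Hf; apply: (@L2M _ (fun z => z^*%R ^+ m) f 1 _ _ (bergman_L2 Hf)).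
  exact/cmeasX/cmeasJ/cmeas_id.
by move=> z z1; rewrite -conjcX cabsJ cabsX_le1.
Qed.

Lemma symbol_L2 L f : bergman f -> L2 (fun z => symbol m L z * f z).
Proof.
case: L => -[al be] ga Hf.
apply: (@eq_L2 _ (fun z => ga * (z^*%R ^+ m * f z) + al * (z ^+ m * f z) + be * f z)).
  by move=> z _; rewrite /symbol; ring.
apply: L2D; last exact/L2Z/bergman_L2.
by apply: L2D; apply: L2Z; [exact: conj_Xn_L2|exact/bergman_L2/bergmanX].
Qed.

Lemma inner_symbol L f k : bergman f -> bergman k ->
  inner (fun z => symbol m L z * f z) k = inner (explicit_toeplitz L f) k.
Proof.
case: L => -[al be] ga Hf Hk.
have k2 := bergman_L2 Hk; have f2 := bergman_L2 Hf; have x2 := bergman_L2 (bergmanX m Hf).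
have b2 := bergman_L2 (bshift_bergman Hf); have j2 := conj_Xn_L2 Hf.
transitivity (inner (fun z => ga * (z^*%R ^+ m * f z) + al * (z ^+ m * f z) + be * f z) k).
  by apply: eq_inner => z _; rewrite /symbol; ring.
have gj2 := L2Z ga j2; have gb2 := L2Z ga b2; have ax2 := L2Z al x2; have bf2 := L2Z be f2.
rewrite (innerDl (L2D gj2 ax2) bf2 k2) (innerDl gj2 ax2 k2) (innerZl ga j2 k2) inner_bshift//.
by rewrite /explicit_toeplitz (innerDl (L2D gb2 ax2) bf2 k2) (innerDl gb2 ax2 k2) (innerZl ga b2 k2).
Qed.

Lemma toeplitzE L f : bergman f -> toeplitz (symbol m L) f = explicit_toeplitz L f.
Proof.
move=> Hf; apply: bergman_projE; first exact: symbol_L2.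
  exact: explicit_bergman.
by move=> k; exact: inner_symbol.
Qed.

(** The pencil projects its terms separately, yet coincides with the Toeplitz operator on the
    Bergman space; this carries Fredholmness of the pencil over. *)
Lemma pencilE L f : bergman f -> pencil m L f = explicit_toeplitz L f.
Proof.
case: L => -[al be] ga Hf; rewrite /pencil /explicit_toeplitz.
rewrite (_ : toeplitz _ f = of_coefs (bshift (coefs f))); last first.
  apply: bergman_projE; [exact: conj_Xn_L2|exact: bshift_bergman|].
  by move=> k; exact: inner_bshift.
rewrite (_ : toeplitz _ f = fun z => z ^+ m * f z)//.
by apply: bergman_projE => //; [exact/bergman_L2/bergmanX|exact: bergmanX].
Qed.

Definition adj_param L : C * C * C := let: (al, be, ga) := L in (ga^*%R, be^*%R, al^*%R).

Lemma inner_adj L f k : bergman f -> bergman k ->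
  inner (explicit_toeplitz L f) k = inner f (explicit_toeplitz (adj_param L) k).
Proof.
move=> Hf Hk; rewrite -inner_symbol// [RHS]innerJ; last 2 first.
- exact/bergman_L2/explicit_bergman.
- exact: bergman_L2.
rewrite -inner_symbol// -innerJ; last 2 first.
- exact: symbol_L2.
- exact: bergman_L2.
apply: eq_inner => z _; case: L => -[al be] ga; rewrite /adj_param /symbol.
rewrite !conjcM !conjcD !conjcM !conjcX !conjCK; ring.
Qed.

Lemma adjointE L T f : (forall g, bergman g -> T g = explicit_toeplitz L g) -> bergman f ->
  adjoint bergman inner T f = explicit_toeplitz (adj_param L) f.
Proof.
move=> TE Hf; rewrite /adjoint; apply: xget_unique.
  by split=> [|k Hk]; [exact: explicit_bergman|rewrite TE// inner_adj].
move=> g [Hg e]; have He := explicit_bergman (adj_param L) Hf.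
apply: inner_inj => // k Hk.
rewrite innerJ; [|exact: bergman_L2..]; rewrite -e// TE// inner_adj// -innerJ//; exact: bergman_L2.
Qed.

End ToeplitzOperator.

(** * Dimensions and three-term recurrences *)

Section DimensionUniqueness.
Context {K : fieldType} {E : lmodType K}.
Implicit Type V : set E.

(** An independent family written in a spanning one has a coefficient matrix of full row rank, at
    most the number of its columns. *)
Lemma has_dim_leq V n n' : has_dim V n -> has_dim V n' -> (n <= n')%N.
Proof.
move=> [b [bV bfree _]] [b' [_ _ b'span]].
have [c bc] := choice (fun i => b'span (b i) (bV i)).
pose M : 'M[K]_(n, n') := \matrix_(i, j) c i j.
suff /eqP <- : row_free M by exact: rank_leq_col.
apply: inj_row_free => v vM0; apply/rowP => i; rewrite mxE.
apply: (bfree (fun i => v 0 i)).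
under eq_bigr do rewrite bc scaler_sumr.
rewrite exchange_big big1//= => j _.
have : (v *m M) 0 j = 0 by rewrite vM0 mxE.
rewrite mxE => e.
rewrite (eq_bigr (fun i => (v 0 i * M i j) *: b' j)); last first.
  by move=> k _; rewrite mxE scalerA.
by rewrite -scaler_suml e scale0r.
Qed.

Lemma dimE V n : has_dim V n -> Defs.dim V = n.
Proof.
move=> Vn; apply: xget_unique => // k Vk.
by apply/eqP; rewrite eqn_leq !(@has_dim_leq V).
Qed.

Lemma has_dim0 V : (forall v, V v -> v = 0) -> has_dim V 0.
Proof.
move=> V0; exists (fun=> 0); split=> [[]//|c _ []//|v /V0 ->].
by exists (fun=> 0); rewrite big_ord0.
Qed.

End DimensionUniqueness.

(** * Three-term recurrences of stride [m] with asymptotically constant coefficients *)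

Section Recurrences.
Context {R : realType}.
Local Notation C := (R[i]).
Variable m : nat.
Hypothesis m_gt0 : (0 < m)%N.
Implicit Types (a : nat -> C) (c : nat -> R).

(** Continuity of the power at 1; it converts rates per stride into rates per index. *)
Lemma stride_radius (x : R) : x < 1 -> exists2 s : R, 0 < s < 1 & x < s ^+ m.
Proof.
move=> x1.
have : (fun s : R => s ^+ m) s @[s --> (1 : R)^'-] --> (1 : R) ^+ m.
  by apply: cvg_at_left_filter; exact: exprn_continuous.
rewrite expr1n => /cvgr_gt /(_ _ x1) h.
near (1 : R)^'- => s; exists s; last by near: s.
by apply/andP; split; near: s; [exact: nbhs_left_gt|exact: nbhs_left_lt].
Unshelve. all: by end_near. Qed.

Lemma geometric_eq0 (x V t : R) : 0 <= t < 1 -> 0 <= x -> (forall k, x <= V * t ^+ k) -> x = 0.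
Proof.
move=> /andP[t0 t1] x0 xV; apply/eqP; rewrite eq_le x0 andbT.
have h : (fun k => V * t ^+ k) @ \oo --> (0 : R).
  by rewrite -[X in _ --> X](mulr0 V); apply: cvgMr; apply: cvg_expr; rewrite ger0_norm.
by apply: (cvgr_to_ge h); exact: nearW.
Qed.

(* With [u j = a j - t2 a (j + m)] the recurrence factors through two first order
   relations that contract from [j + m] to [j]; in the weighted sup norm with
   weights [s ^+ j] the tail of a is mapped into itself with a factor < 1. *)
Lemma recurrence_zero a c (t1 t2 : C) : cabs t1 < 1 -> cabs t2 < 1 ->
  (forall n, 0 <= c n <= 1) ->
  (forall e : R, 0 < e -> exists N, forall n, (N <= n)%N -> 1 - c n <= e) ->
  (forall s : R, 0 < s < 1 -> exists K, forall n, cabs (a n) * s ^+ n <= K) ->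
  (forall j, a j - (t1 + t2) * a (j + m)%N + t1 * t2 * (c (j + m)%N)%:C * a (j + m + m)%N = 0) ->
  forall n, a n = 0.
Proof.
move=> t11 t21 c01 cN aK rec.
have [s s01 smax] : exists2 s : R, 0 < s < 1 & Num.max (cabs t1) (cabs t2) < s ^+ m.
  by apply: stride_radius; rewrite gt_max t11.
move: smax; rewrite gt_max => /andP[s1 s2].
have /andP[s0 _] := s01; have sm : 0 < s ^+ m by rewrite exprn_gt0.
pose p1 := cabs t1 / s ^+ m; pose p2 := cabs t2 / s ^+ m.
have p10 : 0 <= p1 by rewrite divr_ge0 ?cabs_ge0// ltW.
have p20 : 0 <= p2 by rewrite divr_ge0 ?cabs_ge0// ltW.
have p11 : p1 < 1 by rewrite ltr_pdivrMr// mul1r.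
have p21 : p2 < 1 by rewrite ltr_pdivrMr// mul1r.
(* Since [p2 + d < 1], [y] may be as large as [d] times the bound on [x]. Below, [e] keeps the
   perturbation [1 - c] within half of the room left by [p1], the powers of [s] compensating the
   change of weight over two strides. *)
pose d := (1 - p2) / 2.
have d0 : 0 < d by rewrite /d; lra.
pose e := d * (1 - p1) / 2 * (s ^+ m * s ^+ m).
have e0 : 0 < e by rewrite !mulr_gt0//; lra.
have [N hN] := cN e e0.
have [K0 K0P] := aK s s01.
pose u j := a j - t2 * a (j + m)%N.
pose x j := cabs (a j) * s ^+ j; pose y j := cabs (u j) * s ^+ j.
have x0 j : 0 <= x j by rewrite mulr_ge0 ?cabs_ge0 ?exprn_ge0 ?ltW.
have y0 j : 0 <= y j by rewrite mulr_ge0 ?cabs_ge0 ?exprn_ge0 ?ltW.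
have sn0 : s ^+ m != 0 by rewrite gt_eqF.
have xle j : x j <= p2 * x (j + m)%N + y j.
  have -> : p2 * x (j + m)%N + y j = (cabs t2 * cabs (a (j + m)%N) + cabs (u j)) * s ^+ j.
    by rewrite /x /y /p2 exprD; field.
  rewrite /x ler_wpM2r ?exprn_ge0 ?(ltW s0)// -cabsM.
  by rewrite -{1}[a j](subrK (t2 * a (j + m)%N)) addrC cabs_triangle.
have yle j : (N <= j)%N -> y j <= p1 * y (j + m)%N + d * (1 - p1) / 2 * x (j + m + m)%N.
  move=> Nj.
  have uE : u j = t1 * u (j + m)%N + t1 * t2 * (1 - c (j + m)%N)%:C * a (j + m + m)%N.
    apply/eqP; rewrite -subr_eq0 -(rec j) /u rmorphB rmorph1; apply/eqP; ring.
  have -> : p1 * y (j + m)%N + d * (1 - p1) / 2 * x (j + m + m)%N =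
      (cabs t1 * cabs (u (j + m)%N) + e * cabs (a (j + m + m)%N)) * s ^+ j.
    by rewrite /e /x /y /p1 !exprD; field.
  rewrite /y ler_wpM2r ?exprn_ge0 ?(ltW s0)// uE (le_trans (cabs_triangle _ _))// !cabsM lerD//.
  rewrite ler_wpM2r ?cabs_ge0//.
  have /andP[c0 c1] := c01 (j + m)%N; rewrite cabs_real ger0_norm ?subr_ge0//.
  have := hN (j + m)%N (leq_trans Nj (leq_addr _ _)) => ce.
  rewrite -[leRHS]mul1r ler_pM ?subr_ge0 ?mulr_ge0 ?cabs_ge0//.
  by rewrite mulr_ile1 ?cabs_ge0 ?(ltW t11) ?(ltW t21).
pose th := Num.max (p2 + d) ((1 + p1) / 2).
have th01 : 0 <= th < 1.
  by rewrite le_max gt_max; apply/andP; split; [apply/orP; left; lra|apply/andP; split; rewrite /d; lra].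
have th1 : p2 + d <= th by rewrite le_max lexx.
have th2 : (1 + p1) / 2 <= th by rewrite le_max lexx orbT.
have th0 : 0 <= th by case/andP: th01.
(* Large enough for [x j <= V] and [y j <= d * V], the base case of the iteration. *)
pose V := K0 + (K0 + cabs t2 * K0 / s ^+ m) / d.
have K00 : 0 <= K0 by apply: le_trans (x0 0%N) (K0P 0%N).
have V1 : K0 <= V by rewrite /V lerDl divr_ge0 ?(ltW d0)// addr_ge0// !mulr_ge0 ?cabs_ge0 ?invr_ge0 ?(ltW sm).
have iter k j : (N <= j)%N -> x j <= V * th ^+ k /\ y j <= d * V * th ^+ k.
  elim: k j => [|k IH] j Nj.
    rewrite expr0 !mulr1; split; first exact: le_trans (K0P j) V1.
    apply: (@le_trans _ _ (K0 + cabs t2 * K0 / s ^+ m)).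
      rewrite /y (le_trans (ler_wpM2r _ (cabs_triangleB _ _))) ?exprn_ge0 ?(ltW s0)//.
      rewrite mulrDl lerD ?K0P// cabsM -!mulrA ler_wpM2l ?cabs_ge0//.
      by rewrite ler_pdivlMr// -mulrA -exprD K0P.
    rewrite /V mulrDr [d * (_ / d)]mulrC divfK ?gt_eqF// lerDr.
    by rewrite mulr_ge0 ?(ltW d0).
  have [X1 Y1] := IH (j + m)%N (leq_trans Nj (leq_addr _ _)).
  have [X0 Y0] := IH j Nj.
  have [X2 _] := IH (j + m + m)%N (leq_trans Nj (leq_trans (leq_addr _ _) (leq_addr _ _))).
  have W0 : 0 <= V * th ^+ k by apply: le_trans X0.
  rewrite exprS; split.
    apply: le_trans (xle j) _; apply: (@le_trans _ _ ((p2 + d) * (V * th ^+ k))).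
      rewrite mulrDl lerD ?ler_wpM2l// mulrA//.
    by apply: le_trans (ler_wpM2r W0 th1) _; rewrite mulrCA.
  apply: le_trans (yle j Nj) _; apply: (@le_trans _ _ (d * ((1 + p1) / 2) * (V * th ^+ k))).
    have h1 := ler_wpM2l p10 Y1.
    have d1 : 0 <= d * (1 - p1) / 2 by rewrite mulr_ge0 ?invr_ge0// mulr_ge0 ?(ltW d0)// subr_ge0 ltW.
    have h2 := ler_wpM2l d1 X2.
    by apply: le_trans (lerD h1 h2) _; rewrite le_eqVlt; apply/orP; left; apply/eqP; field.
  rewrite -mulrA; apply: le_trans (ler_wpM2l (ltW d0) (ler_wpM2r W0 th2)) _.
  by rewrite le_eqVlt; apply/orP; left; apply/eqP; ring.
have tail n : (N <= n)%N -> a n = 0.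
  move=> Nn; apply/eqP; rewrite -cabs_eq0.
  have /eqP : x n = 0 by apply: (geometric_eq0 th01 (x0 n)) => k; exact: (iter k n Nn).1.
  by rewrite mulf_eq0 expf_eq0 (gt_eqF s0) andbF orbF.
(* Below [N] the recurrence expresses [a n] through two later terms; [d'] bounds the distance to
   [N]. *)
suff back d' n : (N <= n + d')%N -> a n = 0.
  by move=> n; apply: (back N); exact: leq_addl.
elim/ltn_ind: d' n => d' IH n Nn.
have [Nn'|nN] := leqP N n; first exact: tail.
have d'0 : (0 < d')%N by rewrite lt0n; apply/eqP => d'0; move: Nn; rewrite d'0 addn0 leqNgt nN.
have s1d : (d'.-1 < d')%N by rewrite prednK.
have n1 : (N <= n + m + d'.-1)%N.
  by rewrite -addnA (leq_trans Nn)// leq_add2l -{1}(prednK d'0) -add1n leq_add2r.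
have n2 : (N <= n + m + m + d'.-1)%N by rewrite (leq_trans n1)// leq_add2r leq_addr.
have := rec n; rewrite (IH _ s1d _ n1) (IH _ s1d _ n2) !mulr0 subr0 addr0; exact.
Qed.

(* Forward counterpart: [w n = a n - s2 * a (n - m)] satisfies
   [w (n + m) = s1 * w n + (1 - c n) * a (n + m)], and |w n| + d |a n| is eventually
   contracted by each stride of length m. *)
Lemma recurrence_decay (a b : nat -> C) c (s1 s2 : C) : cabs s1 < 1 -> cabs s2 < 1 ->
  (forall n, 0 <= c n <= 1) ->
  (forall e : R, 0 < e -> exists N, forall n, (N <= n)%N -> 1 - c n <= e) ->
  (forall n, b (n + m)%N = a n) ->
  (forall n, (c n)%:C * a (n + m)%N - (s1 + s2) * a n + s1 * s2 * b n = 0) ->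
  exists K q : R, 0 <= q < 1 /\ forall n, cabs (a n) <= K * q ^+ n.
Proof.
move=> s11 s21 c01 cN bE rec.
pose sg := Num.max (cabs s1) (cabs s2).
have sg1 : sg < 1 by rewrite gt_max s11.
have sg0 : 0 <= sg by rewrite le_max cabs_ge0.
have ls1 : cabs s1 <= sg by rewrite le_max lexx.
have ls2 : cabs s2 <= sg by rewrite le_max lexx orbT.
(* [rho] lies midway between [sg] and 1, and [e <= d * (1 - sg) / 2], so the contraction of the term
   [d * |a n|] pays for the perturbation of [w]. *)
pose d := (1 - sg) / 4; pose e := (1 - sg) ^+ 2 / 32; pose rho := (1 + sg) / 2.
have d0 : 0 < d by rewrite /d; lra.
have e0 : 0 < e by rewrite /e divr_gt0// exprn_gt0// subr_gt0.
have [N hN] := cN e e0.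
pose w n := a n - s2 * b n.
pose V n := cabs (w n) + d * cabs (a n).
have V0 n : 0 <= V n by apply: addr_ge0; rewrite ?cabs_ge0// mulr_ge0 ?cabs_ge0// ltW.
have step n : (N <= n)%N -> V (n + m)%N <= rho * V n.
  move=> Nn.
  have wE : w (n + m)%N = s1 * w n + (1 - c n)%:C * a (n + m)%N.
    by apply/eqP; rewrite -subr_eq0 -(rec n) /w bE rmorphB rmorph1; apply/eqP; ring.
  have aE : a (n + m)%N = s2 * a n + w (n + m)%N by rewrite /w bE; ring.
  have := cabs_triangle (s1 * w n) ((1 - c n)%:C * a (n + m)%N).
  rewrite -wE !cabsM cabs_real ger0_norm; last by rewrite subr_ge0; case/andP: (c01 n).
  have := cabs_triangle (s2 * a n) (w (n + m)%N); rewrite -aE cabsM.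
  rewrite /V; have := hN n Nn; have /andP[_ cn1] := c01 n.
  have := cabs_ge0 (w n); have := cabs_ge0 (a n); have := cabs_ge0 (w (n + m)%N).
  have := cabs_ge0 (a (n + m)%N).
  set A' := cabs (a (n + m)%N); set W' := cabs (w (n + m)%N); set A := cabs (a n); set W := cabs (w n).
  move=> A'0 W'0 A0 W0 ce tA tW.
  have hA : A' <= sg * A + W' by apply: le_trans tA _; rewrite lerD2r ler_wpM2r.
  have hW : W' <= sg * W + e * A'.
    by apply: le_trans tW _; rewrite lerD ?ler_wpM2r.
  have [h1 h2 e1] : [/\ (1 + d) * (1 + 2 * e) * sg <= rho, e + d * sg <= rho * d & e <= 1 / 2].
    rewrite /d /e /rho; clear -sg0 sg1; move: sg sg0 sg1 => x x0 x1.
    have y0 : 0 <= (1 - x) ^+ 2 by rewrite sqr_ge0.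
    have y1 : (1 - x) ^+ 2 <= 1 - x by rewrite expr2 ler_piMl; lra.
    split; last by lra.
      have z0 : 0 <= (1 - x) ^+ 2 / 16 <= 1 / 16 by apply/andP; split; lra.
      apply: (@le_trans _ _ ((1 - 3 / 4 * (1 - x)) * (1 + (1 - x) ^+ 2 / 16))); last by nra.
      have -> : (1 + (1 - x) / 4) * (1 + 2 * ((1 - x) ^+ 2 / 32)) * x =
        ((1 + (1 - x) / 4) * x) * (1 + (1 - x) ^+ 2 / 16) by field.
      rewrite ler_wpM2r//; first by lra.
      by nra.
    by nra.
  have rho0 : 0 <= rho by rewrite /rho; lra.
  have rho1 : rho <= 1 by rewrite /rho; lra.
  (* [A'] is eliminated between [hA] and [hW]; [1 / (1 - e) <= 1 + 2 * e] because [e <= 1 / 2]. *)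
  have W'le : W' <= (1 + 2 * e) * (sg * W + e * (sg * A)).
    have h : W' * (1 - e) <= sg * W + e * (sg * A).
      by have := ler_wpM2l (ltW e0) hA; rewrite mulrDr; lra.
    have e2 : 0 <= 1 + 2 * e by lra.
    apply: le_trans (ler_wpM2l e2 h); rewrite mulrCA -[leLHS]mulr1 ler_wpM2l//.
    by clear -e0 e1; nra.
  apply: (@le_trans _ _ ((1 + d) * W' + d * (sg * A))).
    by have := ler_wpM2l (ltW d0) hA; lra.
  have d1 : 0 <= 1 + d by lra.
  have := ler_wpM2l d1 W'le.
  have -> : (1 + d) * ((1 + 2 * e) * (sg * W + e * (sg * A))) =
    (1 + d) * (1 + 2 * e) * sg * W + (1 + d) * (1 + 2 * e) * sg * (e * A) by ring.
  have g1 := ler_wpM2r W0 h1.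
  have eA : 0 <= e * A by rewrite mulr_ge0 ?(ltW e0).
  have g2 := ler_wpM2r eA (le_trans h1 rho1).
  have g3 := ler_wpM2r A0 h2.
  move: g1 g2 g3; rewrite mul1r mulrDl !mulrDr; lra.
have [q q01 rq] : exists2 q : R, 0 < q < 1 & rho < q ^+ m.
  by apply: stride_radius; rewrite /rho; lra.
have /andP[q0 q1] := q01.
(* The sum dominates each of the first [N + m] ratios; from there on [n - m >= N], where the
   contraction holds. *)
pose K := \sum_(n < N + m) V n / q ^+ n.
have K0 : 0 <= K by apply: sumr_ge0 => n _; rewrite divr_ge0 ?exprn_ge0// ltW.
have VK n : V n <= K * q ^+ n.
  elim/ltn_ind: n => n IH; have [nN|Nn] := ltnP n (N + m).
    rewrite -ler_pdivrMr ?exprn_gt0// /K (bigD1 (Ordinal nN))//= lerDl.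
    by apply: sumr_ge0 => k _; rewrite divr_ge0 ?exprn_ge0// ltW.
  have mn : (m <= n)%N := leq_trans (leq_addl N m) Nn.
  have Nnm : (N <= n - m)%N by rewrite leq_subRL// addnC.
  have nm : (n - m < n)%N by rewrite ltn_subrL m_gt0 (leq_trans m_gt0 mn).
  have := step _ Nnm; rewrite subnK// => /le_trans; apply.
  have -> : K * q ^+ n = q ^+ m * (K * q ^+ (n - m)) by rewrite mulrCA -exprD subnKC.
  by apply: ler_pM; rewrite ?V0 ?(ltW rq) ?IH// /rho; lra.
exists (K / d), q; rewrite (ltW q0) q1; split=> // n.
rewrite mulrAC ler_pdivlMr// mulrC; apply: le_trans (VK n).
by rewrite /V lerDr cabs_ge0.
Qed.

End Recurrences.

(** * Kernels *)

Section Kernels.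
Context {R : realType}.
Local Notation C := (R[i]).
Implicit Types (f g h : C -> C^o) (z w : C) (a b : nat -> C) (L : C * C * C).
Variable m : nat.
Hypothesis m_gt0 : (0 < m)%N.

Lemma wratio_gt0 n : 0 < wratio m n :> R.
Proof. by rewrite divr_gt0 ?wt_gt0. Qed.

Lemma wratio01 n : 0 <= (wratio m n : R) <= 1.
Proof. by rewrite wratio_ge0 wratio_le1. Qed.

Lemma explicitD L f g : bergman f -> bergman g ->
  explicit_toeplitz m L (fun z => f z + g z) =
  (fun z => explicit_toeplitz m L f z + explicit_toeplitz m L g z).
Proof.
move=> Hf Hg; have Hfg := bergmanD Hf Hg.
apply: bergman_ext; [exact: explicit_bergman|apply: bergmanD; exact: explicit_bergman|].
rewrite [RHS]coefsD; [|exact: explicit_bergman..]; apply/funext => n.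
case: L => -[al be] ga; rewrite !coefs_explicit// coefsD// /bshift; case: ifP => _; ring.
Qed.

Lemma explicitZ L c f : bergman f ->
  explicit_toeplitz m L (fun z => c * f z) = (fun z => c * explicit_toeplitz m L f z).
Proof.
move=> Hf; have Hcf := bergmanZ c Hf.
apply: bergman_ext; [exact: explicit_bergman|apply: bergmanZ; exact: explicit_bergman|].
rewrite [RHS]coefsZ; last exact: explicit_bergman; apply/funext => n.
case: L => -[al be] ga; rewrite !coefs_explicit// coefsZ// /bshift; case: ifP => _; ring.
Qed.

Lemma bergman_sum (I : Type) (s : seq I) (c : I -> C) (F : I -> C -> C^o) :
  (forall i, bergman (F i)) -> bergman (\sum_(i <- s) c i *: F i) /\
  coefs (\sum_(i <- s) c i *: F i) = (fun n => \sum_(i <- s) c i * coefs (F i) n).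
Proof.
move=> HF; elim: s => [|i s [IH1 IH2]].
  by rewrite big_nil coefs0; split; [exact: bergman0|apply/funext => n; rewrite big_nil].
rewrite big_cons; split; first exact: bergmanD (bergmanZ _ (HF i)) IH1.
rewrite (coefsD (bergmanZ (c i) (HF i)) IH1) coefsZ// IH2.
by apply/funext => n; rewrite big_cons.
Qed.

Lemma explicit_sum_eq0 L (I : Type) (s : seq I) (c : I -> C) (F : I -> C -> C^o) :
  (forall i, bergman (F i)) -> (forall i, explicit_toeplitz m L (F i) = 0) ->
  explicit_toeplitz m L (\sum_(i <- s) c i *: F i) = 0.
Proof.
move=> HF F0; elim: s => [|i s IH].
  have := explicitZ L 0 bergman0; rewrite big_nil.
  rewrite (_ : (fun z => 0 * _) = 0); last by apply/funext => z; rewrite mul0r.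
  by move=> ->; apply/funext => z; rewrite mul0r.
rewrite big_cons; have Hs := (bergman_sum s c HF).1.
have := explicitD L (bergmanZ (c i) (HF i)) Hs; rewrite explicitZ// F0 IH => e.
transitivity (fun z : C => c i * (0 : C -> C^o) z + (0 : C -> C^o) z) => //.
by apply/funext => z; rewrite mulr0 addr0.
Qed.

Lemma explicit_coefs_eq0 al be ga f n : bergman f -> explicit_toeplitz m (al, be, ga) f = 0 ->
  ga * bshift m (coefs f) n + al * (if (n < m)%N then 0 else coefs f (n - m)%N) + be * coefs f n = 0.
Proof. by move=> Hf e; rewrite -coefs_explicit// e coefs0. Qed.

Lemma kernel_trivial (k t1 t2 : C) f : k != 0 -> cabs t1 < 1 -> cabs t2 < 1 -> bergman f ->
  explicit_toeplitz m (k, - (k * (t1 + t2)), k * (t1 * t2)) f = 0 -> f = 0.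
Proof.
move=> k0 t11 t21 Hf e; apply: (bergman_ext Hf bergman0); rewrite coefs0; apply/funext.
apply: (recurrence_zero m_gt0 t11 t21 wratio01 (@wratio_near1 R m)).
  by move=> s /andP[s0 s1]; apply: (pexp_bound (coefsP Hf)); rewrite (ltW s0) s1.
move=> j; have := explicit_coefs_eq0 (j + m)%N Hf e.
rewrite ltnNge leq_addl/= addnK /bshift => h.
apply: (mulfI k0); rewrite mulr0 -[RHS]h; ring.
Qed.

(** * Kernel basis when both zeros [1 / s1], [1 / s2] lie outside the closed disk, possibly at
    infinity *)

Section Solutions.
Variables (k s1 s2 : C).
Hypotheses (k0 : k != 0) (s11 : cabs s1 < 1) (s21 : cabs s2 < 1).

(** The recurrence couples only indices congruent modulo [m]. The pair holds two consecutive
    coefficients in the class of [r], the second at index [q * m + r]; the initial 0 stands for a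
    coefficient of negative index. *)
Fixpoint strand (r q : nat) : C * C :=
  if q is q'.+1 then
    let: (u, v) := strand r q' in
    (v, ((s1 + s2) * v - s1 * s2 * u) / (wratio m (q' * m + r))%:C)
  else (0, 1).

Definition sol r n : C := if (n %% m)%N == r then (strand r (n %/ m)).2 else 0.
(** The solution at [n - m], extended by 0 to [n < m], so that the recurrence holds at every
    index. *)
Definition sol_prev r n : C := if (n %% m)%N == r then (strand r (n %/ m)).1 else 0.

Lemma sol_prev_add r n : sol_prev r (n + m) = sol r n.
Proof.
rewrite /sol_prev /sol modnDr divnDr// divnn m_gt0 addn1.
by case: ifP => // _ /=; case: (strand _ _).
Qed.

Lemma sol_prevE r n : sol_prev r n = if (n < m)%N then 0 else sol r (n - m).
Proof.
case: ltnP => [nm|mn]; last by rewrite -{1}(subnK mn) sol_prev_add.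
by rewrite /sol_prev divn_small//=; case: ifP.
Qed.

Lemma sol_rec r n :
  (wratio m n)%:C * sol r (n + m) - (s1 + s2) * sol r n + s1 * s2 * sol_prev r n = 0.
Proof.
rewrite /sol_prev /sol modnDr divnDr// divnn m_gt0 addn1.
case: eqP => [nr /=|_]; last by rewrite !mulr0 subr0 addr0.
rewrite -nr -divn_eq; case: (strand _ _) => u v /=.
have w0 : (wratio m n)%:C != 0 :> C by rewrite (fmorph_eq0 (real_complex R)) gt_eqF// wratio_gt0.
by rewrite mulrCA divff// mulr1; ring.
Qed.

Lemma sol_init r n : (n < m)%N -> sol r n = (n == r)%:R.
Proof. by move=> nm; rewrite /sol modn_small// divn_small//=; case: eqP. Qed.

Lemma sol_bergman r : bergman (of_coefs (sol r)) /\ coefs (of_coefs (sol r)) = sol r.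
Proof.
have [K [q [/andP[q0 q1] aK]]] := recurrence_decay m_gt0 s11 s21 wratio01 (@wratio_near1 R m)
  (sol_prev_add r) (sol_rec r).
have K0 : 0 <= K by have := aK 0%N; rewrite expr0 mulr1; apply: le_trans; exact: cabs_ge0.
have fa : pexp (of_coefs (sol r)) 0 1 (sol r).
  apply: of_coefs_pexp => s /andP[s0 s1']; exists K => n.
  rewrite -[leRHS]mulr1 ler_pM ?cabs_ge0 ?exprn_ge0 ?(ltW s0)//; last first.
    by rewrite exprn_ile1 ?(ltW s0) ?(ltW s1').
  by apply: le_trans (aK n) _; rewrite -[leRHS]mulr1 ler_wpM2l// exprn_ile1// ltW.
split; last exact: coefsE.
apply: (@of_coefs_bergman _ _ (K ^+ 2 * mom 0 / (1 - q)) fa) => N.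
apply: (@le_trans _ _ (\sum_(n < N) K ^+ 2 * mom 0 * q ^+ n)); last first.
  rewrite -mulr_sumr ler_wpM2l ?mulr_ge0 ?sqr_ge0 ?mom_ge0//.
  have := @geometric_tail_le R q 0 N; rewrite q0 q1 expr0 big_mkord mul1r; exact.
apply: ler_sum => n _; rewrite [leRHS]mulrAC ler_pM ?sqr_ge0 ?mom_ge0//; last by have := @mom_le R 0 n; rewrite add0n.
apply: (@le_trans _ _ ((K * q ^+ n) ^+ 2)).
  by rewrite lerXn2r ?nnegrE ?cabs_ge0 ?mulr_ge0 ?exprn_ge0.
by rewrite exprMn ler_wpM2l ?sqr_ge0// expr2 ler_piMl ?exprn_ge0// exprn_ile1// ltW.
Qed.

Let L0 := (k * (s1 * s2), - (k * (s1 + s2)), k).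

Lemma sol_kernel r : explicit_toeplitz m L0 (of_coefs (sol r)) = 0.
Proof.
have [Hs cs] := sol_bergman r.
apply: (bergman_ext (explicit_bergman m L0 Hs) bergman0).
rewrite coefs0; apply/funext => n; rewrite coefs_explicit// cs -sol_prevE /bshift.
rewrite -[RHS](mulr0 k) -[in RHS](sol_rec r n); ring.
Qed.

(** [k] and the ratios [c_n] are nonzero, so the recurrence determines each [a_(n+m)] from earlier
    coefficients. *)
Lemma kernel_init f : bergman f -> explicit_toeplitz m L0 f = 0 ->
  (forall n, (n < m)%N -> coefs f n = 0) -> f = 0.
Proof.
move=> Hf e f0; apply: (bergman_ext Hf bergman0); rewrite coefs0; apply/funext.
elim/ltn_ind => n IH; have [/f0//|mn] := ltnP n m.
have nm : (n - m < n)%N by rewrite ltn_subrL m_gt0 (leq_trans m_gt0 mn).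
have := explicit_coefs_eq0 (n - m)%N Hf e; rewrite /bshift subnK// (IH _ nm) mulr0 addr0.
rewrite (_ : (if _ then _ else _) = 0) ?mulr0 ?addr0; last first.
  by case: ifP => // _; apply: IH; apply: leq_ltn_trans nm; exact: leq_subr.
move=> /eqP; rewrite !mulf_eq0 (negbTE k0)/= (fmorph_eq0 (real_complex R)) gt_eqF ?wratio_gt0//=.
by move=> /eqP.
Qed.

(** The solutions [sol i] are dual to the first [m] Taylor coefficients, which determine a kernel
    element. *)
Lemma kernel_has_dim : has_dim [set f | bergman f /\ explicit_toeplitz m L0 f = 0] m.
Proof.
have HF (i : 'I_m) := (sol_bergman i).1; have cF (i : 'I_m) := (sol_bergman i).2.
have csum (c : 'I_m -> C) j : coefs (\sum_i c i *: of_coefs (sol i)) j = \sum_(i < m) c i * sol i j.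
  by rewrite (bergman_sum _ _ HF).2; apply: eq_bigr => i _; rewrite cF.
have csum_init (c : 'I_m -> C) (j : 'I_m) : coefs (\sum_i c i *: of_coefs (sol i)) j = c j.
  rewrite csum (bigD1 j)//= sol_init// eqxx mulr1 big1 ?addr0// => i ij.
  by rewrite sol_init// val_eqE eq_sym (negbTE ij) mulr0.
exists (fun i : 'I_m => of_coefs (sol i)); split.
- by move=> i; split; [exact: HF|exact: sol_kernel].
- by move=> c c0 j; rewrite -csum_init c0 coefs0.
move=> f [Hf f0]; exists (fun i => coefs f i).
have [Hg cg] := bergman_sum (index_enum 'I_m) (fun i => coefs f i) HF.
set g := \sum_i _ in Hg cg *.
have g0 : explicit_toeplitz m L0 g = 0.
  by apply: explicit_sum_eq0 => // i; exact: sol_kernel.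
have Hng := bergmanZ (-1) Hg.
have d0 : (fun z => f z + -1 * g z) = 0 :> (C -> C^o).
  apply: kernel_init; first exact: bergmanD.
    rewrite explicitD// explicitZ// f0 g0; apply/funext => z.
    by rewrite mulr0 addr0.
  by move=> n nm; rewrite coefsD// coefsZ// (csum_init _ (Ordinal nm))/= mulN1r subrr.
apply/funext => z; have := congr1 (fun u : C -> C^o => u z) d0.
by rewrite mulN1r => /eqP; rewrite subr_eq0 => /eqP.
Qed.

End Solutions.
End Kernels.

(** * Inversion by Neumann series *)

Section Contraction.
Context {R : realType}.
Local Notation C := (R[i]).
Implicit Types (f g h : C -> C^o) (z w : C).

Lemma nrm2_le (K : R) (f g : C -> C) : 0 <= K -> L2 f -> L2 g ->
  (forall z, cabs z < 1 -> cabs (f z) ^+ 2 <= K * cabs (g z) ^+ 2) -> nrm2 f <= K * nrm2 g.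
Proof.
move=> K0 [mf fo] [mg go] fg; rewrite /nrm2 mulrCA ler_pM2l ?invr_gt0 ?pi_gt0//.
have fE (u : C -> C) : (sqint u < +oo)%E -> sqint u = (fine (sqint u))%:E.
  by move=> uo; rewrite fineK// ge0_fin_numE ?sqint_ge0.
rewrite -lee_fin EFinM -!fE// -ge0_integralZl//; last 2 first.
- exact: measurable_cabs2.
- by move=> p _; rewrite lee_fin sqr_ge0.
apply: ge0_le_integral => //.
- by move=> p _; rewrite lee_fin sqr_ge0.
- exact: measurable_cabs2.
- by apply: measurable_funeM; exact: measurable_cabs2.
by move=> p /disk_xyE p1; rewrite -EFinM lee_fin fg.
Qed.

Lemma nrm2Z c f : L2 f -> nrm2 (fun z => c * f z) = cabs c ^+ 2 * nrm2 f.
Proof.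
move=> f2; apply: complexI; rewrite -inner_self innerZl ?innerZr//; last exact: L2Z.
by rewrite inner_self mulrA mul_conj (rmorphM (real_complex R) (cabs c ^+ 2) (nrm2 f)).
Qed.

Lemma nrm2_lin (t : R) f g : L2 f -> L2 g ->
  nrm2 (fun z => t%:C * f z + g z) =
  t ^+ 2 * nrm2 f + 2 * t * complex.Re (inner f g) + nrm2 g.
Proof.
move=> f2 g2; have tf2 := L2Z t%:C f2.
have tJ : (t%:C)^*%R = t%:C by exact: conjc_real.
have -> : nrm2 (fun z => t%:C * f z + g z) =
    complex.Re (inner (fun z => t%:C * f z + g z) (fun z => t%:C * f z + g z)).
  by rewrite inner_self.
have tfg2 := L2D tf2 g2.
rewrite innerDl// !innerDr// !innerZl// !innerZr// tJ (innerJ f2 g2) !inner_self.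
case: (inner f g) => x y /=; ring.
Qed.

(* Young's inequality in place of Minkowski's. *)
Lemma nrm2_young (t : R) f g : 0 < t -> L2 f -> L2 g ->
  nrm2 (fun z => f z + g z) <= (1 + t) * nrm2 f + (1 + t^-1) * nrm2 g.
Proof.
move=> t0 f2 g2.
have e1 := nrm2_lin 1 f2 g2.
have e2 := nrm2_lin (- t) f2 g2.
have -> : nrm2 (fun z => f z + g z) = nrm2 (fun z => 1%:C * f z + g z).
  by congr nrm2; apply/funext => z; rewrite mul1r.
have := nrm2_ge0 (fun z => (- t)%:C * f z + g z); rewrite e2 e1.
set F := nrm2 f; set G := nrm2 g; set I := complex.Re _ => h.
have : 0 <= t * F - 2 * I + t^-1 * G.
  have -> : t * F - 2 * I + t^-1 * G = t^-1 * ((- t) ^+ 2 * F + 2 * - t * I + G).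
    by field; rewrite gt_eqF.
  by rewrite mulr_ge0// invr_ge0 ltW.
lra.
Qed.

(** Expansion of [0 <= |u - h|^2], where [inner u h = inner h h]. *)
Lemma nrm2_proj (u : C -> C^o) h : L2 u -> bergman h ->
  (forall k, bergman k -> inner u k = inner h k) -> nrm2 h <= nrm2 u.
Proof.
move=> u2 Hh e; have h2 := bergman_L2 Hh.
have := nrm2_ge0 (fun z => (-1)%:C * h z + u z); rewrite nrm2_lin// (innerJ u2 h2) e// inner_self.
by rewrite cReJ/=; lra.
Qed.

(** * Inversion when [|1 - u phi|^2 <= th < 1] on the disk *)

Section Neumann.
Variables (m : nat) (L : C * C * C) (u : C) (th : R).
Hypotheses (th01 : 0 <= th < 1) (u0 : u != 0).
Hypothesis uth : forall z, cabs z < 1 -> cabs (1 - u * symbol m L z) ^+ 2 <= th.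

Local Notation T := (explicit_toeplitz m L).

(** [f - u T f] is the projection of [(1 - u phi) f]. *)
Lemma residual_contraction f : bergman f ->
  nrm2 (fun z => f z + - u * T f z) <= th * nrm2 f.
Proof.
move=> Hf; have HT := explicit_bergman m L Hf; have H1 := bergmanD Hf (bergmanZ (- u) HT).
have f2 := bergman_L2 Hf; have s2 := symbol_L2 m L Hf.
have g2 := L2D f2 (L2Z (- u) s2).
apply: (@le_trans _ _ (nrm2 (fun z => f z + - u * (symbol m L z * f z)))).
  apply: nrm2_proj => // k Hk; have k2 := bergman_L2 Hk; have T2 := bergman_L2 HT.
  rewrite innerDl//; last exact: L2Z.
  rewrite [RHS]innerDl//; last exact: L2Z.
  by rewrite !innerZl// inner_symbol.
apply: nrm2_le => //; first by case/andP: th01.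
move=> z z1; have -> : f z + - u * (symbol m L z * f z) = (1 - u * symbol m L z) * f z by ring.
by rewrite cabsM exprMn ler_wpM2r ?sqr_ge0// uth.
Qed.

Lemma explicit_inj0 f : bergman f -> T f = 0 -> f = 0.
Proof.
move=> Hf f0; apply: nrm2_eq0 => //; have := residual_contraction Hf; rewrite f0.
have -> : (fun z => f z + - u * (0 : C -> C^o) z) = f by apply/funext => z; rewrite mulr0 addr0.
have := nrm2_ge0 f; have /andP[t0 t1] := th01 => h1 h2.
by apply/eqP; rewrite eq_le h1 andbT; nra.
Qed.

(** [f] is the sum of [f - u T f] and [u T f]; the weight [t] in Young's inequality satisfies
    [(1 + t) * th < 1], so the first part can be absorbed. *)
Lemma explicit_below : exists2 K : R, 0 <= K & forall f, bergman f -> nrm2 f <= K * nrm2 (T f).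
Proof.
have /andP[t0 t1] := th01.
pose t := (1 - th) / 2; have tp : 0 < t by rewrite /t; lra.
have ct : 0 < 1 - (1 + t) * th.
  have -> : 1 - (1 + t) * th = (1 - th) * (1 - th / 2) by rewrite /t; field.
  by rewrite mulr_gt0//; lra.
exists ((1 + t^-1) * cabs u ^+ 2 / (1 - (1 + t) * th)).
  by rewrite divr_ge0 ?(ltW ct)// mulr_ge0 ?sqr_ge0// addr_ge0// invr_ge0 ltW.
move=> f Hf; have HT := explicit_bergman m L Hf.
have H1 := bergmanD Hf (bergmanZ (- u) HT).
have := nrm2_young tp (bergman_L2 H1) (bergman_L2 (bergmanZ u HT)).
have -> : (fun z => f z + - u * T f z + u * T f z) = f by apply/funext => z; ring.
rewrite nrm2Z; last exact: bergman_L2.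
have := residual_contraction Hf; set A := nrm2 (fun _ => _) => hA hB.
rewrite mulrAC ler_pdivlMr// mulrBr mulr1 lerBlDr.
have h1 : (1 + t) * A <= (1 + t) * (th * nrm2 f) by rewrite ler_wpM2l//; lra.
apply: le_trans hB _; rewrite addrC lerD//; first by rewrite mulrA.
by apply: le_trans h1 _; rewrite mulrA mulrC.
Qed.

(** The iteration [x_(N+1) = x_N + u (y - T x_N)] from 0; its iterates are the partial sums of the
    series of [(1 - u T)^k (u y)]. *)
Fixpoint neumann (y : C -> C^o) N : C -> C^o :=
  if N is N'.+1 then fun z => neumann y N' z + u * (y z + - 1 * T (neumann y N') z) else 0.

(** Each step applies [1 - u T] to the residual [y - T x_N]. *)
Lemma neumann_residual y N : bergman y -> bergman (neumann y N) /\
  nrm2 (fun z => y z + - 1 * T (neumann y N) z) <= th ^+ N * nrm2 y.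
Proof.
move=> Hy; have th0 : 0 <= th by case/andP: th01.
elim: N => [|N [HN IH]] /=.
  split; first exact: bergman0.
  rewrite expr0 mul1r le_eqVlt; apply/orP; left; apply/eqP; congr nrm2; apply/funext => z.
  have := explicitZ m L 0 (@bergman0 R).
  rewrite (_ : (fun z => 0 * _) = 0); last by apply/funext => z'; rewrite mul0r.
  by move=> ->; rewrite mul0r mulr0 addr0.
have HT := explicit_bergman m L HN.
have Hr := bergmanD Hy (bergmanZ (-1) HT).
split; first exact: bergmanD HN (bergmanZ u Hr).
rewrite exprS -mulrA; apply: le_trans (ler_wpM2l th0 IH).
apply: le_trans (residual_contraction Hr).
rewrite (explicitD _ _ HN (bergmanZ u Hr)) explicitZ//.
rewrite le_eqVlt; apply/orP; left; apply/eqP; congr nrm2; apply/funext => z; ring.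
Qed.

Lemma hnormE f : hnorm inner f = Num.sqrt (nrm2 f).
Proof. by rewrite /hnorm inner_self. Qed.

Lemma explicit_surj y : closed_range (bergman (R := R)) inner T -> bergman y ->
  exists2 x, bergman x & T x = y.
Proof.
move=> cr Hy.
have [|x Hx xy] := cr (neumann y) y (fun N => (neumann_residual N Hy).1) Hy; last by exists x.
have th0 : 0 <= th by case/andP: th01.
have h0 : (fun N => th ^+ N * nrm2 y) @ \oo --> (0 : R).
  rewrite -[X in _ --> X](mul0r (nrm2 y)); apply: cvgMl; apply: cvg_expr.
  by rewrite ger0_norm//; case/andP: th01.
have : (fun N => Num.sqrt (th ^+ N * nrm2 y)) @ \oo --> (0 : R).
  by rewrite -[X in _ --> X](sqrtr0 R); apply: (@continuous_cvg nat R R \oo _ (fun N => th ^+ N * nrm2 y) Num.sqrt 0) => //; exact: sqrt_continuous.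
apply: squeeze_cvgr (cvg_cst (0 : R)) => //; apply: nearW => N.
rewrite hnormE sqrtr_ge0/= ler_wsqrtr//.
have [HN] := neumann_residual N Hy; apply: le_trans.
have HT := explicit_bergman m L HN.
have Hr := bergmanD Hy (bergmanZ (-1) HT).
have -> : nrm2 (T (neumann y N) - y) = nrm2 (fun z => -1 * (y z + -1 * T (neumann y N) z)).
  by congr nrm2; apply/funext => z; rewrite !mulN1r opprB.
by rewrite nrm2Z ?cabsN ?cabs1 ?expr1n ?mul1r//; exact: bergman_L2.
Qed.

Lemma explicit_invertible (T' : (C -> C^o) -> (C -> C^o)) :
  (forall f, bergman f -> T' f = T f) ->
  closed_range (bergman (R := R)) inner T -> invertible (bergman (R := R)) inner T'.
Proof.
move=> T'E cr.
have inj f g : bergman f -> bergman g -> T f = T g -> f = g.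
  move=> Hf Hg e.
  have : (fun z => f z + -1 * g z) = 0 :> (C -> C^o).
    apply: explicit_inj0; first exact: bergmanD Hf (bergmanZ _ Hg).
    rewrite explicitD//; last exact: bergmanZ.
    by rewrite explicitZ// e; apply/funext => z; rewrite mulN1r subrr.
  move=> d0; apply/funext => z; have := congr1 (fun u : C -> C^o => u z) d0.
  by rewrite mulN1r => /eqP; rewrite subr_eq0 => /eqP.
(* The selection of preimages requires a total relation; outside the Bergman space it holds
   vacuously. *)
have ex (y : C -> C^o) : exists x : C -> C^o, bergman y -> bergman x /\ T x = y.
  have [Hy|nHy] := pselect (bergman y); last by exists y.
  by have [x Hx xy] := explicit_surj cr Hy; exists x.
have [S SP] := choice ex.
exists S; split; last first.
  move=> x Hx; have HT := explicit_bergman m L Hx; rewrite T'E//.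
  have [H1 e1] := SP _ HT; have [H2 e2] := SP _ Hx.
  by split; [exact: inj|rewrite T'E].
split.
- by move=> x /SP[].
- move=> a x y Hx Hy; have [H1 e1] := SP _ Hx; have [H2 e2] := SP _ Hy.
  have Hxy : bergman (a *: x + y) by exact: bergmanD (bergmanZ a Hx) Hy.
  have [H3 e3] := SP _ Hxy; have Haxy := bergmanD (bergmanZ a H1) H2.
  apply: inj => //; rewrite e3 (explicitD _ _ (bergmanZ a H1) H2) explicitZ//.
  by rewrite e1 e2.
have [K K0 HK] := explicit_below; exists (Num.sqrt K) => y Hy.
have [H1 e1] := SP _ Hy; rewrite !hnormE -sqrtrM// ler_wsqrtr//.
by rewrite -{2}e1 HK.
Qed.

End Neumann.
End Contraction.

(** * The regions Omega_0, Omega_1, Omega_2 *)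

Section Regions.
Context {R : realType}.
Local Notation C := (R[i]).
Implicit Types (L : C * C * C) (k p q s t : C).

Lemma norm_lt1 t : (`|t| < 1) = (cabs t < 1).
Proof. by rewrite normCE -(ltcR (cabs t)). Qed.

Lemma norm_eq1 t : `|t| = 1 <-> cabs t = 1.
Proof. by rewrite normCE; split=> [/complexI|->]. Qed.

Lemma quadratic_root al be ga t : root (quadratic (al, be, ga)) t = (al * t ^+ 2 + be * t + ga == 0).
Proof. by rewrite /root /quadratic !hornerE. Qed.

(* The coefficients of alpha t^2 + beta t + gamma with zeros 1/s1, 1/s2 (param0), p, 1/q
   (param1) or t1, t2 (param2); a vanishing s1, s2 or q accounts for a drop in degree. *)
Definition param0 k s1 s2 : C * C * C := (k * (s1 * s2), - (k * (s1 + s2)), k).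
Definition param1 k p q : C * C * C := (- (k * q), k * (1 + p * q), - (k * p)).
Definition param2 k t1 t2 : C * C * C := (k, - (k * (t1 + t2)), k * (t1 * t2)).

Lemma quadratic_split L : quadratic L != 0 ->
  [\/ exists2 c, c != 0 & L = (0, 0, c) /\ zeros (quadratic L) = [::],
      exists2 c, c != 0 & exists t, L = (0, c, - (c * t)) /\ zeros (quadratic L) = [:: t] |
      exists2 c, c != 0 & exists t1 t2, L = param2 c t1 t2 /\ zeros (quadratic L) = [:: t1; t2]].
Proof.
move=> L0; rewrite /zeros; case: closed_field_poly_normal => /= s pE.
set c := lead_coef _ in pE.
have c0 : c != 0 by rewrite lead_coef_eq0.
have [al [be [ga LE]]] : exists al be ga, L = (al, be, ga) by case: L {L0 pE c c0} => -[a b] g; exists a, b, g.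
have q0 : (quadratic L)`_0 = ga by rewrite LE /quadratic !coefD !coefZ coefXn coefX coefC/= !mulr0 !add0r.
have q1 : (quadratic L)`_1 = be by rewrite LE /quadratic !coefD !coefZ coefXn coefX coefC/= mulr0 mulr1 add0r addr0.
have q2 : (quadratic L)`_2 = al by rewrite LE /quadratic !coefD !coefZ coefXn coefX coefC/= mulr0 mulr1 !addr0.
have sz : (size s <= 2)%N.
  have : (size (quadratic L) <= 3)%N.
    apply/leq_sizeP => j j3; rewrite LE /quadratic !coefD !coefZ coefXn coefX coefC.
    by case: j j3 => [|[|[|j]]]//= _; rewrite !mulr0 !addr0.
  by rewrite pE size_scale// size_prod_XsubC.
move: q0 q1 q2; rewrite pE; case: s sz pE => [|t1 [|t2 [|//]]] _ pE.
- rewrite big_nil !coefZ !coef1/= mulr1 !mulr0 => g0 b0 a0.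
  by constructor 1; exists c => //; rewrite LE -a0 -b0 -g0.
- rewrite big_cons big_nil mulr1 !coefZ !coefB !coefX !coefC/= sub0r subr0 mulr1 subrr mulr0 mulrN => g0 b0 a0.
  by constructor 2; exists c => //; exists t1; rewrite LE -a0 -b0 -g0.
rewrite !big_cons big_nil mulr1.
have -> : ('X - t1%:P) * ('X - t2%:P) = 'X^2 - (t1 + t2) *: 'X + (t1 * t2)%:P :> {poly C}.
  by rewrite -mul_polyC polyCD polyCM expr2; ring.
rewrite !coefZ !coefD !coefN !coefZ !coefXn !coefX !coefC/= => g0 b0 a0; constructor 3; exists c => //; exists t1, t2; split=> //.
rewrite LE -a0 -b0 -g0 /param2; congr (_, _, _); ring.
Qed.

Lemma Omega_roots i L : Omega i L ->
  quadratic L != 0 /\ forall t, t \in zeros (quadratic L) -> cabs t != 1.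
Proof.
move=> [_ nr]; have L0 : quadratic L != 0.
  apply/eqP => L0; have := nr 1 (normr1 _).
  by rewrite L0 root0.
split=> // t ts; apply/eqP => /norm_eq1 /nr; move: ts L0.
rewrite /zeros; case: closed_field_poly_normal => /= s pE ts L0.
rewrite pE rootZ ?lead_coef_eq0// root_prod_XsubC ts//.
Qed.

Lemma cabsV_lt1 t : 1 < cabs t -> cabs t^-1 < 1.
Proof. by move=> t1; rewrite cabsV invf_lt1// (lt_trans ltr01). Qed.

(** A zero outside the closed disk enters through its inverse, so all parameters lie in the open
    disk. That [i] is 0, 1 or 2 is part of the conclusion. *)
Lemma Omega_cases i L : Omega i L ->
  [\/ i = 0%N /\ exists k s1 s2, [/\ k != 0, cabs s1 < 1, cabs s2 < 1 & L = param0 k s1 s2],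
      i = 1%N /\ exists k p q, [/\ k != 0, cabs p < 1, cabs q < 1 & L = param1 k p q] |
      i = 2%N /\ exists k t1 t2, [/\ k != 0, cabs t1 < 1, cabs t2 < 1 & L = param2 k t1 t2]].
Proof.
move=> OL; have [L0 nT] := Omega_roots OL; case: OL => ci _; move: ci nT.
have gt t : cabs t != 1 -> (cabs t < 1) = false -> 1 < cabs t /\ t != 0.
  move=> t1 /negbT; rewrite -leNgt le_eqVlt eq_sym (negbTE t1)/= => h; split=> //.
  by rewrite -cabs_eq0 gt_eqF// (lt_trans ltr01).
have z1 : cabs (0 : C) < 1 by rewrite cabs0.
have [[c c0 [LE ->]]|[c c0 [t [LE ->]]]|[c c0 [t1 [t2 [LE ->]]]]] := quadratic_split L0.
- move=> <- _; constructor 1; split=> //; exists c, 0, 0; split=> //.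
  by rewrite LE /param0 mulr0 addr0 mulr0 oppr0.
- rewrite /= addn0 norm_lt1 => <- /(_ t); rewrite inE eqxx => /(_ isT) t1.
  case: (boolP (cabs t < 1)) => [tl|/negbTE tl].
    constructor 2; split=> //; exists c, t, 0; split=> //.
    by rewrite LE /param1 !mulr0 oppr0 addr0 mulr1.
  have [tg t0] := gt t t1 tl; constructor 1; split=> //.
  exists (- (c * t)), t^-1, 0; split=> //; first by rewrite oppr_eq0 mulf_neq0.
    exact: cabsV_lt1.
  by rewrite LE /param0 !mulr0 addr0 mulNr opprK mulfK.
rewrite /= addn0 !norm_lt1 => <- nT.
have n1 : cabs t1 != 1 by apply: nT; rewrite inE eqxx.
have n2 : cabs t2 != 1 by apply: nT; rewrite !inE eqxx orbT.
case: (boolP (cabs t1 < 1)) => [l1|/negbTE l1]; case: (boolP (cabs t2 < 1)) => [l2|/negbTE l2].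
- by constructor 3; split=> //; exists c, t1, t2.
- have [g2 t20] := gt t2 n2 l2; constructor 2; split=> //.
  exists (- (c * t2)), t1, t2^-1; split=> //; first by rewrite oppr_eq0 mulf_neq0.
    exact: cabsV_lt1.
  by rewrite LE /param1 /param2; congr (_, _, _); field.
- have [g1 t10] := gt t1 n1 l1; constructor 2; split=> //.
  exists (- (c * t1)), t2, t1^-1; split=> //; first by rewrite oppr_eq0 mulf_neq0.
    exact: cabsV_lt1.
  by rewrite LE /param1 /param2; congr (_, _, _); field.
have [g1 t10] := gt t1 n1 l1; have [g2 t20] := gt t2 n2 l2; constructor 1; split=> //.
exists (c * (t1 * t2)), t1^-1, t2^-1; split; rewrite ?mulf_neq0 ?cabsV_lt1//.
by rewrite LE /param0 /param2; congr (_, _, _); field; rewrite t10 t20.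
Qed.

Definition ineq0 L := let: (al, be, ga) := L in
  cabs (al * be^*%R - be * ga^*%R) < cabs ga ^+ 2 - cabs al ^+ 2.
Definition ineq1 L := let: (al, be, ga) := L in
  2 * cabs al ^+ 2 + 2 * cabs ga ^+ 2 < cabs be ^+ 2 + cabs (be ^+ 2 - 4 * al * ga).
Definition ineq2 L := let: (al, be, ga) := L in
  cabs (al * be^*%R - be * ga^*%R) < cabs al ^+ 2 - cabs ga ^+ 2.

Lemma cabs_unit_ineq (a b : R) : 0 <= a < 1 -> 0 <= b < 1 ->
  0 < (1 - a * b) * ((1 - a) * (1 - b)) /\ a * (1 - b ^+ 2) + b * (1 - a ^+ 2) =
   1 - (a * b) ^+ 2 - (1 - a * b) * ((1 - a) * (1 - b)).
Proof.
move=> /andP[a0 a1] /andP[b0 b1]; split; last by ring.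
by rewrite !mulr_gt0 ?subr_gt0// mulr_ilt1.
Qed.

(** Triangle inequality and the identity of [cabs_unit_ineq]. The last product is kept as an
    explicit gap because it becomes the distance [d] in [symbol_halfplane]. *)
Lemma cabs_pq_le p q : cabs p < 1 -> cabs q < 1 ->
  cabs (p^*%R * (1 - q * q^*%R) + q * (1 - p * p^*%R)) <=
  1 - (cabs p * cabs q) ^+ 2 - (1 - cabs p * cabs q) * ((1 - cabs p) * (1 - cabs q)).
Proof.
move=> p1 q1; have p0 := cabs_ge0 p; have q0 := cabs_ge0 q.
have [_ <-] := @cabs_unit_ineq (cabs p) (cabs q) (introT andP (conj p0 p1)) (introT andP (conj q0 q1)).
have rc (x : C) : cabs x < 1 -> cabs (1 - x * x^*%R) = 1 - cabs x ^+ 2.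
  move=> x1; rewrite mul_conj -(rmorph1 (real_complex R)) -rmorphB cabs_real ger0_norm//.
  by rewrite subr_ge0 exprn_ile1// ?cabs_ge0// ltW.
by rewrite (le_trans (cabs_triangle _ _))// !cabsM !rc// cabsJ.
Qed.

Lemma cabs_pq_lt p q : cabs p < 1 -> cabs q < 1 ->
  cabs (p^*%R * (1 - q * q^*%R) + q * (1 - p * p^*%R)) < 1 - (cabs p * cabs q) ^+ 2.
Proof.
move=> p1 q1; apply: le_lt_trans (cabs_pq_le p1 q1) _.
have [h _] := @cabs_unit_ineq (cabs p) (cabs q) (introT andP (conj (cabs_ge0 p) p1)) (introT andP (conj (cabs_ge0 q) q1)).
by rewrite ltrBlDr ltrDl.
Qed.

Lemma ineq2_param k t1 t2 : k != 0 -> cabs t1 < 1 -> cabs t2 < 1 -> ineq2 (param2 k t1 t2).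
Proof.
move=> k0 h1 h2; rewrite /ineq2 /param2.
have -> : k * (- (k * (t1 + t2)))^*%R - - (k * (t1 + t2)) * (k * (t1 * t2))^*%R =
   - (k * k^*%R * ((t1^*%R * (1 - t2 * t2^*%R)) + (t2^*%R * (1 - t1 * t1^*%R)))).
  by rewrite conjcN !conjcM conjcD; ring.
have kp : 0 < cabs k ^+ 2 by rewrite exprn_gt0// lt_neqAle eq_sym cabs_eq0 k0 cabs_ge0.
rewrite cabsN cabsM mul_conj cabs_real ger0_norm ?sqr_ge0//.
have -> : cabs k ^+ 2 - cabs (k * (t1 * t2)) ^+ 2 = cabs k ^+ 2 * (1 - (cabs t1 * cabs t2) ^+ 2).
  by rewrite !cabsM; ring.
rewrite ltr_pM2l//.
have := @cabs_pq_lt t1 t2^*%R h1; rewrite cabsJ conjCK [t2^*%R * t2]mulrC; exact.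
Qed.

(** Reversing the polynomial, [t |-> 1 / t], exchanges [al] and [ga]. *)
Lemma ineq_swap al be ga : ineq0 (al, be, ga) <-> ineq2 (ga, be, al).
Proof.
rewrite /ineq0 /ineq2 -(cabsJ (ga * _ - _)) conjcD conjcN !conjcM !conjCK.
by rewrite [be^*%R * al]mulrC [ga^*%R * be]mulrC cabsB.
Qed.

Lemma ineq0_param k s1 s2 : k != 0 -> cabs s1 < 1 -> cabs s2 < 1 -> ineq0 (param0 k s1 s2).
Proof. by move=> k0 h1 h2; apply/ineq_swap; exact: ineq2_param. Qed.

Lemma parallelogram (x y : C) : cabs (x + y) ^+ 2 + cabs (x - y) ^+ 2 = 2 * cabs x ^+ 2 + 2 * cabs y ^+ 2.
Proof. by rewrite !sqr_cabs !cReD !cImD cReN cImN; ring. Qed.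

(** The discriminant is the square of [k (1 - p q)]; the parallelogram law for [1 + p q] and
    [1 - p q] reduces the claim to [(1 - |p|^2) (1 - |q|^2) > 0]. *)
Lemma ineq1_param k p q : k != 0 -> cabs p < 1 -> cabs q < 1 -> ineq1 (param1 k p q).
Proof.
move=> k0 p1 q1; rewrite /ineq1 /param1.
have -> : (k * (1 + p * q)) ^+ 2 - 4 * - (k * q) * - (k * p) = (k * (1 - p * q)) ^+ 2 by ring.
rewrite cabsX; have kp : 0 < cabs k ^+ 2 by rewrite exprn_gt0// lt_neqAle eq_sym cabs_eq0 k0 cabs_ge0.
rewrite !cabsN !cabsM !exprMn -[ltRHS]mulrDr parallelogram cabs1 cabsM exprMn.
have p2 : cabs p ^+ 2 < 1 by rewrite exprn_ilt1// cabs_ge0.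
have q2 : cabs q ^+ 2 < 1 by rewrite exprn_ilt1// cabs_ge0.
have : 0 < 2 * (cabs k ^+ 2 * ((1 - cabs p ^+ 2) * (1 - cabs q ^+ 2))).
  by apply: mulr_gt0 => //; apply: mulr_gt0 => //; apply: mulr_gt0; rewrite subr_gt0.
lra.
Qed.

(** Here the discriminant is the square of [k (t1 - t2)], and the same law would turn the inequality
    into [|k|^2 (1 - |t1|^2) (1 - |t2|^2) < 0]. *)
Lemma ineq1_param2 k t1 t2 : cabs t1 < 1 -> cabs t2 < 1 -> ~ ineq1 (param2 k t1 t2).
Proof.
move=> h1 h2; rewrite /ineq1 /param2.
have -> : (- (k * (t1 + t2))) ^+ 2 - 4 * k * (k * (t1 * t2)) = (k * (t1 - t2)) ^+ 2 by ring.
rewrite cabsN cabsX !cabsM !exprMn -[ltRHS]mulrDr parallelogram.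
have p2 : cabs t1 ^+ 2 < 1 by rewrite exprn_ilt1// cabs_ge0.
have q2 : cabs t2 ^+ 2 < 1 by rewrite exprn_ilt1// cabs_ge0.
have : 0 <= 2 * (cabs k ^+ 2 * ((1 - cabs t1 ^+ 2) * (1 - cabs t2 ^+ 2))).
  by do 2![apply: mulr_ge0; rewrite ?sqr_ge0//]; apply: mulr_ge0; rewrite subr_ge0 ltW.
by move=> h h3; lra.
Qed.

Lemma ineq1_swap al be ga : ineq1 (al, be, ga) <-> ineq1 (ga, be, al).
Proof. by rewrite /ineq1 addrC [4 * ga * al]mulrAC. Qed.

(** With [a = |p|], [b = |q|] and [X] the left side divided by [|k|^2], the triangle inequality
    gives [X >= (b - a) (1 + a b)]. The inequality would mean [X < b^2 - a^2], which forces [a < b]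
    and contradicts [1 + a b >= a + b]. *)
Lemma ineq2_param1 k p q : cabs p < 1 -> cabs q < 1 -> ~ ineq2 (param1 k p q).
Proof.
move=> p1 q1; rewrite /ineq2 /param1.
have -> : - (k * q) * (k * (1 + p * q))^*%R - k * (1 + p * q) * (- (k * p))^*%R =
  k * k^*%R * (p^*%R * (1 - q * q^*%R) - q * (1 - p * p^*%R)).
  by rewrite conjcN !conjcM conjcD conjcM conjC1; ring.
rewrite cabsM mul_conj cabs_real ger0_norm ?sqr_ge0// !cabsN !cabsM !exprMn -mulrBr => h.
have k2 := sqr_ge0 (cabs k).
move: h.
have [->|kn] := eqVneq (cabs k ^+ 2) 0; first by rewrite !mul0r ltxx.
rewrite ltr_pM2l ?lt_neqAle 1?eq_sym ?kn// => h.
have rc (x : C) : cabs x < 1 -> cabs (1 - x * x^*%R) = 1 - cabs x ^+ 2.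
  move=> x1; rewrite mul_conj -(rmorph1 (real_complex R)) -rmorphB cabs_real ger0_norm//.
  by rewrite subr_ge0 exprn_ile1// ?cabs_ge0// ltW.
have := cabs_triangle (q * (1 - p * p^*%R) - p^*%R * (1 - q * q^*%R)) (p^*%R * (1 - q * q^*%R)).
rewrite subrK cabsB !cabsM !rc// cabsJ.
have p0 := cabs_ge0 p; have q0 := cabs_ge0 q.
move: h; set X := cabs (_ - _); set a := cabs p in p1 p0 *; set b := cabs q in q1 q0 *.
move=> h1 h2; have : 0 <= X by exact: cabs_ge0.
move=> X0; have ba : a < b.
  by rewrite -(@ltr_pXn2r _ 2)// ?nnegrE//; lra.
have : 0 <= (b - a) * ((1 - a) * (1 - b)) by apply: mulr_ge0; last apply: mulr_ge0; rewrite subr_ge0 ltW.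
have : b * (1 - a ^+ 2) - a * (1 - b ^+ 2) = (b - a) * (a + b) + (b - a) * ((1 - a) * (1 - b)).
  by ring.
have : (b - a) * (a + b) = b ^+ 2 - a ^+ 2 by ring.
lra.
Qed.

(** Such a zero gives [be = - (al t + ga conj t)]. The left side of the outer inequalities becomes
    the absolute value of [|ga|^2 - |al|^2], and the parallelogram law makes the middle one an
    equality. *)
Lemma unit_root_ineq al be ga t : cabs t = 1 -> al * t ^+ 2 + be * t + ga = 0 ->
  [/\ ~ ineq0 (al, be, ga), ~ ineq1 (al, be, ga) & ~ ineq2 (al, be, ga)].
Proof.
move=> t1 e; have tt : t * t^*%R = 1 by rewrite mul_conj t1 expr1n.
have beE : be = - (al * t + ga * t^*%R).
  have : t^*%R * (al * t ^+ 2 + be * t + ga) = 0 by rewrite e mulr0.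
  have -> : t^*%R * (al * t ^+ 2 + be * t + ga) = t * t^*%R * (al * t + be) + ga * t^*%R by ring.
  by rewrite tt mul1r => /eqP; rewrite addrAC addrC addr_eq0 => /eqP.
have E : cabs (al * be^*%R - be * ga^*%R) = `|cabs ga ^+ 2 - cabs al ^+ 2|.
  have -> : al * be^*%R - be * ga^*%R = (ga * ga^*%R - al * al^*%R) * t^*%R.
    by rewrite beE conjcN conjcD !conjcM conjCK; ring.
  by rewrite cabsM cabsJ t1 mulr1 !mul_conj -rmorphB cabs_real.
split.
- by rewrite /ineq0 E => /(le_lt_trans (ler_norm _)); rewrite ltxx.
- rewrite /ineq1; have -> : be ^+ 2 - 4 * al * ga = (al * t - ga * t^*%R) ^+ 2.
    have -> : 4 * al * ga = 4 * al * ga * (t * t^*%R) by rewrite tt mulr1.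
    by rewrite beE; ring.
  by rewrite beE cabsN cabsX parallelogram !cabsM cabsJ t1 !mulr1 ltxx.
by rewrite /ineq2 E distrC => /(le_lt_trans (ler_norm _)); rewrite ltxx.
Qed.

Lemma ineq0_neg2 L : ineq0 L -> ~ ineq2 L.
Proof.
case: L => -[al be] ga; rewrite /ineq0 /ineq2 => h1 h2.
by have := cabs_ge0 (al * be^*%R - be * ga^*%R); lra.
Qed.

Lemma Omega_ineq L :
  [/\ Omega 0 L <-> ineq0 L, Omega 1 L <-> ineq1 L & Omega 2 L <-> ineq2 L].
Proof.
have swap1 k p q : ineq0 (param1 k p q) -> ineq2 (param1 k q p).
  by rewrite /param1 mulrC [q * p]mulrC => /ineq_swap; rewrite mulrC.
have dir i : Omega i L -> [\/ [/\ i = 0%N, ineq0 L, ~ ineq1 L & ~ ineq2 L],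
    [/\ i = 1%N, ~ ineq0 L, ineq1 L & ~ ineq2 L] | [/\ i = 2%N, ~ ineq0 L, ~ ineq1 L & ineq2 L]].
  move=> /Omega_cases[[-> [k [s [t [k0 s1 t1 ->]]]]]|[-> [k [s [t [k0 s1 t1 ->]]]]]|[-> [k [s [t [k0 s1 t1 ->]]]]]].
  - have i0 := ineq0_param k0 s1 t1; constructor 1; split=> //; last exact: ineq0_neg2.
    by move=> /ineq1_swap; exact: ineq1_param2.
  - constructor 2; split=> //; [|exact: ineq1_param|exact: ineq2_param1].
    by move=> /swap1; exact: ineq2_param1.
  - have i2 := ineq2_param k0 s1 t1; constructor 3; split=> //; last exact: ineq1_param2.
    by move=> /ineq0_neg2.
have all_cases : ineq0 L \/ ineq1 L \/ ineq2 L -> exists i, Omega i L.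
  (* The index is the number of zeros in the disk itself, so what remains is the absence of zeros on
     the circle. *)
  move=> iL; eexists; split; first by reflexivity.
  move=> t /norm_eq1 t1; apply/negP; case: L iL {dir} => -[al be] ga iL.
  rewrite quadratic_root => /eqP e.
  by have [n0 n1 n2] := unit_root_ineq t1 e; case: iL => [//|[]].
split; split.
- by move=> /dir[[]|[]|[]].
- move=> h; have [i Oi] := all_cases (or_introl h).
  by have [[<-]|[]|[]] := dir i Oi.
- by move=> /dir[[]|[]|[]].
- move=> h; have [i Oi] := all_cases (or_intror (or_introl h)).
  by have [[]|[<-]|[]] := dir i Oi.
- by move=> /dir[[]|[]|[]].
- move=> h; have [i Oi] := all_cases (or_intror (or_intror h)).
  by have [[]|[]|[<-]] := dir i Oi.
Qed.

End Regions.

(** * Index and invertibility *)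

Section Fredholm.
Context {R : realType}.
Local Notation C := (R[i]).
Implicit Types (f g h : C -> C^o) (z w k p q : C) (L : C * C * C).
Variable m : nat.
Hypothesis m_gt0 : (0 < m)%N.

(* The image of the closed disk under the symbol is a filled ellipse with foci k (1 + s)^2 and k (1 - s)^2
   with s^2 = pq, and 1 - conj (pq) is the normal direction at 0 of the confocal
   ellipse through 0. *)
Lemma symbol_halfplane k p q : k != 0 -> cabs p < 1 -> cabs q < 1 ->
  exists u d M, [/\ u != 0, 0 < d, d <= M & forall z, cabs z < 1 ->
    d <= complex.Re (u * symbol m (param1 k p q) z) /\ cabs (u * symbol m (param1 k p q) z) <= M].
Proof.
move=> k0 p1 q1; pose v := 1 - (p * q)^*%R.
pose d := (1 - cabs p * cabs q) * ((1 - cabs p) * (1 - cabs q)).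
have p0 := cabs_ge0 p; have q0 := cabs_ge0 q.
have d0 : 0 < d.
  by have [] := @cabs_unit_ineq _ (cabs p) (cabs q) (introT andP (conj p0 p1)) (introT andP (conj q0 q1)).
have v0 : v != 0.
  rewrite subr_eq0; apply/eqP => /(congr1 cabs); rewrite cabs1 cabsJ cabsM => e.
  have : cabs p * cabs q < 1 by rewrite mulr_ilt1.
  by rewrite -e ltxx.
exists (v / k), d, (d + cabs v * (cabs (1 + p * q) + cabs q + cabs p)).
split=> //; first by rewrite mulf_neq0 ?invr_neq0.
  by rewrite lerDl mulr_ge0 ?addr_ge0 ?cabs_ge0.
move=> z z1; pose w := z ^+ m.
have w1 : cabs w <= 1 by exact: cabsX_le1.
have -> : v / k * symbol m (param1 k p q) z = v * (1 + p * q) + (- (v * q * w) + - (v * p * w^*%R)).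
  rewrite /symbol /param1 -conjcX -/w; field; exact: k0.
split; last first.
  rewrite (le_trans (cabs_triangle _ _))// -[leLHS]add0r lerD ?(ltW d0)//.
  rewrite -[X in _ <= _ * X]addrA [leRHS]mulrDr cabsM lerD// (le_trans (cabs_triangle _ _))// !cabsN !cabsM cabsJ.
  rewrite mulrDr lerD// -[leRHS]mulr1; apply: ler_pM; rewrite ?mulr_ge0 ?cabs_ge0//.
rewrite !cReD !cReN.
have -> : complex.Re (v * (1 + p * q)) = 1 - (cabs p * cabs q) ^+ 2.
  have -> : v * (1 + p * q) = 1 + (p * q - (p * q)^*%R) - p * q * (p * q)^*%R by rewrite /v; ring.
  rewrite mul_conj !cReD !cReN cReJ /= cabsM; ring.
have -> : complex.Re (v * p * w^*%R) = complex.Re ((v * p)^*%R * w).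
  by rewrite -[LHS]cReJ conjcM conjCK.
(* Under the real part the terms in [w] and conj [w] merge into one linear form in [w], whose
   coefficient [cabs_pq_le] bounds. *)
have -> : - complex.Re (v * q * w) + - complex.Re ((v * p)^*%R * w) =
    - complex.Re ((p^*%R * (1 - q * q^*%R) + q * (1 - p * p^*%R)) * w).
  rewrite -opprD -cReD; congr (- complex.Re _).
  by rewrite /v !conjcM conjcD conjcN conjC1 conjcM !conjCK; ring.
have := cabs_pq_le p1 q1; rewrite -/d.
set X := _ + _ => hX; have := ler_Re_cabs (X * w); rewrite cabsM ler_norml => /andP[_ h].
have : cabs X * cabs w <= cabs X by rewrite ler_piMr ?cabs_ge0.
by move: hX h; lra.
Qed.

(** If [Re X >= d] and [|X| <= M], then [|1 - e X|^2 <= 1 - 2 e d + e^2 M^2], minimal at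
    [e = d / M^2] with value [1 - (d / M)^2]. *)
Lemma symbol_contraction k p q : k != 0 -> cabs p < 1 -> cabs q < 1 ->
  exists u th, [/\ u != 0, 0 <= th < 1 & forall z, cabs z < 1 ->
    cabs (1 - u * symbol m (param1 k p q) z) ^+ 2 <= th].
Proof.
move=> k0 p1 q1; have [u [d [M [u0 d0 dM h]]]] := symbol_halfplane k0 p1 q1.
have M0 : 0 < M by exact: lt_le_trans dM.
pose e := d / M ^+ 2; have e0 : 0 < e by rewrite divr_gt0// exprn_gt0.
have M2 : M ^+ 2 != 0 by rewrite expf_neq0// gt_eqF.
exists (e%:C * u), (1 - (d / M) ^+ 2); split.
- by rewrite mulf_neq0// (fmorph_eq0 (real_complex R)) gt_eqF.
- have dM0 : 0 < d / M by rewrite divr_gt0.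
  rewrite subr_ge0 gtrBl exprn_gt0// exprn_ile1 ?(ltW dM0)// ler_pdivrMr// mul1r dM//.
move=> z z1; have [h1 h2] := h z z1; rewrite -mulrA.
set X := u * _ in h1 h2 *.
have -> : cabs (1 - e%:C * X) ^+ 2 = 1 - 2 * e * complex.Re X + e ^+ 2 * cabs X ^+ 2.
  by rewrite !sqr_cabs; case: X {h1 h2} => x y /=; ring.
have h3 : cabs X ^+ 2 <= M ^+ 2 by rewrite lerXn2r ?nnegrE ?cabs_ge0 ?(ltW M0).
have h4 : e ^+ 2 * cabs X ^+ 2 <= e ^+ 2 * M ^+ 2 by rewrite ler_wpM2l ?sqr_ge0.
have h5 : 2 * e * d <= 2 * e * complex.Re X by rewrite ler_wpM2l// mulr_ge0// ltW.
have -> : (d / M) ^+ 2 = 2 * e * d - e ^+ 2 * M ^+ 2.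
  by rewrite /e; field; rewrite gt_eqF.
lra.
Qed.

Definition ker_explicit L : set (C -> C^o) :=
  [set f | bergman f /\ explicit_toeplitz m L f = 0].

Lemma kernel_toeplitz L : Defs.kernel (bergman (R := R)) (toeplitz (symbol m L)) = ker_explicit L.
Proof.
by apply/seteqP; split=> f [Hf /= e]; split=> //; move: e; rewrite toeplitzE.
Qed.

Lemma kernel_adjoint L :
  Defs.kernel (bergman (R := R)) (adjoint (bergman (R := R)) inner (toeplitz (symbol m L))) =
  ker_explicit (adj_param L).
Proof.
have aE f : bergman f -> adjoint (bergman (R := R)) inner (toeplitz (symbol m L)) f =
    explicit_toeplitz m (adj_param L) f.
  by move=> Hf; apply: adjointE => // g; exact: toeplitzE.
by apply/seteqP; split=> f [Hf /= e]; split=> //; move: e; rewrite aE.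
Qed.

Lemma bergman_indexE L n n' : has_dim (ker_explicit L) n -> has_dim (ker_explicit (adj_param L)) n' ->
  bergman_index (toeplitz (symbol m L)) = n%:Z - n'%:Z.
Proof.
by move=> /dimE h /dimE h'; rewrite /bergman_index /fredholm_index kernel_toeplitz kernel_adjoint h h'.
Qed.

Lemma adj_param0 k s1 s2 : adj_param (param0 k s1 s2) = param2 k^*%R s1^*%R s2^*%R.
Proof. by rewrite /adj_param /param0 /param2 conjcN !conjcM conjcD. Qed.

Lemma adj_param2 k s1 s2 : adj_param (param2 k s1 s2) = param0 k^*%R s1^*%R s2^*%R.
Proof. by rewrite /adj_param /param0 /param2 conjcN !conjcM conjcD. Qed.

Lemma adj_param1 k p q : adj_param (param1 k p q) = param1 k^*%R q^*%R p^*%R.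
Proof.
by rewrite /adj_param /param1 !conjcN !conjcM conjcD conjcM conjC1 [p^*%R * _]mulrC.
Qed.

Lemma ker_param0 k s1 s2 : k != 0 -> cabs s1 < 1 -> cabs s2 < 1 ->
  has_dim (ker_explicit (param0 k s1 s2)) m.
Proof. by move=> k0 h1 h2; exact: kernel_has_dim. Qed.

Lemma ker_param2 k t1 t2 : k != 0 -> cabs t1 < 1 -> cabs t2 < 1 ->
  has_dim (ker_explicit (param2 k t1 t2)) 0.
Proof. by move=> k0 h1 h2; apply: has_dim0 => f [Hf]; exact: (kernel_trivial m_gt0 k0 h1 h2). Qed.

Lemma ker_param1 k p q : k != 0 -> cabs p < 1 -> cabs q < 1 ->
  has_dim (ker_explicit (param1 k p q)) 0.
Proof.
move=> k0 h1 h2; have [u [th [u0 th01 uth]]] := symbol_contraction k0 h1 h2.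
by apply: has_dim0 => f [Hf]; exact: (explicit_inj0 th01 uth Hf).
Qed.

Lemma conj_neq0 k : k != 0 -> k^*%R != 0.
Proof. by rewrite conjC_eq0. Qed.

Lemma index_Omega0 L : Omega 0 L -> bergman_index (toeplitz (symbol m L)) = m%:Z.
Proof.
case/Omega_cases=> [[_ [k [s [t [k0 s1 t1 ->]]]]]|[]//|[]//].
rewrite (bergman_indexE (n := m) (n' := 0)) ?subr0//; first exact: ker_param0.
by rewrite adj_param0; apply: ker_param2; rewrite ?conj_neq0 ?cabsJ.
Qed.

Lemma index_Omega1 L : Omega 1 L -> bergman_index (toeplitz (symbol m L)) = 0.
Proof.
case/Omega_cases=> [[]//|[_ [k [s [t [k0 s1 t1 ->]]]]]|[]//].
rewrite (bergman_indexE (n := 0) (n' := 0)) ?subr0//; first exact: ker_param1.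
by rewrite adj_param1; apply: ker_param1; rewrite ?conj_neq0 ?cabsJ.
Qed.

Lemma index_Omega2 L : Omega 2 L -> bergman_index (toeplitz (symbol m L)) = - m%:Z.
Proof.
case/Omega_cases=> [[]//|[]//|[_ [k [s [t [k0 s1 t1 ->]]]]]].
rewrite (bergman_indexE (n := 0) (n' := m)) ?sub0r//; first exact: ker_param2.
by rewrite adj_param2; apply: ker_param0; rewrite ?conj_neq0 ?cabsJ.
Qed.

(** Fredholmness of the pencil contributes the closed range; injectivity, dense range and the bound
    on the inverse come from the contraction. *)
Lemma invertible_Omega1 L : bergman_fredholm (pencil m L) -> Omega 1 L ->
  bergman_invertible (toeplitz (symbol m L)).
Proof.
move=> [cr _ _] /Omega_cases[[]//|[_ [k [s [t [k0 s1 t1 LE]]]]]|[]//].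
have [u [th [u0 th01 uth]]] := symbol_contraction k0 s1 t1; rewrite -LE in uth.
apply: (explicit_invertible th01 uth); first by move=> f; exact: toeplitzE.
move=> v y Hv Hy vy; have [|x Hx xy] := cr v y Hv Hy.
  by under eq_fun do rewrite pencilE//.
by exists x => //; rewrite -xy pencilE.
Qed.

End Fredholm.

Theorem theorem5p7 (R : realType) (m : nat) (hm : (1 <= m)%N)
  (hP : ~` (@ess_spectrum R m) =
        @Omega R 0%N `|` @Omega R 1%N `|` @Omega R 2%N) :
  (@Omega R 0%N =
     [set L : R[i] * R[i] * R[i] | let: (alpha, beta, gamma) := L in
       `|gamma| ^+ 2 - `|alpha| ^+ 2 > `|alpha * beta^* - beta * gamma^*| ]
   /\ forall L, @Omega R 0%N L ->
        bergman_index (toeplitz (symbol m L)) = m%:Z)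
  /\
  (@Omega R 1%N =
     [set L : R[i] * R[i] * R[i] | let: (alpha, beta, gamma) := L in
       2 * `|alpha| ^+ 2 + 2 * `|gamma| ^+ 2
         < `|beta| ^+ 2 + `|beta ^+ 2 - 4 * alpha * gamma| ]
   /\ (forall L, @Omega R 1%N L ->
        bergman_index (toeplitz (symbol m L)) = 0)
   /\ (forall L, @Omega R 1%N L ->
        bergman_invertible (toeplitz (symbol m L))))
  /\
  (@Omega R 2%N =
     [set L : R[i] * R[i] * R[i] | let: (alpha, beta, gamma) := L in
       `|alpha| ^+ 2 - `|gamma| ^+ 2 > `|alpha * beta^* - beta * gamma^*| ]
   /\ forall L, @Omega R 2%N L ->
        bergman_index (toeplitz (symbol m L)) = - m%:Z).
Proof.
have e2 (a b : R[i]) : `|a| ^+ 2 - `|b| ^+ 2 = (cabs a ^+ 2 - cabs b ^+ 2)%:C.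
  by rewrite !normCE rmorphB !rmorphXn.
have two : 2 = (2 : R)%:C by rewrite rmorph_nat.
have e1 (a b c d : R[i]) : (2 * `|a| ^+ 2 + 2 * `|b| ^+ 2 < `|c| ^+ 2 + `|d|) =
    (2 * cabs a ^+ 2 + 2 * cabs b ^+ 2 < cabs c ^+ 2 + cabs d).
  by rewrite !normCE two -!rmorphXn -!rmorphM -!rmorphD ltcR.
have inq L := @Omega_ineq R L.
split; [split|split; [split; [|split]|split]].
- apply/seteqP; split=> -[[al be] ga] /=; have [i0 _ _] := inq (al, be, ga);
    by rewrite e2 normCE ltcR => /i0.
- by move=> L; exact: index_Omega0.
- apply/seteqP; split=> -[[al be] ga] /=; have [_ i1 _] := inq (al, be, ga);
    by rewrite e1 => /i1.
- by move=> L; exact: index_Omega1.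
- move=> L O1; apply: invertible_Omega1 => //.
  (* The description of the complement of the essential spectrum turns membership in the region into
     Fredholmness. *)
  have : (~` @ess_spectrum R m) L by rewrite hP; left; right.
  by move=> /contrapT.
- apply/seteqP; split=> -[[al be] ga] /=; have [_ _ i2] := inq (al, be, ga);
    by rewrite e2 normCE ltcR => /i2.
- by move=> L; exact: index_Omega2.
Qed.
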